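(* Let $p\ge 0$ be a fixed integer and suppose $\log N=o(T^{1/5})$ as $N\to\infty$. Let $\epsilon_1,\dots,\epsilon_N$ be i.i.d. random vectors in $\mathbb R^T$ such that the entries $\epsilon_{i1},\dots,\epsilon_{iT}$ of $\epsilon_i$ are i.i.d. continuous random variables with $E\epsilon_{11}=0$, $\mathrm{Var}(\epsilon_{11})>0$, and $Ee^{\omega|\epsilon_{11}|}<\infty$ for some $\omega>0$. Let $L_N=\max_{1\le i<j\le N}|\hat\rho_{ij}|$. Then, as $N\to\infty$, $TL_N^2-4\log N+\log\log N$ converges weakly to the distribution with distribution function $F(y)=\exp(-e^{-y/2}/\sqrt{8\pi})$, $y\in\mathbb R$.
   Context: A prime denotes transpose and $\|\cdot\|$ is the Euclidean norm. For each $N$, $T=T_N>p$ is an integer depending on $N$. For $i=1,\dots,N$, $x_i$ is a non-random real $T\times p$ matrix (it may depend on $N$) with $x_i'x_i$ invertible, and $P_i=I_T-x_i(x_i'x_i)^{-1}x_i'$; when $p=0$, $P_i=I_T$. For random vectors $\epsilon_i=(\epsilon_{i1},\dots,\epsilon_{iT})'\in\mathbb R^T$ (the errors in the linear regressions $y_i=x_i\beta_i+\epsilon_i$, whose OLS residual vectors are $P_i\epsilon_i$), the sample correlation coefficients of the residuals are $$\hat\rho_{ij}=\frac{\epsilon_i'P_iP_j\epsilon_j}{\|P_i\epsilon_i\|\,\|P_j\epsilon_j\|}.$$ A random variable $V$ is called continuous if $P(V=v)=0$ for every $v\in\mathbb R$. The common distribution of the $\epsilon_{it}$ does not depend on $N$.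 *)

(* Defs.v *)
From HB Require Import structures.
From mathcomp Require Import all_boot all_order all_algebra.
From mathcomp Require Import all_classical all_reals all_analysis.

Set Implicit Arguments.
Unset Strict Implicit.
Unset Printing Implicit Defensive.

Import Order.TTheory GRing.Theory Num.Theory.
Import numFieldNormedType.Exports.

Local Open Scope classical_set_scope.
Local Open Scope ring_scope.

(* For a finite family, the product rule over the whole family gives the one
   over each subfamily: take A i = setT for the remaining indices. *)
Definition mutually_independent d d' (Omega : measurableType d)
    (E : measurableType d') (R : realType) (P : probability Omega R)
    (I : finType) (X : I -> Omega -> E) : Prop :=
  forall A : I -> set E, (forall i, measurable (A i)) ->
    P [set w | forall i, A i (X i w)] = (\prod_(i : I) P (X i @^-1` A i))%E.

Definition identically_distributed d d' (Omega : measurableType d)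
    (E : measurableType d') (R : realType) (P : probability Omega R)
    (I : finType) (X : I -> Omega -> E) : Prop :=
  forall (i j : I) (A : set E), measurable A ->
    P (X i @^-1` A) = P (X j @^-1` A).

Definition iid d d' (Omega : measurableType d) (E : measurableType d')
    (R : realType) (P : probability Omega R) (I : finType)
    (X : I -> Omega -> E) : Prop :=
  mutually_independent P X /\ identically_distributed P X.

Definition continuous_rv d (Omega : measurableType d) (R : realType)
    (P : probability Omega R) (V : Omega -> R) : Prop :=
  forall v : R, P [set w | V w = v] = 0%E.

(* Weak convergence of distribution functions, i.e. pointwise convergence at
   the continuity points of the limit; X N may live on its own space. *)
Definition converges_weakly_to_df (R : realType) (d : nat -> measure_display)
    (Omega : forall N, measurableType (d N))
    (P : forall N, probability (Omega N) R)
    (X : forall N, Omega N -> R) (F : R -> R) : Prop :=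
  forall y : R, {for y, continuous F} ->
    P N [set w | X N w <= y] @[N --> \oo] --> (F y)%:E.

(* The canonical norm on matrices in the library is the sup norm. *)
Definition euclidean_norm (R : realType) (n : nat) (v : 'cV[R]_n) : R :=
  Num.sqrt (\sum_(t < n) v t ord0 ^+ 2).

(* For p = 0 the subtracted product is an empty sum, so this is 1%:M. *)
Definition residual_maker (R : realType) (n p : nat) (x : 'M[R]_(n, p)) :
    'M[R]_n :=
  1%:M - x *m invmx (x^T *m x) *m x^T.

Definition residual_corr (R : realType) (n p : nat) (x1 x2 : 'M[R]_(n, p))
    (e1 e2 : 'cV[R]_n) : R :=
  (e1^T *m residual_maker x1 *m residual_maker x2 *m e2) ord0 ord0 /
  (euclidean_norm (residual_maker x1 *m e1) *
   euclidean_norm (residual_maker x2 *m e2)).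

(* The default value 0 is harmless for N >= 2, all the terms being
   nonnegative. *)
Definition max_residual_corr (R : realType) (N n p : nat)
    (x : 'I_N -> 'M[R]_(n, p)) (e : 'I_N -> 'cV[R]_n) : R :=
  \big[Num.max/0]_(ij : 'I_N * 'I_N | (ij.1 < ij.2)%N)
    `|residual_corr (x ij.1) (x ij.2) (e ij.1) (e ij.2)|.

Definition col_of_tuple (R : realType) (n : nat) (u : n.-tuple R) : 'cV[R]_n :=
  \col_t tnth u t.

(* Main.v *)
(* The event T * L_N ^+ 2 <= y ^+ 2 says that none of the events
   A_ij = {y ^+ 2 < T * rho_ij ^+ 2}, i < j, occurs. Events with disjoint index pairs are
   independent, so the Chen-Stein method reduces the theorem to N^2 P(A_ij) / 2 -> lam and
   N^3 P(A_ij and A_ik) -> 0 for y^2 = 4 log N - log log N + a, both uniformly in i, j, k.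
   Put s = T^(1/10). Outside an event of probability O(exp(- c s^2)), conditionally on
   eps_i, sqrt(T) rho_ij agrees up to a factor 1 + O(s^-3) with a linear form
   sum_t z_t eps_jt of variance 1 such that sum_t |z_t|^3 = O(s^-5): the hat matrices
   have rank p and change eps_i very little. For y = o(s), sum_t z_t eps_jt exceeds y with
   probability ~ phi(y) / y. This is Lindeberg's replacement argument applied to
   Phi(x / sqrt v), whose derivatives of order k are at most a constant times
   Lam^k exp(theta x + theta^2 v / 2), with tilt theta = y. *)
Require Import Defs.
From HB Require Import structures.
From mathcomp Require Import all_boot all_order all_algebra.
From mathcomp Require Import all_classical all_reals all_analysis.
From mathcomp Require Import measurable_realfun ring lra.
Import Order.TTheory GRing.Theory Num.Theory.
Import numFieldNormedType.Exports.
Local Open Scope classical_set_scope.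
Local Open Scope ring_scope.

(** * Real calculus and Gaussian tails *)

(** The obstacle is that the tail must be known up to a factor 1 + o(1) where it is of order N^-2,
    so every error has to be measured against exp(-y^2/2), not against a constant. The exponential
    weight achieves this: with theta = y it equals exp(-y^2/2) at x = -y, v = 1. Exponential moments
    enter because the weight has to be integrated against the summands, which asks for theta |z_t|
    <= u0.

    The scale s is dictated by log N = o(T^(1/5)) = o(s^2): then y = O(sqrt(log N)) = o(s), and
    exp(-c s^2) is smaller than every power of N, hence beats the N^3 of the Chen-Stein bound. Since
    |z_t| = O(s^-3) and sum |z_t|^3 = O(s^-5), the quantities y^2 max |z_t|, y^5 sum |z_t|^3 and y^2
    s^-3 all tend to 0. The first two are what the tail estimate needs, the third what the passage
    from sqrt(T) rho_ij to the linear form needs.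

    For A_ij and A_ik no joint tail is estimated: once eps_i is fixed outside its exceptional
    events, the two are independent, each of probability O(phi(y)/y + exp(-c s^2)). *)

Section RealCalculus.
Context {R : realType}.
Implicit Types (f g : R -> R) (x y a b : R).

(* Unlike is_derive this is not a typeclass, so that its premises are left to
   the user instead of being searched for. *)
Definition has_deriv (f : R -> R) (x a : R) : Prop := is_derive x 1 f a.

Lemma has_derivD f g x a b : has_deriv f x a -> has_deriv g x b ->
  has_deriv (fun t => f t + g t) x (a + b).
Proof. exact: is_deriveD. Qed.

Lemma has_derivN f x a : has_deriv f x a -> has_deriv (fun t => - f t) x (- a).
Proof. exact: is_deriveN. Qed.

Lemma has_derivM f g x a b : has_deriv f x a -> has_deriv g x b ->
  has_deriv (fun t => f t * g t) x (a * g x + f x * b).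
Proof.
move=> df dg; apply: is_derive_eq (is_deriveM df dg) _.
by rewrite /GRing.scale/= addrC mulrC.
Qed.

Lemma has_deriv_comp f g x a b : has_deriv g x b -> has_deriv f (g x) a ->
  has_deriv (fun t => f (g t)) x (a * b).
Proof. by move=> dg df; exact: is_derive1_comp. Qed.

Lemma has_deriv_id x : has_deriv (fun t : R => t) x 1.
Proof. exact: is_derive_id. Qed.

Lemma has_deriv_cst x (c : R) : has_deriv (fun _ : R => c) x 0.
Proof. exact: is_derive_cst. Qed.

Lemma has_deriv_eq f x a b : has_deriv f x a -> a = b -> has_deriv f x b.
Proof. by move=> ? <-. Qed.

Lemma has_deriv_ext f g x a : f =1 g -> has_deriv f x a -> has_deriv g x a.
Proof. by move=> /funext ->. Qed.

Lemma has_deriv_sqr x : has_deriv (fun t : R => t ^+ 2) x (2 * x).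
Proof.
apply: has_deriv_ext (has_deriv_eq _ _ _ _ (has_derivM _ _ _ _ _
  (has_deriv_id x) (has_deriv_id x)) _) => [t|]; first by rewrite expr2.
by ring.
Qed.

Lemma has_derivV x : x != 0 -> has_deriv (fun t : R => t^-1) x (- x ^- 2).
Proof.
move=> x0; apply: has_deriv_eq.
  exact: (@is_deriveV _ id x _ _ x0 (is_derive_id _ _)).
by rewrite /GRing.scale/= mulr1.
Qed.

Lemma has_deriv_expR x : has_deriv expR x (expR x).
Proof. exact: is_derive_expR. Qed.

Lemma has_deriv_continuous_at f x a : has_deriv f x a -> {for x, continuous f}.
Proof.
by move=> [dfx _]; apply: differentiable_continuous; exact/derivable1_diffP.
Qed.

Lemma MVT_le f f' a b : a <= b ->
  (forall x : R, x \in `[a, b] -> has_deriv f x (f' x)) ->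
  exists2 c, c \in `[a, b] & f b - f a = f' c * (b - a).
Proof.
move=> ab df; have := @MVT_segment R f f' a b ab.
have h (x : R) : x \in `]a, b[ -> is_derive x 1 f (f' x).
  by rewrite in_itv/= => /andP[ax xb]; apply: df; rewrite in_itv/= !ltW.
move/(_ h); suff cf : {within `[a, b], continuous f} by move/(_ cf).
by apply: derivable_within_continuous => x xab; have [] := df x xab.
Qed.

Lemma MVT_between f f' a b :
  (forall x : R, x \in `[Num.min a b, Num.max a b] -> has_deriv f x (f' x)) ->
  exists2 c, c \in `[Num.min a b, Num.max a b] & f b - f a = f' c * (b - a).
Proof.
case: (leP a b) => [ab|/ltW ba] df; first exact: MVT_le.
have [c cab e] := MVT_le _ _ _ _ ba df.
by exists c => //; rewrite -opprB e -mulrN opprB.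
Qed.

Lemma between_itvP (x y z : R) : x \in `[Num.min y z, Num.max y z] ->
  `|x - y| <= `|z - y|.
Proof.
by rewrite in_itv/=; case: (leP y z) => yz /andP[? ?];
  [rewrite !ger0_norm ?subr_ge0// lerB|rewrite !ler0_norm ?subr_le0// ?lerN2 ?lerB// ltW].
Qed.

Lemma between_trans (x y z w : R) : x \in `[Num.min y z, Num.max y z] ->
  w \in `[Num.min y x, Num.max y x] -> w \in `[Num.min y z, Num.max y z].
Proof.
rewrite !in_itv/= => /andP[h1 h2] /andP[h3 h4].
rewrite (le_trans _ h3) ?(le_trans h4)//; first by rewrite ge_max h2 le_max lexx.
by rewrite le_min h1 ge_min lexx.
Qed.

Lemma between_r (y z : R) : z \in `[Num.min y z, Num.max y z].
Proof. by rewrite in_itv/= ge_min le_max lexx !orbT. Qed.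

Lemma increment_bound (g g' : R -> R) (x z K : R) :
  (forall s : R, s \in `[Num.min x z, Num.max x z] -> has_deriv g s (g' s)) ->
  (forall s : R, s \in `[Num.min x z, Num.max x z] -> `|g' s| <= K) ->
  forall s : R, s \in `[Num.min x z, Num.max x z] -> `|g s - g x| <= K * `|z - x|.
Proof.
move=> dg gK s sxz.
have [|c cxs ->] := MVT_between g g' x s.
  by move=> u us; apply: dg; exact: between_trans sxz us.
rewrite normrM; apply: ler_pM => //; last exact: between_itvP.
by apply: gK; exact: between_trans sxz cxs.
Qed.

(* The constant is not the sharp 1/6: the mean value theorem is used three times. *)
Lemma taylor2_bound (f f1 f2 f3 : R -> R) (x h B : R) :
  (forall s, has_deriv f s (f1 s)) -> (forall s, has_deriv f1 s (f2 s)) ->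
  (forall s, has_deriv f2 s (f3 s)) ->
  (forall s : R, s \in `[Num.min x (x + h), Num.max x (x + h)] -> `|f3 s| <= B) ->
  `|f (x + h) - (f x + f1 x * h + f2 x * (h ^+ 2 / 2))| <= B * `|h| ^+ 3.
Proof.
move=> df df1 df2 f3B.
have eh : `|x + h - x| = `|h| by rewrite addrAC subrr add0r.
have dsx s : has_deriv (fun s => s - x) s 1.
  apply: has_deriv_eq (has_derivD _ _ _ _ _ (has_deriv_id s) (has_deriv_cst s (- x))) _.
  by rewrite addr0.
(* The derivative of each remainder is the increment of the next one ([r0] to [r1], [r1] to [f2]),
   so every use of [increment_bound] gains one factor [|h|]. *)
pose r1 s := f1 s - f2 x * (s - x).
have dr1 s : has_deriv r1 s (f2 s - f2 x).
  apply: has_deriv_eq (has_derivD _ _ _ _ _ (df1 s) (has_derivN _ _ _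
    (has_derivM _ _ _ _ _ (has_deriv_cst s (f2 x)) (dsx s)))) _.
  by ring.
pose r0 s := f s - f1 x * (s - x) - f2 x * ((s - x) ^+ 2 / 2).
have dr0 s : has_deriv r0 s (r1 s - r1 x).
  apply: has_deriv_eq.
    apply: has_derivD.
      apply: has_derivD (df s) (has_derivN _ _ _ (has_derivM _ _ _ _ _
        (has_deriv_cst s (f1 x)) (dsx s))).
    apply: has_derivN; apply: has_derivM; first exact: has_deriv_cst.
    apply: has_derivM; last exact: has_deriv_cst.
    exact: (has_deriv_comp (fun t => t ^+ 2) _ _ _ _ (dsx s) (has_deriv_sqr _)).
  by rewrite /r1; field.
have b2 := increment_bound f2 f3 x (x + h) B (fun s _ => df2 s) f3B.
have b1 := increment_bound r1 _ x (x + h) _ (fun s _ => dr1 s) b2.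
have b0 := increment_bound r0 _ x (x + h) _ (fun s _ => dr0 s) b1.
have := b0 _ (between_r x (x + h)).
rewrite /r0 !eh (_ : B * _ ^+ 3 = B * `|h| * `|h| * `|h|); last by ring.
by congr (_ <= _); congr `|_|; ring.
Qed.

(** A nonincreasing function is at least its values further out, and some of these exceed any [- e].
    This replaces a limit at infinity in both Mills inequalities. *)
Lemma nonincr_ge0 f f' : (forall x, 0 < x -> has_deriv f x (f' x)) ->
  (forall x, 0 < x -> f' x <= 0) ->
  (forall x e, 0 < e -> exists2 y, x <= y & - e <= f y) ->
  forall x, 0 < x -> 0 <= f x.
Proof.
move=> df f'0 fge x x0; apply/ler_addgt0Pr => e e0.
have [y xy fy] := fge x _ e0.
have [|c] := MVT_le f f' x y xy.
  by move=> z; rewrite in_itv/= => /andP[xz _]; apply/df/(lt_le_trans x0).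
rewrite in_itv/= => /andP[xc _] fyx.
have : f y - f x <= 0.
  by rewrite fyx mulr_le0_ge0 ?subr_ge0//; apply/f'0/(lt_le_trans x0).
by move: fy; lra.
Qed.

End RealCalculus.

(** * The standard normal distribution function and Mills' ratio *)

Section StandardNormal.
Context {R : realType}.
Implicit Types u : R.

Definition phi (u : R) : R := expR (- (u ^+ 2 / 2)) / Num.sqrt (2 * pi).

Definition Phi (u : R) : R := fine (normal_prob 0 1 `]-oo, u] : \bar R).

Lemma sqrt2pi_gt0 : 0 < Num.sqrt (2 * pi) :> R.
Proof. by rewrite sqrtr_gt0 mulr_gt0 ?pi_gt0. Qed.

Lemma phi_pdf u : phi u = normal_pdf 0 1 u.
Proof.
rewrite normal_pdfE// /normal_peak /normal_fun /phi subr0 expr1n mul1r.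
by rewrite mulr2n mulrDl mul1r mulNr mulrC -mulr2n.
Qed.

Lemma phi_gt0 u : 0 < phi u.
Proof. by rewrite divr_gt0 ?expR_gt0 ?sqrt2pi_gt0. Qed.

Lemma PhiE : Phi = fun u => \int[lebesgue_measure]_(t in `]-oo, u]) (normal_pdf 0 1 t : R).
Proof. by []. Qed.

Lemma has_deriv_Phi u : has_deriv Phi u (phi u).
Proof.
have [||| dF] := @continuous_FTC1 R (normal_pdf 0 1) -oo%O u (u + 1) _ _ (ltNyr _).
- by rewrite ltrDl.
- by apply: (integrableS _ _ (subsetT _)) => //; exact: integrable_normal_pdf.
- by apply: continuous_normal_pdf; exact: oner_neq0.
by rewrite phi_pdf derive1E => <-; rewrite /has_deriv PhiE; exact: derivableP.
Qed.

Lemma has_deriv_phi u : has_deriv phi u (- (u * phi u)).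
Proof.
apply: has_deriv_eq.
  apply: has_derivM; last exact: has_deriv_cst.
  apply: has_deriv_comp; last exact: has_deriv_expR.
  by apply: has_derivN; apply: has_derivM (has_deriv_sqr _) (has_deriv_cst _ _).
by rewrite /phi; have := sqrt2pi_gt0 => /gt_eqF/negbT ?; field.
Qed.

Lemma Phi_ge0 u : 0 <= Phi u.
Proof. exact: fine_ge0. Qed.

Lemma Phi_le1 u : Phi u <= 1.
Proof.
rewrite -lee_fin fineK ?probability_le1//; exact: fin_num_measure.
Qed.

Lemma Phi_nd : {homo Phi : u v / u <= v}.
Proof.
move=> u v uv; apply: fine_le; [exact: fin_num_measure..|].
by apply: le_measure; rewrite ?inE//; exact: subitvPr.
Qed.

(** The identity as a random variable under the normal law: its distribution function is [Phi], so
    the limits of [Phi] at both ends are those of a distribution function. *)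
Let idTR : measurableTypeR R -> R := idfun.

#[local] HB.instance Definition _ :=
  @isMeasurableFun.Build _ _ _ _ idTR (@measurable_id _ _ setT).

Lemma Phi_near1 (e : R) : 0 < e -> exists K, forall u, K <= u -> 1 - e <= Phi u.
Proof.
move=> e0; have := cvg_cdfy1 (idTR : {RV (normal_prob (0 : R) 1) >-> R}).
move=> /fine_cvg/cvgr_ge/(_ (1 - e)); rewrite gtrBl => /(_ e0)[K [_ KP]].
by exists (K + 1) => u Ku; apply: KP; rewrite (lt_le_trans _ Ku)// ltrDl.
Qed.

Lemma Phi_near0 (e : R) : 0 < e -> exists K, forall u, u <= K -> Phi u <= e.
Proof.
move=> e0; have := cvg_cdfNy0 (idTR : {RV (normal_prob (0 : R) 1) >-> R}).
move=> /fine_cvg/cvgr_le/(_ e e0)[K [_ KP]].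
by exists (K - 1) => u Ku; apply: KP; rewrite (le_lt_trans Ku)// gtrBl.
Qed.

(** As phi is even, [Phi v + Phi (- v)] has derivative 0; the limits at infinity identify the
    constant as 1. *)
Lemma PhiN u : Phi (- u) = 1 - Phi u.
Proof.
have cst v : Phi v + Phi (- v) = Phi 0 + Phi 0.
  transitivity (Phi 0 + Phi (- 0)); last by rewrite oppr0.
  apply: (@is_derive_0_is_cst R (fun v => Phi v + Phi (- v))) => w.
  apply: has_deriv_eq.
    apply: has_derivD; first exact: has_deriv_Phi.
    apply: (has_deriv_comp Phi); last exact: has_deriv_Phi.
    by apply: has_derivN; exact: has_deriv_id.
  by rewrite mulrN1 /phi sqrrN subrr.
suff e : Phi 0 + Phi 0 = 1 by have := cst u; lra.
apply/eqP; rewrite eq_le; apply/andP; split; apply/ler_addgt0Pr => e e0.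
- have [K KP] := Phi_near0 _ e0; have := KP _ (lexx _).
  by rewrite -(cst K); have := Phi_le1 (- K); lra.
- have [K KP] := Phi_near1 _ e0; have := KP _ (lexx _).
  by rewrite -(cst K); have := Phi_ge0 (- K); lra.
Qed.

(** The difference of the two sides has derivative - phi(u) / u^2 and is eventually above any
    negative number. *)
Lemma mills_upper u : 0 < u -> 1 - Phi u <= phi u / u.
Proof.
move=> u0; rewrite -subr_ge0.
apply: (@nonincr_ge0 R (fun u => phi u / u - (1 - Phi u))
  (fun u => - (phi u / u ^+ 2))); last exact: u0.
- move=> x x0; apply: has_deriv_eq.
    apply: has_derivD; first apply: has_derivM; first exact: has_deriv_phi.
      by apply: has_derivV; rewrite gt_eqF.
    apply: has_derivN; apply: has_derivD; first exact: has_deriv_cst.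
    by apply: has_derivN; exact: has_deriv_Phi.
  by have /gt_eqF/negbT ? := x0; field.
- by move=> x x0; rewrite oppr_le0 divr_ge0 ?ltW ?phi_gt0 ?exprn_gt0.
- move=> x e e0; have [K KP] := Phi_near1 _ e0.
  exists (Num.max 1 (Num.max x K)); first by rewrite !le_max lexx orbT.
  set y := Num.max _ _.
  have y1 : 1 <= y by rewrite le_max lexx.
  have := KP y; rewrite !le_max lexx !orbT => /(_ isT).
  have : 0 <= phi y / y by rewrite divr_ge0 ?ltW ?phi_gt0// (lt_le_trans _ y1).
  by lra.
Qed.

Lemma phi_le1 u : phi u <= 1.
Proof.
rewrite ler_pdivrMr ?sqrt2pi_gt0// mul1r (@le_trans _ _ 1)//.
  by rewrite -expR0 ler_expR oppr_le0 divr_ge0 ?sqr_ge0.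
rewrite -[leLHS]sqrtr1 ler_wsqrtr//; have := @pi_ge2 R; lra.
Qed.

(** Here the difference has derivative - 3 phi(u) / u^4: the derivative of phi(u) (1/u - 1/u^3) is -
    phi(u) (1 - 3/u^4). *)
Lemma mills_lower u : 0 < u -> phi u * (u^-1 - u^-1 ^+ 3) <= 1 - Phi u.
Proof.
move=> u0; rewrite -subr_ge0.
apply: (@nonincr_ge0 R (fun u => (1 - Phi u) - phi u * (u^-1 - (u^-1 * (u^-1 * u^-1))))
  (fun u => - (3 * phi u / u ^+ 4))); last exact: u0.
- move=> x x0; apply: has_deriv_eq.
    apply: has_derivD; first apply: has_derivD; first exact: has_deriv_cst.
      by apply: has_derivN; exact: has_deriv_Phi.
    have dV : has_deriv (fun x : R => x^-1) x (- x ^- 2) by apply: has_derivV; rewrite gt_eqF.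
    apply: has_derivN; apply: has_derivM; first exact: has_deriv_phi.
    apply: has_derivD; first exact: dV.
    by apply: has_derivN; apply: has_derivM; [exact: dV|apply: has_derivM; exact: dV].
  by have /gt_eqF/negbT ? := x0; field.
- move=> x x0; rewrite oppr_le0; apply: divr_ge0; last exact/exprn_ge0/ltW.
  by apply: mulr_ge0 => //; exact/ltW/phi_gt0.
- move=> x e e0.
  exists (Num.max 1 (Num.max x e^-1)); first by rewrite !le_max lexx orbT.
  set y := Num.max _ _.
  have y1 : 1 <= y by rewrite le_max lexx.
  have y0 : 0 < y by rewrite (lt_le_trans _ y1).
  have ye : y^-1 <= e by rewrite invf_ple ?posrE// !le_max lexx !orbT.
  have := Phi_le1 y; have := phi_le1 y; have := phi_gt0 y => p0 p1 P1.
  have yi0 : 0 < y^-1 by rewrite invr_gt0.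
  have : phi y * (y^-1 - y^-1 * (y^-1 * y^-1)) <= 1 * y^-1.
    rewrite (@le_trans _ _ (phi y * y^-1)) ?ler_wpM2l ?ler_wpM2r ?(ltW p0)//; last exact: ltW.
    by rewrite gerBl !mulr_ge0// ltW.
  by move: P1; lra.
Qed.

End StandardNormal.

(** * The heat equation *)

Section HeatSolution.
Context {R : realType}.
Implicit Types (u v x q theta Lam : R).

(** The solution of the heat equation F_v = F_xx / 2 that starts from a unit step: the probability
    that a centred Gaussian of variance [v] is at most [x]. The next formulas are its derivatives in
    [x], and [heatFvv] is the second derivative in [v]. *)
Definition heatF v x : R := Phi (x / Num.sqrt v).
Definition heatFx v x : R := phi (x / Num.sqrt v) / Num.sqrt v.
Definition heatFxx v x : R := - (x / Num.sqrt v * phi (x / Num.sqrt v)) / v.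
Definition heatFxxx v x : R :=
  ((x / Num.sqrt v) ^+ 2 - 1) * phi (x / Num.sqrt v) / (Num.sqrt v * v).
Definition heatFvv v x : R :=
  (3 * (x / Num.sqrt v) - (x / Num.sqrt v) ^+ 3) * phi (x / Num.sqrt v) / (4 * v ^+ 2).

(** The mean of exp(theta (x + G)) for G centred Gaussian of variance [v], thus again a solution of
    the heat equation. Averaging over a summand therefore moves the weight from [v] to
    [v + m2 * z ^+ 2] at small cost, and the error bounds keep their form during the replacement. *)
Definition expweight theta v x : R := expR (theta * x + theta ^+ 2 * v / 2).

Lemma has_deriv_scale x c : has_deriv (fun x : R => x / c) x c^-1.
Proof.
apply: has_deriv_eq (has_derivM _ _ _ _ _ (has_deriv_id x) (has_deriv_cst x c^-1)) _.
by rewrite mul1r mulr0 addr0.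
Qed.

Lemma has_deriv_heatF v x : 0 < v -> has_deriv (heatF v) x (heatFx v x).
Proof.
by move=> v0; exact: (has_deriv_comp Phi _ _ _ _ (has_deriv_scale _ _) (has_deriv_Phi _)).
Qed.

Lemma has_deriv_heatFx v x : 0 < v -> has_deriv (heatFx v) x (heatFxx v x).
Proof.
move=> v0; apply: has_deriv_eq.
  apply: has_derivM; last exact: has_deriv_cst.
  exact: (has_deriv_comp phi _ _ _ _ (has_deriv_scale _ _) (has_deriv_phi _)).
rewrite /heatFxx mulr0 addr0 -mulrA -invfM -expr2 sqr_sqrtr ?ltW//.
Qed.

Lemma has_deriv_heatFxx v x : 0 < v -> has_deriv (heatFxx v) x (heatFxxx v x).
Proof.
move=> v0; apply: has_deriv_eq.
  apply: has_derivM; last exact: has_deriv_cst.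
  apply: has_derivN; apply: has_derivM; first exact: has_deriv_scale.
  exact: (has_deriv_comp phi _ _ _ _ (has_deriv_scale _ _) (has_deriv_phi _)).
rewrite /heatFxxx; have r0 : Num.sqrt v != 0 by rewrite gt_eqF// sqrtr_gt0.
by have /gt_eqF/negbT ? := v0; field; apply/andP.
Qed.

Lemma has_deriv_ratio v x : 0 < v ->
  has_deriv (fun v => x / Num.sqrt v) v (- (x / Num.sqrt v) / (2 * v)).
Proof.
move=> v0; have r0 : Num.sqrt v != 0 by rewrite gt_eqF// sqrtr_gt0.
apply: has_deriv_eq.
  apply: has_derivM; first exact: has_deriv_cst.
  apply: (has_deriv_comp (fun t => t^-1)); last exact: has_derivV.
  exact: is_derive1_sqrt.
move: (sqr_sqrtr (ltW v0)) r0; move: (Num.sqrt v) => r <- r0; by field.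
Qed.

Lemma has_deriv_heatF_time v x : 0 < v ->
  has_deriv (fun v => heatF v x) v (heatFxx v x / 2).
Proof.
move=> v0; apply: has_deriv_eq.
  exact: (has_deriv_comp Phi _ _ _ _ (has_deriv_ratio _ _ v0) (has_deriv_Phi _)).
have r0 : Num.sqrt v != 0 by rewrite gt_eqF// sqrtr_gt0.
by rewrite /heatFxx; have /gt_eqF/negbT ? := v0; field; apply/andP.
Qed.

Lemma has_deriv_heatFxx_time v x : 0 < v ->
  has_deriv (fun v => heatFxx v x / 2) v (heatFvv v x).
Proof.
move=> v0; have r0 : Num.sqrt v != 0 by rewrite gt_eqF// sqrtr_gt0.
have ? : v != 0 by rewrite gt_eqF.
apply: has_deriv_eq.
  apply: has_derivM; last exact: has_deriv_cst.
  apply: has_derivM; last exact: has_derivV.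
  apply: has_derivN; apply: has_derivM; first exact: has_deriv_ratio.
  exact: (has_deriv_comp phi _ _ _ _ (has_deriv_ratio _ _ v0) (has_deriv_phi _)).
by rewrite /heatFvv; field; apply/andP.
Qed.

Lemma expweight_gt0 theta v x : 0 < expweight theta v x.
Proof. exact: expR_gt0. Qed.

(** Completing the square, - u^2/2 = a u + a^2/2 - w^2/2 with w = |u + a|. The polynomial is
    absorbed by 1 + |u| <= (1 + w) (1 + a), (1 + w)^k <= exp(k w) and k w - w^2/2 <= k^2/2. *)
Lemma phi_poly_bound (k : nat) u a : 0 <= a ->
  (1 + `|u|) ^+ k * phi u <= expR (k%:R ^+ 2 / 2) * (1 + a) ^+ k * expR (a * u + a ^+ 2 / 2).
Proof.
move=> a0; have a1 : 0 <= 1 + a by rewrite addr_ge0.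
set w := `|u + a|; have w0 : 0 <= w by exact: normr_ge0.
have uw : 1 + `|u| <= (1 + w) * (1 + a).
  have : `|u| <= w + a by have := ler_normB (u + a) a; rewrite addrK (ger0_norm a0).
  by have := mulr_ge0 (normr_ge0 (u + a)) a0; rewrite -/w; nra.
have w1 : (1 + w) ^+ k <= expR (k%:R * w).
  rewrite expRM_natl; apply: lerXn2r; rewrite ?nnegrE ?expR_ge0 ?expR_ge1Dx//.
  exact: addr_ge0.
have phiu : phi u <= expR (- (u ^+ 2 / 2)).
  rewrite /phi ler_pdivrMr ?sqrt2pi_gt0// ler_peMr ?expR_ge0//.
  rewrite -[leLHS]sqrtr1 ler_wsqrtr//; have := @pi_ge2 R; lra.
apply: (@le_trans _ _ (((1 + w) * (1 + a)) ^+ k * expR (- (u ^+ 2 / 2)))).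
  apply: ler_pM; rewrite ?exprn_ge0 ?addr_ge0 ?(ltW (phi_gt0 _))//.
  by apply: lerXn2r; rewrite ?nnegrE ?mulr_ge0 ?addr_ge0.
rewrite exprMn [X in _ <= X * _]mulrC -!mulrA [X in X <= _]mulrCA ler_wpM2l ?exprn_ge0//.
rewrite (le_trans (ler_wpM2r (expR_ge0 _) w1))//.
rewrite -!expRD ler_expR.
have : w ^+ 2 = (u + a) ^+ 2 by rewrite /w real_normK ?num_real.
by have := sqr_ge0 (w - k%:R); nra.
Qed.

(** [phi_poly_bound] with a = theta sqrt(v). The lower bound on [v] says Lam sqrt(v) >= 1, so 1 + a
    <= 2 Lam sqrt(v), and each inverse power of sqrt(v) costs one factor Lam. *)
Lemma heat_bound (k : nat) theta Lam v x : 0 < Lam -> 0 <= theta <= Lam ->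
  Lam ^- 2 <= v ->
  (1 + `|x / Num.sqrt v|) ^+ k * phi (x / Num.sqrt v) / Num.sqrt v ^+ k.+1 <=
  expR (k%:R ^+ 2 / 2) * 2 ^+ k * Lam ^+ k.+1 * expweight theta v x.
Proof.
move=> Lam0 /andP[th0 thL] Lv.
have v0 : 0 < v by rewrite (lt_le_trans _ Lv)// invr_gt0 exprn_gt0.
have r0 : 0 < Num.sqrt v by rewrite sqrtr_gt0.
set r := Num.sqrt v; rewrite -/r in r0 *.
have rL : r^-1 <= Lam.
  rewrite invf_ple ?posrE// -(ler_pXn2r (ltn0Sn 1)) ?nnegrE ?invr_ge0 ?(ltW Lam0) ?(ltW r0)//.
  by rewrite exprVn sqr_sqrtr ?(ltW v0).
rewrite ler_pdivrMr ?exprn_gt0//.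
have a0 : 0 <= theta * r by rewrite mulr_ge0// ltW.
apply: le_trans (phi_poly_bound k (x / r) _ a0) _.
have -> : expR (theta * r * (x / r) + (theta * r) ^+ 2 / 2) = expweight theta v x.
  rewrite /expweight -[in RHS](sqr_sqrtr (ltW v0)) -/r; congr expR.
  by have /gt_eqF/negbT ? := r0; field.
have h1 : 1 <= Lam * r by rewrite -ler_pdivrMr// mul1r.
rewrite (_ : _ * r ^+ k.+1 = expR (k%:R ^+ 2 / 2) * (2 ^+ k * (Lam ^+ k.+1 * r ^+ k.+1))
  * expweight theta v x); last by ring.
rewrite ler_wpM2r ?(ltW (expR_gt0 _))// ler_wpM2l ?expR_ge0//.
have -> : 2 ^+ k * (Lam ^+ k.+1 * r ^+ k.+1) = (Lam * r) * (2 * (Lam * r)) ^+ k.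
  by rewrite !exprMn !exprS; ring.
apply: (@le_trans _ _ ((2 * (Lam * r)) ^+ k)).
  apply: lerXn2r; rewrite ?nnegrE ?addr_ge0// ?mulr_ge0 ?(ltW Lam0) ?(ltW r0)//.
  by have := ler_wpM2r (ltW r0) thL; lra.
by apply: ler_peMl => //; rewrite exprn_ge0// ?mulr_ge0 ?(ltW Lam0) ?(ltW r0).
Qed.

Lemma expweight_shift theta v x h : 0 <= theta ->
  expweight theta v (x + h) <= expweight theta v x * expR (theta * `|h|).
Proof.
move=> th0; rewrite -expRD ler_expR mulrDr.
by have := ler_wpM2l th0 (ler_norm h); lra.
Qed.

Lemma expweight_le theta v v' x : v <= v' -> expweight theta v x <= expweight theta v' x.
Proof. by move=> vv'; rewrite ler_expR lerD2l ler_pM2r// ler_wpM2l// sqr_ge0. Qed.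

(** One constant for both derivatives: [heat_bound] gives 4 exp(2) for [heatFxxx] (k = 2) and, after
    the factor 1/4, 2 exp(9/2) for [heatFvv] (k = 3). *)
Definition heatK : R := 4 * expR 5.

Lemma heatK_gt0 : 0 < heatK.
Proof. by rewrite mulr_gt0// expR_gt0. Qed.

Lemma heatFxxx_bound theta Lam v x : 0 < Lam -> 0 <= theta <= Lam ->
  Lam ^- 2 <= v -> `|heatFxxx v x| <= heatK * Lam ^+ 3 * expweight theta v x.
Proof.
move=> Lam0 thL Lv.
have v0 : 0 < v by rewrite (lt_le_trans _ Lv)// invr_gt0 exprn_gt0.
have r0 : 0 < Num.sqrt v by rewrite sqrtr_gt0.
have := heat_bound 2 theta Lam v x Lam0 thL Lv; rewrite /heatFxxx.
move: (x / Num.sqrt v) => u.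
have -> : Num.sqrt v * v = Num.sqrt v ^+ 3 by rewrite exprS sqr_sqrtr// ltW.
rewrite normrM (ger0_norm (_ : 0 <= (_ ^+ 3)^-1)); last by rewrite invr_ge0 exprn_ge0// ltW.
rewrite normrM (gtr0_norm (phi_gt0 u)) => h.
apply: le_trans (le_trans h _).
  rewrite !ler_wpM2r ?invr_ge0 ?exprn_ge0 ?(ltW r0)//; first exact/ltW/phi_gt0.
  rewrite (le_trans (ler_normB _ _))// normr1 normrX.
  by have := normr_ge0 u; nra.
rewrite !ler_wpM2r ?exprn_ge0 ?(ltW Lam0)//; first exact/ltW/expweight_gt0.
rewrite mulrC /heatK; apply: ler_pM; rewrite ?exprn_ge0 ?expR_ge0//.
  by rewrite -natrX.
by rewrite ler_expR; lra.
Qed.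

Lemma heatFvv_bound theta Lam v x : 0 < Lam -> 0 <= theta <= Lam ->
  Lam ^- 2 <= v -> `|heatFvv v x| <= heatK * Lam ^+ 4 * expweight theta v x.
Proof.
move=> Lam0 thL Lv.
have v0 : 0 < v by rewrite (lt_le_trans _ Lv)// invr_gt0 exprn_gt0.
have r0 : 0 < Num.sqrt v by rewrite sqrtr_gt0.
have := heat_bound 3 theta Lam v x Lam0 thL Lv; rewrite /heatFvv.
move: (x / Num.sqrt v) => u.
have -> : v ^+ 2 = Num.sqrt v ^+ 4 by rewrite (exprM _ 2 2) sqr_sqrtr// ltW.
have R4 : 0 <= Num.sqrt v ^+ 4 by rewrite exprn_ge0// ltW.
have -> : `|(3 * u - u ^+ 3) * phi u / (4 * Num.sqrt v ^+ 4)| =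
    4^-1 * (`|3 * u - u ^+ 3| * phi u / Num.sqrt v ^+ 4).
  rewrite normrM normfV normrM (gtr0_norm (phi_gt0 u)) [X in _ / X]ger0_norm ?mulr_ge0//.
  by rewrite invfM; ring.
move=> h.
apply: le_trans (le_trans (ler_wpM2l (_ : 0 <= 4^-1) h) _); last 2 first.
- by [].
- rewrite (_ : 4^-1 * _ = 2 * expR (3 ^+ 2 / 2) * (Lam ^+ 4 * expweight theta v x)); last by field.
  rewrite -[leRHS]mulrA ler_wpM2r ?mulr_ge0 ?exprn_ge0 ?(ltW Lam0) ?(ltW (expweight_gt0 _ _ _))//.
  rewrite /heatK; apply: ler_pM; rewrite ?expR_ge0//; first by lra.
  by rewrite ler_expR; lra.
rewrite ler_wpM2l ?invr_ge0// ler_wpM2r ?invr_ge0// ler_wpM2r ?(ltW (phi_gt0 _))//.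
rewrite (le_trans (ler_normB _ _))// normrM normrX (ger0_norm (_ : (0:R) <= 3))//.
by have := normr_ge0 u; set a := `|u|; move=> a0; have := mulr_ge0 a0 a0; nra.
Qed.

Lemma heat_taylor_space theta Lam v x h : 0 < Lam -> 0 <= theta <= Lam ->
  Lam ^- 2 <= v ->
  `|heatF v (x + h) - (heatF v x + heatFx v x * h + heatFxx v x * (h ^+ 2 / 2))| <=
  heatK * Lam ^+ 3 * expweight theta v x * expR (theta * `|h|) * `|h| ^+ 3.
Proof.
move=> Lam0 /andP[th0 thL] Lv.
have v0 : 0 < v by rewrite (lt_le_trans _ Lv)// invr_gt0 exprn_gt0.
apply: (taylor2_bound (heatF v) (heatFx v) (heatFxx v) (heatFxxx v)).
- by move=> s; exact: has_deriv_heatF.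
- by move=> s; exact: has_deriv_heatFx.
- by move=> s; exact: has_deriv_heatFxx.
move=> s /between_itvP; rewrite addrAC subrr add0r => sx.
apply: le_trans (heatFxxx_bound theta Lam v s Lam0 _ Lv) _; first by rewrite th0.
rewrite -[leRHS]mulrA ler_wpM2l ?mulr_ge0 ?exprn_ge0 ?(ltW heatK_gt0) ?(ltW Lam0)//.
have := expweight_shift theta v x (s - x) th0; rewrite subrKC => ws.
rewrite (le_trans ws)//.
by rewrite ler_wpM2l ?(ltW (expweight_gt0 _ _ _))// ler_expR ler_wpM2l.
Qed.

(** Counterpart of [heat_taylor_space]: for q = m2 z^2 the first-order term here is the mean of the
    second-order term there. The weight sits at [v + q] because it increases with the variance. *)
Lemma heat_taylor_time theta Lam v x q : 0 < Lam -> 0 <= theta <= Lam ->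
  Lam ^- 2 <= v -> 0 <= q ->
  `|heatF (v + q) x - (heatF v x + heatFxx v x * (q / 2))| <=
  heatK * Lam ^+ 4 * expweight theta (v + q) x * q ^+ 2.
Proof.
move=> Lam0 thL Lv q0.
have v0 : 0 < v by rewrite (lt_le_trans _ Lv)// invr_gt0 exprn_gt0.
have vvq : Num.min v (v + q) = v by rewrite min_l// lerDl.
have vvq' : Num.max v (v + q) = v + q by rewrite max_r// lerDl.
pose g w := heatF w x - (heatFxx v x / 2) * (w - v).
have dg w : 0 < w -> has_deriv g w (heatFxx w x / 2 - heatFxx v x / 2).
  move=> w0; apply: has_deriv_eq.
    apply: has_derivD; first exact: has_deriv_heatF_time.
    apply: has_derivN; apply: has_derivM; first exact: has_deriv_cst.
    by apply: has_derivD; [exact: has_deriv_id|exact: has_deriv_cst].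
  by rewrite mul0r add0r addr0 mulr1.
have b1 := increment_bound (fun w => heatFxx w x / 2) (fun w => heatFvv w x) v (v + q)
  (heatK * Lam ^+ 4 * expweight theta (v + q) x).
rewrite vvq vvq' in b1.
have b0 := increment_bound g _ v (v + q) _ _ _ (v + q) _.
rewrite vvq vvq' in b0.
have := b0 _ (heatK * Lam ^+ 4 * expweight theta (v + q) x * `|v + q - v|) _ (b1 _ _) _.
rewrite (addrAC v) subrr add0r (ger0_norm q0) => {b0 b1} h.
rewrite (_ : _ * q ^+ 2 = heatK * Lam ^+ 4 * expweight theta (v + q) x * q * q); last by ring.
have -> : heatF (v + q) x - (heatF v x + heatFxx v x * (q / 2)) = g (v + q) - g v.
  by rewrite /g; move: (heatF (v + q) x) (heatF v x) (heatFxx v x) => a b c; field.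
apply: h.
- by move=> s; rewrite in_itv/= => /andP[vs _]; apply: dg; exact: lt_le_trans vs.
- by move=> s; rewrite in_itv/= => /andP[vs _]; apply: has_deriv_heatFxx_time; exact: lt_le_trans vs.
- move=> s; rewrite in_itv/= => /andP[vs sv].
  apply: le_trans (heatFvv_bound theta Lam s x Lam0 thL (le_trans Lv vs)) _.
  rewrite ler_wpM2l ?mulr_ge0 ?(ltW heatK_gt0)// ?exprn_ge0 ?(ltW Lam0)//.
  exact: expweight_le.
- by rewrite in_itv/= lexx lerDl q0.
Qed.

End HeatSolution.

(** * Independence of blocks *)

Section Independence.
Context {d} {Omega : measurableType d} {R : realType} (P : probability Omega R).

(** The events independent of [B] form a Dynkin system, so independence passes from a generating
    pi-system to its sigma-algebra. [indep_sigma] does this on one side and then on the other. *)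
Lemma indep_sigma_l (G : set (set Omega)) (B : set Omega) :
  setI_closed G -> G `<=` measurable -> measurable B ->
  (forall A, G A -> P (A `&` B) = (P A * P B)%E) ->
  forall A, <<s G >> A -> P (A `&` B) = (P A * P B)%E.
Proof.
move=> GI Gm mB GP.
have sGm A : <<s G >> A -> measurable A.
  by apply: smallest_sub => //; exact: sigma_algebra_measurable.
have hC (A : set Omega) : measurable A -> P (A `&` B) = (P A * P B)%E ->
    P (~` A `&` B) = (P (~` A) * P B)%E.
  move=> mA AB; rewrite setIC -setDE.
  have -> : P (B `\` A) = (P B - P (A `&` B))%E.
    by rewrite setIC; apply: measureD; rewrite // ltey_eq fin_num_measure.
  rewrite AB probability_setC// muleBl ?mul1e ?fin_num_measure//.
have hU (F : (set Omega)^nat) : (forall n, measurable (F n)) -> trivIset setT F ->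
    (forall n, P (F n `&` B) = (P (F n) * P B)%E) ->
    P (\bigcup_k F k `&` B) = (P (\bigcup_k F k) * P B)%E.
  have sP (H : (set Omega)^nat) : (forall n, measurable (H n)) ->
      trivIset setT H -> P (\bigcup_k H k) = (\sum_(0 <= k <oo) P (H k))%E.
    move=> mH tH; apply/esym/cvg_lim => //.
    by apply: measure_semi_sigma_additive => //; exact: bigcup_measurable.
  move=> mF tF FP; rewrite setI_bigcupl !sP//.
  - under eq_eseriesr do rewrite FP.
    have -> : P B = (fine (P B))%:E by rewrite fineK ?fin_num_measure.
    under eq_eseriesr do rewrite muleC.
    by rewrite nneseriesZl// muleC.
  - by move=> n; exact: measurableI.
  - exact: trivIset_setIr.
apply: (@dynkin_induction _ (g_sigma_algebraType G) G
  (fun A => P (A `&` B) = (P A * P B)%E)) => //.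
- by rewrite setTI probability_setT mul1e.
- by move=> A /sGm; exact: hC.
- by move=> F mF; apply: hU => n; apply: sGm; exact: mF.
Qed.

Lemma indep_sigma (G H : set (set Omega)) :
  setI_closed G -> setI_closed H -> G `<=` measurable -> H `<=` measurable ->
  (forall A B, G A -> H B -> P (A `&` B) = (P A * P B)%E) ->
  forall A B, <<s G >> A -> <<s H >> B -> P (A `&` B) = (P A * P B)%E.
Proof.
move=> GI HI Gm Hm GH A B sA sB.
have mA : measurable A.
  by move: A sA; apply: smallest_sub => //; exact: sigma_algebra_measurable.
rewrite setIC muleC; apply: (indep_sigma_l H) sB => // B' HB'.
rewrite setIC muleC; apply: (indep_sigma_l G) sA => //; first exact: Hm.
by move=> A' GA'; exact: GH.
Qed.

End Independence.

Section Blocks.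
Context {d d'} {Omega : measurableType d} {E : measurableType d'} {R : realType}
  (P : probability Omega R) {I : finType} (X : I -> Omega -> E).

Definition block_cylinders (S : pred I) : set (set Omega) :=
  [set C | exists2 A : I -> set E, (forall i, measurable (A i)) &
    C = [set w | forall i, S i -> A i (X i w)]].

(* Omega with the sigma-algebra generated by the X i for i in S. *)
Definition block (S : pred I) := g_sigma_algebraType (block_cylinders S).

Lemma block_cylinders_setI S : setI_closed (block_cylinders S).
Proof.
move=> _ _ [A mA ->] [B mB ->]; exists (fun i => A i `&` B i).
  by move=> i; exact: measurableI.
apply/seteqP; split => w /=; first by move=> [hA hB] i Si; split; [exact: hA|exact: hB].
by move=> h; split => i /h [].
Qed.

Lemma measurable_block_X (S : pred I) i : S i ->
  measurable_fun [set: block S] (X i : block S -> E).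
Proof.
move=> Si _ A mA; rewrite setTI; apply: sub_sigma_algebra.
exists (fun j => if j == i then A else setT) => [j|]; first by case: ifP.
apply/seteqP; split => w /= h.
  by move=> j _; case: eqP => // ->.
by have := h i Si; rewrite eqxx.
Qed.

Hypothesis mX : forall i, measurable_fun [set: Omega] (X i).

Lemma block_cylinders_measurable S : block_cylinders S `<=` measurable.
Proof.
move=> _ [A mA ->].
rewrite (_ : [set w | _] = \bigcap_(i in [set i | S i]) (X i @^-1` A i)); last first.
  by apply/seteqP; split => w /= h i /=; [exact: h|exact: h].
apply: fin_bigcap_measurable; first exact: finite_finset.
by move=> i _; rewrite -[X in measurable X]setTI; exact: mX.
Qed.

Lemma block_measurable S : (@measurable _ (block S) : set (set Omega)) `<=` measurable.
Proof.
apply: smallest_sub; first exact: sigma_algebra_measurable.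
exact: block_cylinders_measurable.
Qed.

Lemma measurable_fun_block {d2} {E2 : measurableType d2} (S : pred I) (f : Omega -> E2) :
  measurable_fun [set: block S] (f : block S -> E2) -> measurable_fun [set: Omega] f.
Proof. by move=> mf _ A mA; apply: (block_measurable S); exact: mf. Qed.

Hypothesis indX : mutually_independent P X.

(** By [indep_sigma] it suffices to treat cylinders. The intersection of a cylinder over [S] and one
    over [S'] is a cylinder over the union, and its probability is a product that splits because the
    index sets are disjoint. *)
Lemma indep_blocks (S S' : pred I) (A B : set Omega) : (forall i, S i -> ~~ S' i) ->
  @measurable _ (block S) A -> @measurable _ (block S') B ->
  P (A `&` B) = (P A * P B)%E.
Proof.
move=> SS'; apply: indep_sigma; try exact: block_cylinders_setI;
  try exact: block_cylinders_measurable.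
have cyl (U : pred I) (C : I -> set E) : (forall i, measurable (C i)) ->
    P [set w | forall i, U i -> C i (X i w)] = (\prod_(i | U i) P (X i @^-1` C i))%E.
  move=> mC; pose C' i := if U i then C i else setT.
  have -> : [set w | forall i, U i -> C i (X i w)] = [set w | forall i, C' i (X i w)].
    apply/seteqP; split => w /= h i; rewrite /C'; first by case: ifPn => // /h.
    by move=> Ui; have := h i; rewrite /C' Ui.
  rewrite indX; last by move=> i; rewrite /C'; case: ifP.
  rewrite [RHS]big_mkcond; apply: eq_bigr => i _; rewrite /C'.
  by case: ifP => // _; rewrite preimage_setT probability_setT.
move=> _ _ [A1 mA1 ->] [B1 mB1 ->].
pose C i := if S i then A1 i else B1 i.
have -> : [set w | forall i, S i -> A1 i (X i w)] `&` [set w | forall i, S' i -> B1 i (X i w)] =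
    [set w | forall i, (fun i => S i || S' i) i -> C i (X i w)].
  apply/seteqP; split => w /=.
    by move=> [h1 h2] i; rewrite /C; case Si: (S i) => /= S'i; [exact: h1|exact: h2].
  move=> h; split=> i Si; have := h i; rewrite /= Si ?orbT => /(_ isT); rewrite /C ?Si//.
  by case S1: (S i) => //; move: (SS' i S1); rewrite Si.
rewrite !cyl//=; last by move=> i; rewrite /C; case: ifP.
rewrite big_mkcond [X in _ = (X * _)%E]big_mkcond [X in _ = (_ * X)%E]big_mkcond -big_split/=.
apply: eq_bigr => i _; rewrite /C; case Si: (S i) => /=; last by rewrite mul1e.
by rewrite (negbTE (SS' _ Si)) mule1.
Qed.

Lemma indep_blocks_fun {d1 d2} {E1 : measurableType d1} {E2 : measurableType d2}
    (S S' : pred I) (Y : Omega -> E1) (Z : Omega -> E2) :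
  (forall i, S i -> ~~ S' i) ->
  measurable_fun [set: block S] (Y : block S -> E1) ->
  measurable_fun [set: block S'] (Z : block S' -> E2) ->
  forall A B, measurable A -> measurable B ->
    P (Y @^-1` A `&` Z @^-1` B) = (P (Y @^-1` A) * P (Z @^-1` B))%E.
Proof.
move=> SS' mY mZ A B mA mB; apply: (indep_blocks S S') => //.
- by rewrite -[X in measurable X]setTI; exact: mY.
- by rewrite -[X in measurable X]setTI; exact: mZ.
Qed.

End Blocks.

Section IndepPair.
Context {d d1 d2} {Omega : measurableType d} {E1 : measurableType d1}
  {E2 : measurableType d2} {R : realType} (P : probability Omega R).
Variables (Y : Omega -> E1) (Z : Omega -> E2).
Hypotheses (mY : measurable_fun [set: Omega] Y) (mZ : measurable_fun [set: Omega] Z).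
Hypothesis ind : forall A B, measurable A -> measurable B ->
  P (Y @^-1` A `&` Z @^-1` B) = (P (Y @^-1` A) * P (Z @^-1` B))%E.

(** Independence on rectangles identifies the joint law with the product of the two laws, and
    Tonelli applies. This takes the place of conditional expectations throughout. *)
Lemma indep_pair_integral (h : E1 * E2 -> \bar R) :
  measurable_fun setT h -> (forall x, 0 <= h x)%E ->
  (\int[P]_w h (Y w, Z w) = \int[P]_w \int[P]_w' h (Y w, Z w'))%E.
Proof.
move=> mh h0.
pose PY : probability E1 R := distribution P (mfun_Sub (mem_set mY)).
pose PZ : probability E2 R := distribution P (mfun_Sub (mem_set mZ)).
have mYZ : measurable_fun [set: Omega] (fun w => (Y w, Z w)).
  exact: measurable_fun_pair.
pose PYZ : probability (E1 * E2)%type R := distribution P (mfun_Sub (mem_set mYZ)).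
have PE A : measurable A -> (PY \x PZ)%E A = PYZ A.
  apply: product_measure_unique => B C mB mC.
  exact: ind.
transitivity (\int[PYZ]_z h z)%E.
  by rewrite ge0_integral_pushforward.
transitivity (\int[PY \x PZ]_z h z)%E.
  by apply: eq_measure_integral => A mA _; apply/esym; exact: PE.
rewrite fubini_tonelli1//.
rewrite ge0_integral_pushforward//; last 2 first.
- exact: measurable_fun_fubini_tonelli_F.
- by move=> x _; exact: integral_ge0.
apply: eq_integral => w _; rewrite /= /fubini_F.
rewrite ge0_integral_pushforward//.
by apply: measurableT_comp => //; exact: measurable_pair1.
Qed.

Lemma indep_pair_prob (C : set (E1 * E2)) : measurable C ->
  P [set w | C (Y w, Z w)] = (\int[P]_w P [set w' | C (Y w, Z w')])%E.
Proof.
move=> mC.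
have mYZ : measurable_fun [set: Omega] (fun w => (Y w, Z w)).
  exact: measurable_fun_pair.
have := @indep_pair_integral (fun z => (\1_C z)%:E); rewrite /=.
have mI : measurable_fun setT (fun z => (\1_C z)%:E : \bar R).
  by apply/measurable_EFinP; exact: measurable_indic.
move=> /(_ mI) h; move: h.
have -> : (\int[P]_w (\1_C (Y w, Z w))%:E)%E = P [set w | C (Y w, Z w)].
  rewrite (eq_integral (fun w => (\1_[set w | C (Y w, Z w)] w)%:E)); last first.
    by move=> w _; rewrite !indicE; congr ((nat_of_bool _)%:R%:E); apply/idP/idP => /set_mem h; apply/mem_set.
  by rewrite integral_indic ?setIT// -[X in measurable X]setTI; exact: mYZ.
move=> ->; last by move=> z; rewrite lee_fin.
apply: eq_integral => w _.
have mYw : measurable_fun [set: Omega] (fun w' => (Y w, Z w')).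
  exact: measurable_fun_pair.
rewrite (eq_integral (fun w' => (\1_[set w' | C (Y w, Z w')] w')%:E)); last first.
  by move=> w' _; rewrite !indicE; congr ((nat_of_bool _)%:R%:E); apply/idP/idP => /set_mem h; apply/mem_set.
by rewrite integral_indic ?setIT// -[X in measurable X]setTI; exact: mYw.
Qed.

End IndepPair.

(** * Moderate deviations of weighted sums *)

Section Expectation.
Context {d} {Omega : measurableType d} {R : realType} (P : probability Omega R).

Lemma integrable_le (f g : Omega -> R) : measurable_fun setT f ->
  (forall w, `|f w| <= g w) -> P.-integrable setT (EFin \o g) ->
  P.-integrable setT (EFin \o f).
Proof.
move=> mf fg; apply: le_integrable => //; first exact/measurable_EFinP.
by move=> w _; rewrite /= lee_fin (le_trans (fg w))// ler_norm.
Qed.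

Lemma integrable_bounded (f : Omega -> R) (c : R) : measurable_fun setT f ->
  (forall w, `|f w| <= c) -> P.-integrable setT (EFin \o f).
Proof.
move=> mf fc; apply: (integrable_le _ (cst c)) => //.
exact: finite_measure_integrable_cst.
Qed.

Lemma EFin_Rintegral (f : Omega -> R) : P.-integrable setT (EFin \o f) ->
  (\int[P]_w (f w)%:E = (\int[P]_w f w)%:E)%E.
Proof. by move=> fi; rewrite fineK//; exact: integrable_fin_num. Qed.

Lemma Rintegral_cst1 (r : R) : \int[P]_w r = r.
Proof.
by rewrite Rintegral_cst//= (_ : _ setT = 1%E) ?mulr1//; exact: probability_setT.
Qed.

Lemma measurable_set_ge (f : Omega -> R) (a : R) : measurable_fun setT f ->
  measurable [set w | a <= f w].
Proof.
move=> mf; have := mf measurableT `[a, +oo[%classic (measurable_itv _).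
by rewrite setTI; congr measurable; apply/seteqP; split => w /=; rewrite in_itv/= andbT.
Qed.

Lemma markov_exp (f : Omega -> R) (a r : R) : measurable_fun setT f ->
  (\int[P]_w (expR (f w))%:E <= r%:E)%E ->
  (P [set w | (a <= f w)%R] <= (expR (- a) * r)%:E)%E.
Proof.
move=> mf fr.
have mA := measurable_set_ge f a mf.
have mef : measurable_fun setT (fun w => (expR (f w))%:E : \bar R).
  by apply/measurable_EFinP; exact: measurableT_comp.
rewrite EFinM -lee_pdivrMl ?expR_gt0// -expRN opprK.
apply: le_trans fr.
rewrite -(setIT [set w | a <= f w]) -integral_indic// -ge0_integralZl//; try by rewrite lee_fin expR_ge0.
  2: by apply/measurable_EFinP; exact: measurable_indic.
apply: ge0_le_integral => //.
- apply/measurable_EFinP; apply: measurable_funM => //; exact: measurable_indic.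
move=> w _; rewrite -EFinM lee_fin indicE; case: (boolP (w \in _)) => [|_].
  by rewrite inE/= mulr1 ler_expR.
by rewrite mulr0 expR_ge0.
Qed.

End Expectation.

(** * Moments of the common law and a single replacement step *)

Section Moments.
Context {R : realType} (mu : probability R R) (u0 : R).
Hypotheses (u0gt0 : 0 < u0)
  (int2 : mu.-integrable setT (fun x : R => (expR (2 * u0 * `|x|))%:E)).

(** The k-th power of t/k <= exp(t/k). *)
Lemma pow_le_exp (k : nat) (t : R) : 0 <= t -> t ^+ k <= k%:R ^+ k * expR t.
Proof.
case: k => [|k] t0; first by rewrite !expr0 mul1r -expR0 ler_expR.
have -> : expR t = expR (t / k.+1%:R) ^+ k.+1.
  by rewrite -expRM_natl mulrC divfK.
rewrite -exprMn mulrC.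
apply: lerXn2r; rewrite ?nnegrE ?mulr_ge0 ?expR_ge0//.
rewrite -ler_pdivrMr// (le_trans _ (expR_ge1Dx _))//.
by rewrite lerDr.
Qed.

Lemma measurable_exp_norm (u : R) : measurable_fun setT (fun x : R => expR (u * `|x|)).
Proof.
by apply: measurableT_comp => //; apply: measurable_funM => //; exact: measurableT_comp.
Qed.

(** The reason for the exponent [2 * u0] in [int2]: one factor exp(u0 |x|) absorbs the power, the
    other remains as a weight. *)
Lemma integrable_pow_exp (k : nat) :
  mu.-integrable setT (EFin \o (fun x : R => `|x| ^+ k * expR (u0 * `|x|))).
Proof.
apply: (integrable_le mu _ (fun x : R => (k%:R / u0) ^+ k * expR (2 * u0 * `|x|))) => //.
- apply: measurable_funM; last exact: measurable_exp_norm.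
  by apply: measurable_funX; exact: normr_measurable.
- move=> x; rewrite ger0_norm ?mulr_ge0 ?expR_ge0 ?exprn_ge0//.
  have -> : expR (2 * u0 * `|x|) = expR (u0 * `|x|) * expR (u0 * `|x|).
    by rewrite -expRD; congr expR; ring.
  rewrite mulrA ler_wpM2r ?expR_ge0//.
  rewrite expr_div_n mulrAC ler_pdivlMr ?exprn_gt0// mulrC -exprMn.
  by apply: pow_le_exp; rewrite mulr_ge0// ltW.
- have -> : EFin \o (fun x : R => (k%:R / u0) ^+ k * expR (2 * u0 * `|x|)) =
     (fun x => ((k%:R / u0) ^+ k)%:E * (expR (2 * u0 * `|x|))%:E)%E by [].
  exact: integrableZl.
Qed.

Lemma integrable_pow (k : nat) :
  mu.-integrable setT (EFin \o (fun x : R => `|x| ^+ k)).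
Proof.
apply: (integrable_le mu _ (fun x : R => `|x| ^+ k * expR (u0 * `|x|))) => //.
- by apply: measurable_funX; exact: normr_measurable.
- move=> x; rewrite ger0_norm ?exprn_ge0// ler_peMr ?exprn_ge0//.
  by rewrite -expR0 ler_expR mulr_ge0// ltW.
- exact: integrable_pow_exp.
Qed.

Lemma integrable_id : mu.-integrable setT (EFin \o (fun x : R => x)).
Proof. by apply: (integrable_le mu _ (fun x => `|x| ^+ 1)) => //; exact: integrable_pow. Qed.

Lemma integrable_sqr : mu.-integrable setT (EFin \o (fun x : R => x ^+ 2)).
Proof.
apply: (integrable_le mu _ (fun x => `|x| ^+ 2)) => //; last exact: integrable_pow.
by move=> x; rewrite normrX.
Qed.

Definition moment2 : R := \int[mu]_x (x ^+ 2).
(** The weight makes this a bound for third-order remainders: a tilt u with |u| <= [u0] changes the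
    third moment by at most the factor exp(u0 |x|). *)
Definition moment3 : R := \int[mu]_x (`|x| ^+ 3 * expR (u0 * `|x|)).

Lemma moment2_ge0 : 0 <= moment2.
Proof. by apply: Rintegral_ge0 => x _; exact: sqr_ge0. Qed.

Lemma moment3_ge0 : 0 <= moment3.
Proof. by apply: Rintegral_ge0 => x _; rewrite mulr_ge0 ?exprn_ge0 ?expR_ge0. Qed.

Hypothesis mean0 : \int[mu]_x x = 0.

Lemma expR_taylor2 (t : R) :
  expR t <= 1 + t + t ^+ 2 / 2 + `|t| ^+ 3 * expR `|t|.
Proof.
have := @taylor2_bound R expR expR expR expR 0 t (expR `|t|) (@has_deriv_expR R)
  (@has_deriv_expR R) (@has_deriv_expR R).
rewrite expR0 !mul1r add0r => /(_ _)/(le_trans (ler_norm _)).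
have h (s : R) : s \in `[Num.min 0 t, Num.max 0 t] -> `|expR s| <= expR `|t|.
  move=> /between_itvP; rewrite !subr0 (ger0_norm (expR_ge0 s)) ler_expR.
  exact/le_trans/ler_norm.
by move=> /(_ h); rewrite mulrC; lra.
Qed.

Lemma integrableM_cst (f : R -> R) (c : R) : mu.-integrable setT (EFin \o f) ->
  mu.-integrable setT (EFin \o (fun x => c * f x)).
Proof.
move=> fi; rewrite (_ : EFin \o _ = (fun x => c%:E * (f x)%:E)%E)//.
exact: integrableZl.
Qed.

Lemma integrableD_fun (f g : R -> R) : mu.-integrable setT (EFin \o f) ->
  mu.-integrable setT (EFin \o g) ->
  mu.-integrable setT (EFin \o (fun x => f x + g x)).
Proof.
move=> fi gi; rewrite (_ : EFin \o _ = (EFin \o f) \+ (EFin \o g))%E//.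
exact: integrableD.
Qed.

Lemma integrable_expM (u : R) : `|u| <= 2 * u0 ->
  mu.-integrable setT (EFin \o (fun x : R => expR (u * x))).
Proof.
move=> u2; apply: (integrable_le mu _ (fun x : R => expR (2 * u0 * `|x|))) => //.
  by apply: measurableT_comp => //; exact: measurable_funM.
move=> x; rewrite ger0_norm ?expR_ge0// ler_expR (le_trans (ler_norm _))// normrM.
exact: ler_wpM2r.
Qed.

Lemma quad_integral (a b c : R) :
  \int[mu]_x (a + b * x + c * x ^+ 2) = a + c * moment2.
Proof.
have i1 : mu.-integrable setT (EFin \o (fun x => b * x)).
  exact/integrableM_cst/integrable_id.
have i2 : mu.-integrable setT (EFin \o (fun x => c * x ^+ 2)).
  exact/integrableM_cst/integrable_sqr.
have i0 : mu.-integrable setT (EFin \o (fun _ => a)).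
  exact: finite_measure_integrable_cst.
rewrite RintegralD//; last exact: integrableD_fun.
rewrite RintegralD// Rintegral_cst1 !RintegralZl//; [|exact: integrable_sqr|exact: integrable_id].
by rewrite mean0 mulr0 addr0.
Qed.

Lemma quad_integrable (a b c : R) :
  mu.-integrable setT (EFin \o (fun x => a + b * x + c * x ^+ 2)).
Proof.
apply: integrableD_fun; last exact/integrableM_cst/integrable_sqr.
apply: integrableD_fun; last exact/integrableM_cst/integrable_id.
exact: finite_measure_integrable_cst.
Qed.

(** Second-order expansion of the exponential under the integral; centring removes the linear term,
    and |u| <= [u0] puts the remainder under [moment3]. *)
Lemma mgf_bound (u : R) : `|u| <= u0 ->
  \int[mu]_x expR (u * x) <= expR (moment2 * u ^+ 2 / 2 + moment3 * `|u| ^+ 3).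
Proof.
move=> uu0.
have u2 : `|u| <= 2 * u0 by have := normr_ge0 u; lra.
apply: (@le_trans _ _ (\int[mu]_x ((1 + u * x + (u ^+ 2 / 2) * x ^+ 2) +
    `|u| ^+ 3 * (`|x| ^+ 3 * expR (u0 * `|x|))))).
  apply: le_Rintegral => //; first exact: integrable_expM.
    by apply: integrableD_fun; [exact: quad_integrable|
      exact/integrableM_cst/integrable_pow_exp].
  move=> x _; apply: le_trans (expR_taylor2 (u * x)) _.
  rewrite (_ : `|u * x| ^+ 3 * _ = `|u| ^+ 3 * (`|x| ^+ 3 * expR (`|u| * `|x|))); last first.
    by rewrite normrM exprMn mulrA.
  apply: lerD; first by rewrite le_eqVlt; apply/orP; left; apply/eqP; ring.
  rewrite ler_wpM2l ?exprn_ge0// ler_wpM2l ?exprn_ge0// ler_expR.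
  by rewrite ler_wpM2r.
rewrite RintegralD//; [|exact: quad_integrable|exact/integrableM_cst/integrable_pow_exp].
rewrite quad_integral RintegralZl//; last exact: integrable_pow_exp.
rewrite -/moment3 (le_trans _ (expR_ge1Dx _))//; lra.
Qed.

Lemma measurable_heatF (v : R) : 0 < v -> measurable_fun setT (@heatF R v).
Proof.
move=> v0; apply: continuous_measurable_fun => x.
exact/has_deriv_continuous_at/has_deriv_heatF.
Qed.

Definition lindeberg_const : R := @heatK R * (moment3 + moment2 ^+ 2).

(** Expanding in space, the mean over [e] has no linear term, and its quadratic term cancels against
    the first-order term in time. There remain a space error of order (Lam |z|)^3 and a time error
    of order (Lam |z|)^4; the latter joins the former by Lam |z| <= 1. *)
Lemma heat_step (theta Lam v x z : R) : 0 < Lam -> 0 <= theta <= Lam ->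
  Lam ^- 2 <= v -> theta * `|z| <= u0 -> Lam * `|z| <= 1 ->
  mu.-integrable setT (EFin \o (fun e => heatF v (x + z * e))) /\
  `|\int[mu]_e heatF v (x + z * e) - heatF (v + moment2 * z ^+ 2) x| <=
  lindeberg_const * (Lam ^+ 3 * `|z| ^+ 3) * expweight theta (v + moment2 * z ^+ 2) x.
Proof.
move=> Lam0 thL Lv tz Lz; have /andP[th0 _] := thL.
have v0 : 0 < v by rewrite (lt_le_trans _ Lv)// invr_gt0 exprn_gt0.
have iF : mu.-integrable setT (EFin \o (fun e => heatF v (x + z * e))).
  apply: (integrable_bounded mu _ 1).
    apply: (measurableT_comp (measurable_heatF _ v0)).
    by apply: measurable_funD => //; exact: measurable_funM.
  by move=> e; rewrite /heatF ger0_norm ?Phi_ge0 ?Phi_le1.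
split => //.
set q := moment2 * z ^+ 2.
have q0 : 0 <= q by rewrite mulr_ge0 ?moment2_ge0 ?sqr_ge0.
have ht := heat_taylor_time theta Lam v x q Lam0 thL Lv q0.
pose Q e := heatF v x + (heatFx v x * z) * e + (heatFxx v x * (z ^+ 2 / 2)) * e ^+ 2.
have iQ : mu.-integrable setT (EFin \o Q) by exact: quad_integrable.
have eQ : \int[mu]_e Q e = heatF v x + heatFxx v x * (q / 2).
  by rewrite quad_integral /q; field.
pose c := @heatK R * Lam ^+ 3 * expweight theta v x * `|z| ^+ 3.
have c0 : 0 <= c.
  apply: mulr_ge0; last exact: exprn_ge0.
  apply: mulr_ge0; last exact/ltW/expweight_gt0.
  by apply: mulr_ge0; [exact/ltW/heatK_gt0|exact/exprn_ge0/ltW].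
have pb e : `|heatF v (x + z * e) - Q e| <= c * (`|e| ^+ 3 * expR (u0 * `|e|)).
  have := heat_taylor_space theta Lam v x (z * e) Lam0 thL Lv.
  rewrite (_ : _ + _ + _ = Q e); last by rewrite /Q; ring.
  move=> /le_trans; apply.
  rewrite (_ : _ * _ * _ = c * (`|e| ^+ 3 * expR (theta * `|z * e|))); last first.
    by rewrite /c normrM exprMn; ring.
  rewrite ler_wpM2l// ler_wpM2l ?exprn_ge0// ler_expR normrM mulrA.
  exact: ler_wpM2r.
have iB : mu.-integrable setT (EFin \o (fun e => heatF v (x + z * e) - Q e)).
  rewrite (_ : EFin \o _ = (EFin \o (fun e => heatF v (x + z * e))) \- (EFin \o Q))%E//.
  exact: integrableB.
have b1 : `|\int[mu]_e heatF v (x + z * e) - \int[mu]_e Q e| <= c * moment3.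
  rewrite -RintegralB//.
  apply: le_trans (le_normr_Rintegral _ _) _ => //.
  rewrite -RintegralZl//; last exact: integrable_pow_exp.
  apply: le_Rintegral => //.
  - apply: (integrable_le mu _ (fun e => c * (`|e| ^+ 3 * expR (u0 * `|e|)))).
    + apply: measurableT_comp => //.
      by have /integrableP[/measurable_EFinP] := iB.
    + by move=> e; rewrite normr_id.
    + exact/integrableM_cst/integrable_pow_exp.
  - exact/integrableM_cst/integrable_pow_exp.
have -> : \int[mu]_e heatF v (x + z * e) - heatF (v + q) x =
  (\int[mu]_e heatF v (x + z * e) - \int[mu]_e Q e) - (heatF (v + q) x - \int[mu]_e Q e).
  by ring.
rewrite (le_trans (ler_normB _ _))// [in X in _ + X]eQ (le_trans (lerD b1 ht))//.
have W1 := expweight_le theta v (v + q) x _; have {W1} := W1 (ltac:(by rewrite lerDl)).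
rewrite /c /lindeberg_const.
set W := expweight theta (v + q) x => W1.
have W0 : 0 <= W by exact/ltW/expweight_gt0.
have -> : @heatK R * (moment3 + moment2 ^+ 2) * (Lam ^+ 3 * `|z| ^+ 3) * W =
  @heatK R * Lam ^+ 3 * `|z| ^+ 3 * moment3 * W + @heatK R * W * (moment2 ^+ 2 * (Lam ^+ 3 * `|z| ^+ 3)).
  by ring.
apply: lerD.
  rewrite (_ : _ * moment3 = @heatK R * Lam ^+ 3 * `|z| ^+ 3 * moment3 * expweight theta v x); last by ring.
  by rewrite ler_wpM2l// !mulr_ge0 ?exprn_ge0 ?moment3_ge0 ?(ltW (heatK_gt0)) ?(ltW Lam0).
have -> : @heatK R * Lam ^+ 4 * W * q ^+ 2 =
    @heatK R * W * (moment2 ^+ 2 * ((Lam * `|z|) * (Lam ^+ 3 * `|z| ^+ 3))).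
  rewrite /q -(real_normK (num_real z)); ring.
rewrite ler_wpM2l ?mulr_ge0 ?(ltW (heatK_gt0))// ler_wpM2l ?sqr_ge0//.
by rewrite ler_piMl// mulr_ge0 ?exprn_ge0 ?(ltW Lam0).
Qed.

End Moments.

(** * Linear forms in independent variables and the Lindeberg replacement *)

Section LinearForms.
Context {d} {Omega : measurableType d} {R : realType} (P : probability Omega R)
  {I : finType} (X : I -> Omega -> R) (mu : probability R R).
Hypotheses (mX : forall i, measurable_fun setT (X i))
  (indX : mutually_independent P X)
  (lawX : forall i A, measurable A -> P (X i @^-1` A) = mu A).

Lemma law_integral i (g : R -> \bar R) : measurable_fun setT g ->
  (forall x, 0 <= g x)%E -> (\int[P]_w g (X i w) = \int[mu]_x g x)%E.
Proof.
move=> mg g0; rewrite -(@ge0_integral_pushforward _ _ _ _ _ _ (mX i) P setT g)//.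
by apply: eq_measure_integral => A mA _; exact: lawX.
Qed.

Lemma measurable_block_sum (z : I -> R) (s : seq I) :
  measurable_fun [set: block X (mem s)] (fun w : block X (mem s) => \sum_(j <- s) z j * X j w).
Proof.
rewrite (_ : (fun w => _) =
  (fun w : block X (mem s) => \sum_(j <- s) (if j \in s then z j * X j w else 0))).
  apply: measurable_sum => j; case js: (j \in s); last exact: measurable_cst.
  by apply: measurable_funM; [exact: measurable_cst|exact: measurable_block_X].
by apply/funext => w; apply: eq_big_seq => j ->.
Qed.

Lemma measurable_block_prod (h : I -> R -> R) (s : seq I) :
  (forall j, measurable_fun setT (h j)) ->
  measurable_fun [set: block X (mem s)] (fun w : block X (mem s) => \prod_(j <- s) h j (X j w)).
Proof.
move=> mh; rewrite (_ : (fun w => _) =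
  (fun w : block X (mem s) => \prod_(j <- s) (if j \in s then h j (X j w) else 1))).
  apply: measurable_prod => j js; rewrite js.
  by apply: measurableT_comp => //; exact: measurable_block_X.
by apply/funext => w; apply: eq_big_seq => j ->.
Qed.

(** [Y] depends only on the variables indexed by [s], so [X i] with [i] outside [s] can be
    integrated out with [Y] held fixed. Both inductions over the summands rest on this. *)
Lemma fresh_integral i (s : seq I) (Y : Omega -> R) (h : R * R -> \bar R) :
  i \notin s -> measurable_fun [set: block X (mem s)] (Y : block X (mem s) -> R) ->
  measurable_fun setT h -> (forall x, 0 <= h x)%E ->
  (\int[P]_w h (Y w, X i w) = \int[P]_w \int[mu]_x h (Y w, x))%E.
Proof.
move=> his mY mh h0.
rewrite (@indep_pair_integral _ _ _ _ _ _ _ P Y (X i))//.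
- apply: eq_integral => w _; apply: (law_integral i (fun x => h (Y w, x))) => //.
  by apply: measurableT_comp => //; exact: measurable_pair1.
- exact: (measurable_fun_block X mX (mem s) Y mY).
- apply: (indep_blocks_fun P X mX indX (mem s) (pred1 i)) => //.
    by move=> j /= js; apply/negP => /eqP ji; move: his; rewrite -ji js.
  by apply: measurable_block_X; rewrite /= eqxx.
Qed.

Lemma prod_integral (h : I -> R -> R) (r : I -> R) (s : seq I) : uniq s ->
  (forall j, measurable_fun setT (h j)) -> (forall j x, 0 <= h j x) ->
  (forall j, \int[mu]_x (h j x)%:E = (r j)%:E)%E ->
  (\int[P]_w (\prod_(j <- s) h j (X j w))%:E = (\prod_(j <- s) r j)%:E)%E.
Proof.
move=> + mh h0 hr; elim: s => [_|i s IH /= /andP[his us]].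
  by under eq_integral do rewrite big_nil; rewrite integral_cst//= mul1e big_nil; exact: probability_setT.
have r0 j : 0 <= r j.
  by rewrite -lee_fin -hr; apply: integral_ge0 => x _; rewrite lee_fin.
have Y0 w : 0 <= \prod_(j <- s) h j (X j w) by exact: prodr_ge0.
under eq_integral do rewrite big_cons.
(* The absolute value makes the integrand nonnegative on the whole plane, as [fresh_integral]
   requires; on the product itself it changes nothing. *)
have mh1 : measurable_fun setT (fun p : R * R => (h i p.2 * `|p.1|)%:E : \bar R).
  apply/measurable_EFinP; apply: measurable_funM; first exact: measurableT_comp.
  by apply: measurableT_comp => //; exact: normr_measurable.
have := fresh_integral i s _ _ his (measurable_block_prod h s mh) mh1.
rewrite /= => E; rewrite (eq_integral (fun w => (h i (X i w) * `|\prod_(j <- s) h j (X j w)|)%:E)); last first.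
  by move=> w _; rewrite ger0_norm.
rewrite E; last by move=> p; rewrite lee_fin mulr_ge0.
rewrite big_cons EFinM -IH//.
transitivity (\int[P]_w ((r i)%:E * (\prod_(j <- s) h j (X j w))%:E))%E.
  apply: eq_integral => w _; rewrite (ger0_norm (Y0 w)).
  under eq_integral do rewrite EFinM.
  rewrite ge0_integralZr//.
  - by rewrite hr.
  - exact/measurable_EFinP.
  - by move=> x _; rewrite lee_fin.
  - by rewrite lee_fin.
rewrite ge0_integralZl//.
- apply/measurable_EFinP; exact: (measurable_fun_block X mX (mem s) _ (measurable_block_prod h s mh)).
- by move=> w _; rewrite lee_fin.
- by rewrite lee_fin.
Qed.

Section Lindeberg.
Variable u0 : R.
Hypotheses (u0gt0 : 0 < u0)
  (int2 : mu.-integrable setT (fun x : R => (expR (2 * u0 * `|x|))%:E))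
  (mean0 : \int[mu]_x x = 0).
Local Notation m2 := (moment2 mu).
Local Notation m3 := (moment3 mu u0).

Lemma linear_mgf (u : R) (z : I -> R) (s : seq I) : uniq s ->
  (forall i, `|u| * `|z i| <= u0) ->
  (\int[P]_w (expR (u * \sum_(i <- s) z i * X i w))%:E <=
   (expR (m2 * u ^+ 2 * (\sum_(i <- s) z i ^+ 2) / 2 +
          m3 * `|u| ^+ 3 * \sum_(i <- s) `|z i| ^+ 3))%:E)%E.
Proof.
move=> us uz.
have uz' i : `|u * z i| <= u0 by rewrite normrM.
have uz2 i : `|u * z i| <= 2 * u0 by have := normr_ge0 (u * z i); have := uz' i; lra.
rewrite (eq_integral (fun w => (\prod_(i <- s) expR (u * z i * X i w))%:E)); last first.
  move=> w _; rewrite -expR_sum big_distrr/=; congr (expR _)%:E.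
  by apply: eq_bigr => i _; rewrite mulrA.
have mh j : measurable_fun setT (fun x : R => expR (u * z j * x)).
  by apply: measurableT_comp => //; exact: measurable_funM.
have hr j : (\int[mu]_x (expR (u * z j * x))%:E = (\int[mu]_x expR (u * z j * x))%:E)%E.
  by rewrite EFin_Rintegral//; exact: integrable_expM int2 _ (uz2 j).
rewrite (prod_integral (fun i x => expR (u * z i * x)) _ s us mh _ hr)//.
rewrite lee_fin.
apply: (@le_trans _ _ (\prod_(i <- s) expR (m2 * (u * z i) ^+ 2 / 2 + m3 * `|u * z i| ^+ 3))).
  apply: ler_prod => i _; apply/andP; split.
    by apply: Rintegral_ge0 => x _; exact: expR_ge0.
  exact: mgf_bound.
rewrite -expR_sum ler_expR big_split/= lerD//.
  rewrite mulrAC mulr_sumr le_eqVlt; apply/orP; left; apply/eqP.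
  by apply: eq_bigr => i _; rewrite exprMn; ring.
rewrite mulr_sumr le_eqVlt; apply/orP; left; apply/eqP.
by apply: eq_bigr => i _; rewrite normrM exprMn; ring.
Qed.

Lemma measurable_linear (z : I -> R) (s : seq I) :
  measurable_fun setT (fun w => \sum_(i <- s) z i * X i w).
Proof. exact: (measurable_fun_block X mX (mem s) _ (measurable_block_sum z s)). Qed.

Lemma fresh_Rintegral i (s : seq I) (Y : Omega -> R) (h : R -> R -> R) :
  i \notin s -> measurable_fun [set: block X (mem s)] (Y : block X (mem s) -> R) ->
  measurable_fun setT (fun p : R * R => h p.1 p.2) -> (forall x y, 0 <= h x y) ->
  (forall y, mu.-integrable setT (EFin \o h y)) ->
  \int[P]_w h (Y w) (X i w) = \int[P]_w \int[mu]_x h (Y w) x.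
Proof.
move=> his mY mh h0 hi.
rewrite /Rintegral (fresh_integral i s Y (fun p => (h p.1 p.2)%:E) his mY)//.
- congr fine; apply: eq_integral => w _ /=.
  by rewrite EFin_Rintegral//; exact: hi.
- exact/measurable_EFinP.
- by move=> p; rewrite lee_fin.
Qed.

(** A linear form acts on the weight as a Gaussian of the same variance would, up to a factor given
    by the third-order sum. *)
Lemma expweight_integral (theta v x : R) (z : I -> R) (s : seq I) : uniq s ->
  0 <= theta -> (forall i, theta * `|z i| <= u0) ->
  P.-integrable setT (EFin \o (fun w => expweight theta v (x + \sum_(i <- s) z i * X i w))) /\
  \int[P]_w expweight theta v (x + \sum_(i <- s) z i * X i w) <=
  expweight theta (v + m2 * \sum_(i <- s) z i ^+ 2) x *
  expR (m3 * (theta ^+ 3 * \sum_(i <- s) `|z i| ^+ 3)).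
Proof.
move=> us th0 tz.
have mgf := linear_mgf theta z s us _.
rewrite (ger0_norm th0) in mgf; have {mgf} := mgf tz.
set S := fun w => \sum_(i <- s) z i * X i w; move=> mgf.
have mS : measurable_fun setT (fun w => expR (theta * S w)).
  apply: measurableT_comp => //; apply: measurable_funM => //; exact: measurable_linear.
have iS : P.-integrable setT (EFin \o (fun w => expR (theta * S w))).
  apply/integrableP; split; first exact/measurable_EFinP.
  under eq_integral do rewrite /= ger0_norm ?expR_ge0//.
  by apply: le_lt_trans mgf _; rewrite ltry.
have e w : expweight theta v (x + S w) = expweight theta v x * expR (theta * S w).
  by rewrite /expweight -expRD; congr expR; ring.
have -> : (fun w => expweight theta v (x + S w)) =
  (fun w => expweight theta v x * expR (theta * S w)) by exact/funext.
split.
  rewrite (_ : EFin \o _ = (fun w => (expweight theta v x)%:E * (expR (theta * S w))%:E)%E)//.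
  exact: integrableZl.
rewrite RintegralZl//.
rewrite EFin_Rintegral// lee_fin in mgf.
rewrite (le_trans (ler_wpM2l (ltW (expweight_gt0 _ _ _)) mgf))//.
rewrite /expweight -!expRD ler_expR.
by rewrite le_eqVlt; apply/orP; left; apply/eqP; ring.
Qed.

Lemma measurable_heatF_linear v x (z : I -> R) (s : seq I) : 0 < v ->
  measurable_fun setT (fun w => heatF v (x + \sum_(i <- s) z i * X i w)).
Proof.
move=> v0; apply: (measurableT_comp (measurable_heatF _ v0)).
by apply: measurable_funD => //; exact: measurable_linear.
Qed.

Lemma integrable_heatF_linear v x (z : I -> R) (s : seq I) : 0 < v ->
  P.-integrable setT (EFin \o (fun w => heatF v (x + \sum_(i <- s) z i * X i w))).
Proof.
move=> v0; apply: (integrable_bounded P _ 1); first exact: measurable_heatF_linear.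
by move=> w; rewrite /heatF ger0_norm ?Phi_ge0 ?Phi_le1.
Qed.

(* One summand is replaced at a time: heatF (v + m2 * z ^+ 2) is heatF v smoothed by a
   centred Gaussian of variance m2 * z ^+ 2, so no Gaussian variables are needed. *)
Lemma lindeberg (theta Lam : R) (z : I -> R) (s : seq I) :
  uniq s -> 0 < Lam -> 0 <= theta <= Lam ->
  (forall i, theta * `|z i| <= u0) -> (forall i, Lam * `|z i| <= 1) ->
  forall v x, Lam ^- 2 <= v ->
  `|\int[P]_w heatF v (x + \sum_(i <- s) z i * X i w) -
    heatF (v + m2 * \sum_(i <- s) z i ^+ 2) x| <=
  lindeberg_const mu u0 * (Lam ^+ 3 * \sum_(i <- s) `|z i| ^+ 3) *
  expR (m3 * (theta ^+ 3 * \sum_(i <- s) `|z i| ^+ 3)) *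
  expweight theta (v + m2 * \sum_(i <- s) z i ^+ 2) x.
Proof.
move=> + Lam0 thL tz Lz; have /andP[th0 _] := thL.
elim: s => [_ v x Lv|i s IH /= /andP[his us] v x Lv].
  under eq_Rintegral do rewrite big_nil addr0.
  by rewrite Rintegral_cst1 !big_nil !mulr0 mul0r mul0r addr0 subrr normr0.
have v0 : 0 < v by rewrite (lt_le_trans _ Lv)// invr_gt0 exprn_gt0.
set S := fun w => \sum_(j <- s) z j * X j w.
set q := m2 * z i ^+ 2.
have q0 : 0 <= q by rewrite mulr_ge0 ?moment2_ge0 ?sqr_ge0.
set c := \sum_(j <- s) `|z j| ^+ 3.
have c0 : 0 <= c by apply: sumr_ge0 => j _; exact: exprn_ge0.
have Q : \sum_(j <- i :: s) z j ^+ 2 = z i ^+ 2 + \sum_(j <- s) z j ^+ 2 by rewrite big_cons.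
have C : \sum_(j <- i :: s) `|z j| ^+ 3 = `|z i| ^+ 3 + c by rewrite big_cons.
rewrite Q C mulrDr -/q addrA.
(* [G] averages over the new summand only. [heat_step] compares it pointwise with [heatF (v + q)],
   to which the induction hypothesis applies. *)
set G := fun y => \int[mu]_e heatF v (x + y + z i * e).
have E1 : \int[P]_w heatF v (x + \sum_(j <- i :: s) z j * X j w) = \int[P]_w G (S w).
  have := fresh_Rintegral i s S (fun y e => heatF v (x + y + z i * e)) his
    (measurable_block_sum z s).
  have mh : measurable_fun setT (fun p : R * R => heatF v (x + p.1 + z i * p.2)).
    apply: (measurableT_comp (measurable_heatF _ v0)).
    by apply: measurable_funD; [exact: measurable_funD|exact: measurable_funM].
  move=> /(_ mh) <-; last 2 first.
  - by move=> y e; exact: Phi_ge0.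
  - by move=> y; exact: (heat_step mu u0 u0gt0 int2 mean0 theta Lam v (x + y) (z i) Lam0 thL Lv (tz i) (Lz i)).1.
  by apply: eq_Rintegral => w _; rewrite big_cons -addrA [z i * _ + _]addrC.
have gst y := (heat_step mu u0 u0gt0 int2 mean0 theta Lam v (x + y) (z i) Lam0 thL Lv (tz i) (Lz i)).2.
have Lvq : Lam ^- 2 <= v + q by rewrite (le_trans Lv)// lerDl.
have := IH us (v + q) x Lvq; rewrite -/c -/S => IH'.
have [iW bW] := expweight_integral theta (v + q) x z s us th0 tz.
rewrite -/S -/c in iW bW.
have vq0 : 0 < v + q by rewrite ltr_wpDr.
have iF := integrable_heatF_linear (v + q) x z s vq0.
rewrite -/S in iF.
have mG : measurable_fun setT G.
  rewrite /G /Rintegral; apply: measurableT_comp; first exact: fine_measurable.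
  apply: (measurable_fun_fubini_tonelli_F (m2 := mu)
    (fun p : R * R => (heatF v (x + p.1 + z i * p.2))%:E)).
    apply/measurable_EFinP; apply: (measurableT_comp (measurable_heatF _ v0)).
    by apply: measurable_funD; [exact: measurable_funD|exact: measurable_funM].
  by move=> p; rewrite lee_fin Phi_ge0.
have Gb1 w : `|G (S w)| <= 1.
  rewrite ger0_norm; last first.
    by apply: Rintegral_ge0 => e _; exact: Phi_ge0.
  rewrite -(Rintegral_cst1 mu 1); apply: le_Rintegral => //.
  - exact: (heat_step mu u0 u0gt0 int2 mean0 theta Lam v (x + S w) (z i) Lam0 thL Lv (tz i) (Lz i)).1.
  - exact: finite_measure_integrable_cst.
  - by move=> e _; exact: Phi_le1.
have iG : P.-integrable setT (EFin \o (fun w => G (S w))).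
  apply: (integrable_bounded P _ 1); last exact: Gb1.
  by apply: measurableT_comp => //; exact: measurable_linear.
pose K := lindeberg_const mu u0.
have K0 : 0 <= K.
  by apply: mulr_ge0; [exact/ltW/heatK_gt0|rewrite addr_ge0 ?moment3_ge0 ?sqr_ge0].
(* The error of one step carries the weight at the random point [x + S w]; [expweight_integral]
   turns its mean into the weight at [x] with the full variance. *)
have b1 : `|\int[P]_w G (S w) - \int[P]_w heatF (v + q) (x + S w)| <=
    K * (Lam ^+ 3 * `|z i| ^+ 3) * \int[P]_w expweight theta (v + q) (x + S w).
  rewrite -RintegralB//; apply: le_trans (le_normr_Rintegral _ _) _ => //.
    rewrite (_ : EFin \o _ = (EFin \o (fun w => G (S w))) \-
      (EFin \o (fun w => heatF (v + q) (x + S w))))%E//.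
    exact: integrableB.
  rewrite -RintegralZl//; apply: le_Rintegral => //.
  - apply: (integrable_bounded P _ 2).
      apply: measurableT_comp => //; apply: measurable_funB.
        by apply: measurableT_comp => //; exact: measurable_linear.
      exact: measurable_heatF_linear.
    move=> w; rewrite normr_id (_ : 2 = 1 + 1)// (le_trans (ler_normB _ _))//.
    by apply: lerD; rewrite ?Gb1// /heatF ger0_norm ?Phi_ge0 ?Phi_le1.
  - rewrite (_ : EFin \o _ = (fun w => (K * (Lam ^+ 3 * `|z i| ^+ 3))%:E *
      (expweight theta (v + q) (x + S w))%:E)%E)//.
    exact: integrableZl.
  - by move=> w _; exact: gst.
rewrite E1.
set A := \int[P]_w G (S w) in b1 *; set B := \int[P]_w heatF (v + q) (x + S w) in b1 IH' *.
set D := heatF _ x in IH' *; set W := expweight _ _ x in bW IH' *.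
have -> : A - D = (A - B) + (B - D) by rewrite addrA subrK.
rewrite (le_trans (ler_normD _ _))// (le_trans (lerD b1 IH'))//.
have L0 : 0 <= K * Lam ^+ 3 by rewrite mulr_ge0 ?exprn_ge0 ?(ltW Lam0).
have z0 : 0 <= `|z i| ^+ 3 by exact: exprn_ge0.
have W0 : 0 <= W by exact/ltW/expweight_gt0.
have a1 : K * (Lam ^+ 3 * `|z i| ^+ 3) * \int[P]_w expweight theta (v + q) (x + S w) <=
  K * (Lam ^+ 3 * `|z i| ^+ 3) * (W * expR (m3 * (theta ^+ 3 * c))).
  by rewrite ler_wpM2l// mulrA mulr_ge0.
rewrite (le_trans (lerD a1 (lexx _)))//.
(* Old and new errors now share one factor exp(m3 theta^3 c), so their third-order sums add;
   enlarging [c] in the exponential restores the claimed form. *)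
rewrite (_ : _ + _ = (K * Lam ^+ 3 * (`|z i| ^+ 3 + c) * W) * expR (m3 * (theta ^+ 3 * c))); last by rewrite /K; ring.
rewrite (_ : lindeberg_const mu u0 * _ * _ * W = (K * Lam ^+ 3 * (`|z i| ^+ 3 + c) * W) * expR (m3 * (theta ^+ 3 * (`|z i| ^+ 3 + c)))); last by rewrite /K; ring.
apply: ler_wpM2l; first by rewrite mulr_ge0// mulr_ge0// addr_ge0.
rewrite ler_expR ler_wpM2l ?moment3_ge0// ler_wpM2l ?exprn_ge0//.
by rewrite lerDr.
Qed.

End Lindeberg.
End LinearForms.

(** * Tail of a normalised linear form with relative error *)

Section ModerateDeviation.
Context {d} {Omega : measurableType d} {R : realType} (P : probability Omega R)
  {I : finType} (X : I -> Omega -> R) (mu : probability R R).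
Hypotheses (mX : forall i, measurable_fun setT (X i))
  (indX : mutually_independent P X)
  (lawX : forall i A, measurable A -> P (X i @^-1` A) = mu A).
Variable u0 : R.
Hypotheses (u0gt0 : 0 < u0)
  (int2 : mu.-integrable setT (fun x : R => (expR (2 * u0 * `|x|))%:E))
  (mean0 : \int[mu]_x x = 0).
Local Notation m2 := (moment2 mu).
Local Notation m3 := (moment3 mu u0).
Variable z : I -> R.
Local Notation S := (fun w => \sum_i z i * X i w).
Local Notation zeta := (\sum_i `|z i| ^+ 3).

Lemma Rintegral_indic (A : set Omega) : measurable A ->
  \int[P]_w \1_A w = fine (P A).
Proof. by move=> mA; rewrite /Rintegral integral_indic ?setIT. Qed.

Lemma integrable_indicator (A : set Omega) : measurable A ->
  P.-integrable setT (EFin \o (\1_A : Omega -> R)).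
Proof.
move=> mA; apply: (integrable_bounded P _ 1); first exact: measurable_indic.
by move=> w; rewrite indicE; case: (w \in A); rewrite ?normr1 ?normr0.
Qed.

Let mS : measurable_fun setT S.
Proof. exact: (measurable_linear X mX z (index_enum I)). Qed.

Lemma sum_cube_ge0 : 0 <= zeta.
Proof. by apply: sumr_ge0 => i _; exact: exprn_ge0. Qed.

Hypothesis unit_var : m2 * \sum_i z i ^+ 2 = 1.

Lemma phi_le_exp (u : R) : phi u <= expR (- (u ^+ 2 / 2)).
Proof.
rewrite /phi ler_pdivrMr ?sqrt2pi_gt0// ler_peMr ?expR_ge0//.
rewrite -[leLHS]sqrtr1 ler_wsqrtr//; have := @pi_ge2 R; lra.
Qed.

Lemma Phi_neg_bound (u : R) : u <= -1 -> Phi u <= expR (- (u ^+ 2 / 2)).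
Proof.
move=> u1; have nu : 1 <= - u by rewrite lerNr.
have := mills_upper (- u); rewrite PhiN (lt_le_trans _ nu)// => /(_ isT).
rewrite opprB addrC subrK => /le_trans; apply.
rewrite ler_pdivrMr ?(lt_le_trans _ nu)// (le_trans (phi_le_exp _))// sqrrN.
by rewrite ler_peMr ?expR_ge0.
Qed.

Section Bounds.
Variables (L y : R).
Hypotheses (L1 : 1 <= L) (y1 : 1 <= y).
Local Notation Lam := (y * L ^+ 2).
Local Notation v0 := ((y * L ^+ 2) ^- 2).
Hypotheses (yz : forall i, y * `|z i| <= u0) (Lz : forall i, Lam * `|z i| <= 1).

Let err := lindeberg_const mu u0 * (Lam ^+ 3 * zeta) * expR (m3 * (y ^+ 3 * zeta)) *
  expR (2 - y ^+ 2 / 2).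

Let L0 : 0 < L. Proof. exact: lt_le_trans L1. Qed.
Let y0 : 0 < y. Proof. exact: lt_le_trans y1. Qed.
Let Lam0 : 0 < Lam. Proof. by rewrite mulr_gt0// exprn_gt0. Qed.

(** With theta = y the weight at - c has exponent - y c + y^2/2 + L^-4/2, which is at most 2 - y^2/2
    as soon as y c >= y^2 - 1/L. Both thresholds y - 1/(yL) and y + 1/(yL) qualify. *)
Lemma lindeberg_at (c : R) : y - (y * L)^-1 <= c ->
  `|\int[P]_w heatF v0 (- c + S w) - heatF (v0 + 1) (- c)| <= err.
Proof.
move=> yc.
have thL : 0 <= y <= Lam by rewrite ltW//= ler_peMr ?(ltW y0)// exprn_ege1.
have := lindeberg P X mu mX indX lawX u0 u0gt0 int2 mean0 y Lam z
  (index_enum I) (index_enum_uniq I) Lam0 thL yz Lz v0 (- c) (lexx _).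
rewrite unit_var => /le_trans; apply.
apply: ler_wpM2l.
  apply: mulr_ge0; last exact: expR_ge0.
  apply: mulr_ge0; last by rewrite mulr_ge0 ?sum_cube_ge0// exprn_ge0// ltW.
  by apply: mulr_ge0; [exact/ltW/heatK_gt0|rewrite addr_ge0 ?moment3_ge0 ?sqr_ge0].
rewrite ler_expR.
have -> : y * - c + y ^+ 2 * (v0 + 1) / 2 = - (y * c) + y ^+ 2 / 2 + (L ^- 4) / 2.
  by field; apply/andP; split; rewrite gt_eqF.
have : y * (y - (y * L)^-1) <= y * c by rewrite ler_wpM2l// ltW.
have -> : y * (y - (y * L)^-1) = y ^+ 2 - L^-1 by field; apply/andP; split; rewrite gt_eqF.
have : L^-1 <= 1 by rewrite invf_le1.
have : L ^- 4 <= 1 by rewrite invf_le1 ?exprn_gt0// exprn_ege1.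
by lra.
Qed.

Lemma sqrt_v0 : Num.sqrt v0 = Lam^-1.
Proof. by rewrite -exprVn sqrtr_sqr ger0_norm// invr_ge0 ltW. Qed.

(** The smooth step has standard deviation 1 / Lam, and 1/(yL) is L such deviations. Centred at y -
    1/(yL), it is therefore at least [Phi L] on the whole event. *)
Lemma md_upper : Phi L * fine (P [set w | y <= S w]) <=
  (1 - Phi ((y - (y * L)^-1) / Num.sqrt (v0 + 1))) + err.
Proof.
have mA := measurable_set_ge S y mS.
set a := y - _.
have v00 : 0 < v0 by rewrite invr_gt0 exprn_gt0.
have := lindeberg_at a (lexx _); rewrite ler_norml => /andP[_].
rewrite lerBlDl /heatF mulNr PhiN => /(le_trans _); apply.
rewrite -Rintegral_indic// -RintegralZl//; last exact: integrable_indicator.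
apply: le_Rintegral => //.
- rewrite (_ : EFin \o _ = (fun w => (Phi L)%:E * (\1_[set w | (y <= S w)%R] w)%:E)%E)//.
  by apply: integrableZl => //; exact: integrable_indicator.
- exact: (integrable_heatF_linear P X mX v0 (- a) z (index_enum I)).
move=> w _; rewrite indicE; case: (boolP (w \in _)) => [|_]; last first.
  by rewrite mulr0 Phi_ge0.
rewrite inE/= mulr1 => ySw; apply: Phi_nd; rewrite sqrt_v0 invrK.
apply: (@le_trans _ _ ((y * L)^-1 * Lam)).
  by rewrite le_eqVlt; apply/orP; left; apply/eqP; field; apply/andP; split; rewrite gt_eqF.
by rewrite ler_wpM2r ?(ltW Lam0)// /a; lra.
Qed.

(** Centred at y + 1/(yL), the smooth step is small but not zero below y. A bound exp(-L^2/2) alone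
    would be useless next to a tail of order exp(-y^2/2), so the decay exp(- y (y - S)) is kept as
    well and averaged by [expweight_integral]. *)
Lemma md_lower : 1 - Phi ((y + (y * L)^-1) / Num.sqrt (v0 + 1)) <=
  fine (P [set w | y <= S w]) + err +
  expR (- (L ^+ 2 / 2)) * expR (- (y ^+ 2 / 2) + m3 * y ^+ 3 * zeta).
Proof.
have mA := measurable_set_ge S y mS.
set b := y + _.
have yb : y - (y * L)^-1 <= b.
  by rewrite /b; have : 0 <= (y * L)^-1; [rewrite invr_ge0 mulr_ge0 ?(ltW y0) ?(ltW L0)|lra].
have v00 : 0 < v0 by rewrite invr_gt0 exprn_gt0.
have := lindeberg_at b yb; rewrite ler_norml => /andP[+ _].
have -> : heatF (v0 + 1) (- b) = 1 - Phi (b / Num.sqrt (v0 + 1)).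
  by rewrite /heatF mulNr PhiN.
rewrite lerBrDl => h.
have [iW bW] := expweight_integral P X mu mX indX lawX u0 u0gt0 int2 mean0 y 0 (- y) z
  (index_enum I) (index_enum_uniq I) (ltW y0) yz.
rewrite unit_var -expRD in bW.
set E := \int[P]_w heatF v0 (- b + S w) in h.
pose c := expR (- (L ^+ 2 / 2)).
suff hE : E <= fine (P [set w | y <= S w]) +
    c * expR (- (y ^+ 2 / 2) + m3 * y ^+ 3 * zeta).
  by move: h hE; rewrite -/err -/c; lra.
have c0 : 0 <= c by exact: expR_ge0.
have eW : \int[P]_w (c * expweight y 0 (- y + S w)) <= c * expR (- (y ^+ 2 / 2) + m3 * y ^+ 3 * zeta).
  rewrite RintegralZl// ler_wpM2l//; apply: le_trans bW _; rewrite ler_expR.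
  by rewrite le_eqVlt; apply/orP; left; apply/eqP; field.
have icW : P.-integrable setT (EFin \o (fun w => c * expweight y 0 (- y + S w))).
  rewrite (_ : EFin \o _ = (fun w => c%:E * (expweight y 0 (- y + S w))%:E)%E)//.
  exact: integrableZl.
have i1 := integrable_indicator _ mA.
rewrite -Rintegral_indic//; apply: le_trans (lerD (lexx _) eW).
rewrite -RintegralD//; apply: le_Rintegral => //.
- exact: (integrable_heatF_linear P X mX v0 (- b) z (index_enum I)).
- rewrite (_ : EFin \o _ = (EFin \o \1_[set w | (y <= S w)%R]) \+
    (EFin \o (fun w => (c * expweight y 0 (- y + S w))%R)))%E//.
  exact: integrableD.
move=> w _; rewrite /heatF sqrt_v0 invrK indicE; case: (boolP (w \in _)) => [_|].
  apply: le_trans (Phi_le1 _) _; rewrite [true%:R](_ : _ = 1)// lerDl.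
  by rewrite mulr_ge0// ltW// expweight_gt0.
rewrite notin_setE/= => /negP; rewrite -ltNge => Sy; rewrite [false%:R](_ : _ = 0)// add0r.
have e1 : (- b + S w) * Lam = - (L + Lam * (y - S w)).
  by rewrite /b; field; apply/andP; split; rewrite gt_eqF.
have LS : 0 <= Lam * (y - S w) by rewrite mulr_ge0 ?(ltW Lam0)// subr_ge0 ltW.
rewrite e1; apply: le_trans (Phi_neg_bound _ _) _; first by rewrite lerN2 (le_trans L1)// lerDl.
rewrite sqrrN -expRD ler_expR mulr0 mul0r addr0.
(* The cross term of (L + Lam (y - S))^2 / 2 yields the decay exp(- y (y - S)), since L Lam = y L^3
   >= y. *)
have : y * (y - S w) <= L * (Lam * (y - S w)).
  rewrite mulrA ler_wpM2r ?subr_ge0 ?(ltW Sy)// mulrCA ler_peMr ?(ltW y0)//.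
  by rewrite -exprS exprn_ege1.
by have := sqr_ge0 (Lam * (y - S w)); nra.
Qed.

End Bounds.

(* The choices y = L^6 and Lam = L^8 balance the Lindeberg error y^4 L^6 zeta against
   the leftover exp(-L^2/2). *)
Section Asymptotics.
Variables (L eta : R).
Hypotheses (L8 : 8 <= L) (eta0 : 0 <= eta) (eta1 : eta <= 1) (etau : eta <= u0).
Local Notation y := (L ^+ 6).
Hypotheses (zmax : forall i, y ^+ 2 * `|z i| <= eta) (zeta_small : y ^+ 5 * zeta <= eta).

Let L1 : 1 <= L. Proof. by rewrite (le_trans _ L8)// ler1n. Qed.
Let L0 : 0 < L. Proof. exact: lt_le_trans L1. Qed.
Let y1 : 1 <= y. Proof. exact: exprn_ege1. Qed.
Let y0 : 0 < y. Proof. exact: lt_le_trans y1. Qed.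

Let yz i : y * `|z i| <= u0.
Proof.
apply: le_trans etau; apply: le_trans (zmax i).
by rewrite ler_wpM2r// expr2 ler_peMr// ltW.
Qed.

Let Lz i : y * L ^+ 2 * `|z i| <= 1.
Proof.
apply: le_trans eta1; apply: le_trans (zmax i).
by rewrite ler_wpM2r// [y ^+ 2]expr2 ler_wpM2l ?(ltW y0)// ler_weXn2l.
Qed.

(** The leading term of 1 - Phi(y), by the two Mills inequalities. *)
Definition tail (y : R) : R := phi y / y.

Definition md_err_const : R :=
  lindeberg_const mu u0 * expR m3 * expR 2 * Num.sqrt (2 * pi).

(** For y = L^6 the factor (y L^2)^3 is y^4, and exp(- y^2/2) = sqrt(2 pi) y [tail y] contributes
    one more y. This is the origin of the power 5 in [zeta_small]. *)
Let err_bound : lindeberg_const mu u0 * ((y * L ^+ 2) ^+ 3 * zeta) * expR (m3 * (y ^+ 3 * zeta)) *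
  expR (2 - y ^+ 2 / 2) <= md_err_const * eta * tail y.
Proof.
have z0 := sum_cube_ge0.
have y3 : y ^+ 3 * zeta <= 1.
  apply: le_trans eta1; apply: le_trans zeta_small.
  by rewrite ler_wpM2r// ler_weXn2l.
have -> : expR (2 - y ^+ 2 / 2) = expR 2 * Num.sqrt (2 * pi) * y * tail y.
  rewrite /tail /phi expRD; have := @sqrt2pi_gt0 R => /gt_eqF/negbT s0.
  by field; rewrite s0 gt_eqF.
have -> : (y * L ^+ 2) ^+ 3 * zeta = y ^+ 4 * zeta by rewrite exprMn -!exprM -!exprD.
have -> : md_err_const * eta * tail y =
  lindeberg_const mu u0 * expR m3 * (expR 2 * Num.sqrt (2 * pi) * tail y) * eta.
  by rewrite /md_err_const; ring.
have K0 : 0 <= lindeberg_const mu u0.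
  by apply: mulr_ge0; [exact/ltW/heatK_gt0|rewrite addr_ge0 ?moment3_ge0 ?sqr_ge0].
have t0 : 0 <= tail y by rewrite divr_ge0 ?ltW ?phi_gt0.
have c0 : 0 <= expR 2 * Num.sqrt (2 * pi) * tail y.
  by rewrite mulr_ge0// mulr_ge0 ?expR_ge0 ?sqrtr_ge0.
rewrite (_ : _ * _ * _ * _ = lindeberg_const mu u0 * expR (m3 * (y ^+ 3 * zeta)) *
  (expR 2 * Num.sqrt (2 * pi) * tail y) * (y ^+ 5 * zeta)); last by ring.
apply: ler_pM => //.
- by rewrite mulr_ge0// mulr_ge0 ?expR_ge0.
- by rewrite mulr_ge0// exprn_ge0// ltW.
rewrite ler_wpM2r// ler_wpM2l// ler_expR ler_piMr ?moment3_ge0//.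
Qed.

Let l0 : 0 < L^-1. Proof. by rewrite invr_gt0. Qed.
Let l8 : L^-1 <= 8^-1. Proof. by rewrite lef_pV2 ?posrE. Qed.

Let t0 : 0 < tail y. Proof. by rewrite divr_gt0 ?phi_gt0. Qed.

Lemma phi_le_shift (u v c : R) : v ^+ 2 - 2 * c <= u ^+ 2 -> phi u <= phi v * expR c.
Proof.
move=> h; rewrite /phi [leRHS]mulrAC ler_wpM2r ?invr_ge0 ?sqrtr_ge0//.
by rewrite -expRD ler_expR; lra.
Qed.

Let yl : (y * L)^-1 <= y * L^-1.
Proof.
rewrite invfM ler_wpM2r ?(ltW l0)// (@le_trans _ _ 1)// invf_le1//.
Qed.

Let tail_upper : 1 - Phi ((y - (y * L)^-1) / Num.sqrt ((y * L ^+ 2) ^- 2 + 1)) <=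
  tail y / (1 - 2 * L^-1) ^+ 2.
Proof.
set v0 := (y * L ^+ 2) ^- 2.
have yL0 : 0 < y * L by rewrite mulr_gt0.
have p0 : 0 < 1 - 2 * L^-1 by move: l8; lra.
(* Dividing by sqrt(v0 + 1) <= 1 + v0/2 lowers the threshold by at most y v0 / 2 <= 1/(yL); the
   second multiple of 1/(yL) pays for it. *)
pose x' := y - 2 * (y * L)^-1.
have x'y : y * (1 - 2 * L^-1) <= x' by rewrite /x'; move: yl; lra.
have x'0 : 0 < x' by rewrite (lt_le_trans _ x'y)// mulr_gt0.
have v00 : 0 < v0 by rewrite invr_gt0 exprn_gt0// mulr_gt0// exprn_gt0.
have sq : Num.sqrt (v0 + 1) <= 1 + v0 / 2.
  rewrite -(ler_pXn2r (ltn0Sn 1)) ?nnegrE ?sqrtr_ge0//; last by lra.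
  by rewrite sqr_sqrtr; [have := sqr_ge0 v0; nra|lra].
have sq0 : 0 < Num.sqrt (v0 + 1) by rewrite sqrtr_gt0; lra.
have yv0 : y * v0 / 2 <= (y * L)^-1.
  have -> : y * v0 / 2 = (y * L)^-1 * (2 * L ^+ 3)^-1.
    by rewrite /v0; field; rewrite !gt_eqF.
  rewrite ler_piMr ?invr_ge0 ?(ltW yL0)// invf_le1 ?mulr_gt0 ?exprn_gt0//.
  by have := exprn_ege1 3 L1; lra.
have xx' : x' <= (y - (y * L)^-1) / Num.sqrt (v0 + 1).
  rewrite ler_pdivlMr// (le_trans (ler_wpM2l (ltW x'0) sq))//.
  have : x' * (v0 / 2) <= y * (v0 / 2).
    rewrite ler_wpM2r ?divr_ge0 ?(ltW v00)// /x'.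
    by have : 0 <= (y * L)^-1; [rewrite invr_ge0 ltW|lra].
  by rewrite /x'; move: yv0; lra.
apply: (@le_trans _ _ (1 - Phi x')); first by rewrite lerD2l lerN2 Phi_nd.
apply: le_trans (mills_upper _ x'0) _.
have ph : phi x' <= phi y * expR (2 * L^-1).
  apply: phi_le_shift.
  have -> : x' ^+ 2 = y ^+ 2 - 4 * L^-1 + (2 * (y * L)^-1) ^+ 2.
    by rewrite /x'; field; rewrite !gt_eqF.
  by have := sqr_ge0 (2 * (y * L)^-1); lra.
have ex : expR (2 * L^-1) <= (1 - 2 * L^-1)^-1.
  rewrite -[leLHS]invrK lef_pV2 ?posrE ?invr_gt0 ?expR_gt0// -expRN.
  exact: expR_ge1Dx.
rewrite (_ : tail y / _ = phi y * (1 - 2 * L^-1)^-1 / (y * (1 - 2 * L^-1))); last first.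
  rewrite /tail; field; apply/andP; split; rewrite gt_eqF//.
  by move: L8; lra.
apply: ler_pM; rewrite ?invr_ge0 ?(ltW (phi_gt0 _)) ?(ltW x'0)//.
  by apply: le_trans ph _; rewrite ler_wpM2l ?(ltW (phi_gt0 _)).
by rewrite lef_pV2 ?posrE ?mulr_gt0.
Qed.

Let tail_lower : (1 - 4 * L^-1) * tail y <=
  1 - Phi ((y + (y * L)^-1) / Num.sqrt ((y * L ^+ 2) ^- 2 + 1)).
Proof.
set v0 := (y * L ^+ 2) ^- 2; set b := y + _.
have yL0 : 0 < y * L by rewrite mulr_gt0.
have v00 : 0 < v0 by rewrite invr_gt0 exprn_gt0// mulr_gt0// exprn_gt0.
have yLi : 0 < (y * L)^-1 by rewrite invr_gt0.
have b0 : 0 < b by rewrite addr_gt0.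
have sq1 : 1 <= Num.sqrt (v0 + 1) by rewrite -[leLHS]sqrtr1 ler_wsqrtr//; lra.
apply: (@le_trans _ _ (1 - Phi b)); last first.
  by rewrite lerD2l lerN2 Phi_nd// ler_pdivrMr ?(lt_le_trans _ sq1)// ler_peMr// ltW.
apply: le_trans _ (mills_lower _ b0).
have by_ : b <= y * (1 + L^-1) by rewrite /b mulrDr mulr1 lerD2l.
have yb : y <= b by rewrite /b lerDl ltW.
have b2 : b^-1 ^+ 2 <= L^-1.
  apply: (@le_trans _ _ (y^-1 ^+ 2)).
    by rewrite lerXn2r ?nnegrE ?invr_ge0 ?(ltW b0) ?(ltW y0)// lef_pV2 ?posrE.
  rewrite exprVn lef_pV2 ?posrE ?exprn_gt0// -exprM.
  by rewrite -[leLHS]expr1 ler_weXn2l.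
have ph : phi y <= phi b * expR (2 * L^-1).
  apply: phi_le_shift.
  have -> : b ^+ 2 = y ^+ 2 + 2 * L^-1 + ((y * L)^-1) ^+ 2.
    by rewrite /b; field; rewrite !gt_eqF.
  have : ((y * L)^-1) ^+ 2 <= L^-1.
    rewrite expr2 -[leRHS]mul1r ler_pM ?(ltW yLi)//.
      by rewrite invf_le1// mulr_ege1.
    by rewrite lef_pV2 ?posrE// ler_peMl// ltW.
  by move: l0; lra.
have ex : 1 - 2 * L^-1 <= expR (- (2 * L^-1)) by exact: expR_ge1Dx.
have phb : phi y * (1 - 2 * L^-1) <= phi b.
  apply: (@le_trans _ _ (phi y * expR (- (2 * L^-1)))).
    by rewrite ler_wpM2l ?(ltW (phi_gt0 _)).
  by rewrite expRN ler_pdivrMr ?expR_gt0.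
have bi : (1 - L^-1) / (y * (1 + L^-1)) <= b^-1 - b^-1 ^+ 3.
  rewrite [b^-1 ^+ 3]exprS -{1}[b^-1]mulr1 -mulrBr mulrC.
  have c1 : 0 < y * (1 + L^-1) by rewrite mulr_gt0// addr_gt0.
  apply: ler_pM; rewrite ?invr_ge0 ?(ltW c1)//.
  - by move: l8; lra.
  - by rewrite lef_pV2 ?posrE.
  - by rewrite lerD2l lerN2.
apply: le_trans (ler_pM _ _ phb bi).
- rewrite (_ : phi y * _ * _ = tail y * ((1 - 2 * L^-1) * ((1 - L^-1) / (1 + L^-1)))); last first.
    by rewrite /tail; field; rewrite !gt_eqF// addr_gt0.
  rewrite mulrC ler_wpM2l ?(ltW t0)// mulrA ler_pdivlMr ?addr_gt0//.
  by move: l0 l8 (sqr_ge0 L^-1); nra.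
- by rewrite mulr_ge0 ?(ltW (phi_gt0 _))//; move: l8; lra.
- by apply: divr_ge0; [move: l8; lra|rewrite ltW// mulr_gt0// addr_gt0].
Qed.

Let leftover : expR (- (L ^+ 2 / 2)) * expR (- (y ^+ 2 / 2) + m3 * y ^+ 3 * zeta) <=
  2 ^+ 12 * Num.sqrt (2 * pi) * expR m3 * L^-1 * tail y.
Proof.
have z0 := sum_cube_ge0.
have y3 : y ^+ 3 * zeta <= 1.
  apply: le_trans eta1; apply: le_trans zeta_small.
  by rewrite ler_wpM2r// ler_weXn2l.
have e1 : expR (- (y ^+ 2 / 2)) = Num.sqrt (2 * pi) * y * tail y.
  rewrite /tail /phi; have := @sqrt2pi_gt0 R => /gt_eqF/negbT s0.
  by field; rewrite s0 gt_eqF.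
rewrite expRD e1.
have e2 : expR (m3 * y ^+ 3 * zeta) <= expR m3.
  by rewrite ler_expR -mulrA ler_piMr ?moment3_ge0.
have e3 : y * expR (- (L ^+ 2 / 2)) <= 2 ^+ 12 * L^-1.
  rewrite expRN ler_pdivrMr ?expR_gt0//.
  (* The case k = 4 at L^2/2 reads L^8 <= 16 * 4^4 exp(L^2/2), and 16 * 4^4 = 2^12; the left side
     exceeds y L = L^7. *)
  have := @pow_le_exp R 4 (L ^+ 2 / 2); rewrite divr_ge0 ?exprn_ge0 ?(ltW L0)// => /(_ isT) h.
  have : L ^+ 8 <= 2 ^+ 12 * expR (L ^+ 2 / 2).
    have -> : L ^+ 8 = 16 * (L ^+ 2 / 2) ^+ 4 by field.
    have -> : 2 ^+ 12 = 16 * 4 ^+ 4 :> R by ring.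
    by rewrite -mulrA ler_wpM2l.
  move=> h8; rewrite mulrAC ler_pdivlMr//; apply: le_trans h8.
  by rewrite -exprSr ler_weXn2l.
rewrite (_ : _ * (_ * _) = (y * expR (- (L ^+ 2 / 2))) * (Num.sqrt (2 * pi) * tail y * expR (m3 * y ^+ 3 * zeta))); last by ring.
rewrite (_ : 2 ^+ 12 * _ * _ * _ * _ = (2 ^+ 12 * L^-1) * (Num.sqrt (2 * pi) * tail y * expR m3)); last by ring.
apply: ler_pM => //.
- by rewrite mulr_ge0 ?expR_ge0// ltW.
- by rewrite mulr_ge0 ?expR_ge0// mulr_ge0 ?sqrtr_ge0// ltW.
- by rewrite ler_wpM2l// mulr_ge0 ?sqrtr_ge0// ltW.
Qed.

(** The 20 collects the Mills corrections and the division by Phi(L) >= 1 - 1/L, the middle term is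
    that of [leftover], and the 2 before [md_err_const] comes from the same division. *)
Definition md_const : R :=
  20 + 2 ^+ 12 * Num.sqrt (2 * pi) * expR m3 + 2 * md_err_const.

Lemma md_err_const_ge0 : 0 <= md_err_const.
Proof.
apply: mulr_ge0; last exact: sqrtr_ge0.
apply: mulr_ge0; last exact: expR_ge0.
apply: mulr_ge0; last exact: expR_ge0.
by apply: mulr_ge0; [exact/ltW/heatK_gt0|rewrite addr_ge0 ?moment3_ge0 ?sqr_ge0].
Qed.

Lemma moderate_deviation :
  `|fine (P [set w | y <= S w]) - tail y| <= md_const * (L^-1 + eta) * tail y.
Proof.
have E0 := md_err_const_ge0.
set pr := fine _.
have pr0 : 0 <= pr by exact: fine_ge0.
have lb0 := l0; have lb8 := l8; have tb0 := t0.
set l := L^-1 in lb0 lb8 *; set E := md_err_const in E0 *.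
pose C2 := 2 ^+ 12 * Num.sqrt (2 * pi) * expR m3.
have C20 : 0 <= C2.
  by rewrite mulr_ge0 ?expR_ge0// mulr_ge0 ?sqrtr_ge0// exprn_ge0.
have up := md_upper L y L1 y1 yz Lz; rewrite -/pr in up.
have lo := md_lower L y L1 y1 yz Lz; rewrite -/pr in lo.
have eb := err_bound; have tu := tail_upper; have tl := tail_lower; have lf := leftover.
rewrite -/l -/C2 in tu tl lf; rewrite -/E in eb.
have PL : 1 - l <= Phi L.
  have := mills_upper _ L0; have : phi L / L <= l.
    by rewrite ler_piMl ?(ltW lb0)// phi_le1.
  by rewrite -/l; lra.
set t := tail y in tb0 eb tu tl lf *.
have up2 : pr * (1 - l) <= t / (1 - 2 * l) ^+ 2 + E * eta * t.
  rewrite mulrC; apply: le_trans (ler_wpM2r pr0 PL) _.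
  by apply: le_trans up _; exact: lerD.
have p2 : t / (1 - 2 * l) ^+ 2 <= (1 + 16 * l) * t.
  rewrite ler_pdivrMr; last by rewrite exprn_gt0//; move: lb8; lra.
  rewrite mulrAC ler_peMl ?(ltW tb0)//.
  have l2 : 0 <= l * (1 - 8 * l) by rewrite mulr_ge0 ?(ltW lb0)//; move: lb8; lra.
  have l3 : 0 <= l ^+ 3 by rewrite exprn_ge0// ltW.
  by rewrite (_ : (1 + 16 * l) * (1 - 2 * l) ^+ 2 = 1 + 12 * l - 60 * l ^+ 2 + 64 * l ^+ 3); [move: lb0; nra|ring].
have Et : 0 <= E * eta * t by rewrite mulr_ge0 ?(ltW tb0)// mulr_ge0.
have Ct : 0 <= C2 * (l + eta) * t.
  by rewrite mulr_ge0 ?(ltW tb0)// mulr_ge0// addr_ge0// ltW.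
have Elt : 0 <= E * l * t by rewrite mulr_ge0 ?(ltW tb0)// mulr_ge0// ltW.
have lt0 : 0 < l * t by rewrite mulr_gt0.
have et0 : 0 <= eta * t by rewrite mulr_ge0// ltW.
change (`|pr - t| <= (20 + C2 + 2 * E) * (l + eta) * t).
rewrite ler_norml; apply/andP; split.
  have Cet : 0 <= C2 * eta * t by rewrite mulr_ge0 ?(ltW tb0)// mulr_ge0.
  by move: lo eb tl lf Cet Et Elt lt0 et0; lra.
rewrite lerBlDl.
suff : pr <= (1 + 20 * l) * t + 2 * (E * eta * t).
  by move: Ct Et Elt lt0 et0; lra.
have p1 : 0 < 1 - l by move: lb8; lra.
rewrite -(ler_pM2r p1); apply: le_trans up2 _.
apply: le_trans (lerD p2 (lexx _)) _.
have h1 : (1 + 16 * l) * t <= (1 + 20 * l) * t * (1 - l).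
  rewrite mulrAC ler_wpM2r ?(ltW tb0)//.
  have : 0 <= l * (1 - 8 * l) by rewrite mulr_ge0 ?(ltW lb0)//; move: lb8; lra.
  by move: lb0; nra.
have h2 : E * eta * t <= 2 * (E * eta * t) * (1 - l).
  by move: Et; set e := E * eta * t => e0; move: lb8; nra.
by move: h1 h2; lra.
Qed.

End Asymptotics.
End ModerateDeviation.

(** * The Chen-Stein method *)

Section RintegralSum.
Context {d} {Omega : measurableType d} {R : realType} (P : probability Omega R).

Lemma Rintegral_sum (J : Type) (s : seq J) (Q : pred J) (f : J -> Omega -> R) :
  (forall j, P.-integrable setT (EFin \o f j)) ->
  P.-integrable setT (EFin \o (fun w => \sum_(j <- s | Q j) f j w)) /\
  \int[P]_w (\sum_(j <- s | Q j) f j w) = \sum_(j <- s | Q j) \int[P]_w f j w.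
Proof.
move=> fi; elim: s => [|j s [IH1 IH2]].
  have e w : \sum_(j <- [::] | Q j) f j w = 0 by rewrite big_nil.
  rewrite (funext e) big_nil Rintegral_cst1; split => //.
  exact: finite_measure_integrable_cst.
rewrite big_cons; case Qj: (Q j); last first.
  have e w : \sum_(j <- j :: s | Q j) f j w = \sum_(j <- s | Q j) f j w.
    by rewrite big_cons Qj.
  by rewrite (funext e).
have e w : \sum_(j <- j :: s | Q j) f j w = f j w + \sum_(j <- s | Q j) f j w.
  by rewrite big_cons Qj.
rewrite (funext e); split; last by rewrite RintegralD// IH2.
rewrite (_ : EFin \o _ = (EFin \o f j) \+
  (EFin \o (fun w => (\sum_(j <- s | Q j) f j w)%R)))%E//.
exact: integrableD.
Qed.

Lemma measurable_comp_nat (f : Omega -> nat) (g : nat -> R) :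
  (forall k, measurable (f @^-1` [set k])) -> measurable_fun setT (fun w => g (f w)).
Proof.
move=> mf _ Y mY; rewrite setTI.
rewrite (_ : _ @^-1` Y = \bigcup_(k in [set k | Y (g k)]) (f @^-1` [set k])).
  by apply: bigcup_measurable => k _; exact: mf.
apply/seteqP; split => w /=; first by move=> Yw; exists (f w).
by move=> [k Yk fk]; rewrite /= fk.
Qed.

End RintegralSum.

Lemma has_derivX {R : realType} (k : nat) (s : R) :
  has_deriv (fun t => t ^+ k) s (k%:R * s ^+ k.-1).
Proof.
elim: k => [|k IH]; first by rewrite mul0r; exact: has_deriv_cst.
apply: (has_deriv_ext (fun t => t * t ^+ k)) => [t|]; first by rewrite exprS.
apply: has_deriv_eq (has_derivM _ _ _ _ _ (has_deriv_id s) IH) _.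
by case: k {IH} => [|k]; rewrite /= ?exprS -?natr1; ring.
Qed.

Section ChenStein.
Context {d} {Omega : measurableType d} {R : realType} (P : probability Omega R)
  {I : finType} (A : I -> set Omega) (B : I -> pred I).
Hypotheses (mA : forall i, measurable (A i)) (Bii : forall i, B i i).

(** [W] counts the events that occur and [V i] those outside the dependency neighbourhood [B i],
    which contains [i]. *)
Let ind i (w : Omega) : nat := (w \in A i).
Let W w : nat := (\sum_i ind i w)%N.
Let V i w : nat := (\sum_(j | ~~ B i j) ind j w)%N.
Let p i : R := fine (P (A i)).
Let lam : R := \sum_i p i.

(** The two classical Chen-Stein quantities. The diagonal j = i belongs to b1 only. *)
Definition chen_stein_b1 : R := \sum_i \sum_(j | B i j) fine (P (A i)) * fine (P (A j)).
Definition chen_stein_b2 : R := \sum_i \sum_(j | B i j && (j != i)) fine (P (A i `&` A j)).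

Let indE i w : (ind i w)%:R = \1_(A i) w :> R.
Proof. by rewrite /ind indicE. Qed.

Let mind i : measurable_fun setT (fun w => (ind i w)%:R : R).
Proof.
by rewrite (_ : (fun w => _) = (\1_(A i) : Omega -> R)); [exact: measurable_indic|exact/funext/indE].
Qed.

Let powE (s : R) (Q : pred I) w :
  s ^+ (\sum_(j | Q j) ind j w)%N = \prod_(j | Q j) (1 - (1 - s) * (ind j w)%:R).
Proof.
rewrite -prodrXr; apply: eq_bigr => j _; rewrite /ind.
by case: (w \in A j); rewrite ?mulr1 ?mulr0 ?subr0 ?expr0// opprB addrC subrK expr1.
Qed.

Let mpow (s : R) (Q : pred I) : measurable_fun setT (fun w => s ^+ (\sum_(j | Q j) ind j w)%N).
Proof.
rewrite (_ : (fun w => _) = (fun w => \prod_(j <- [seq j <- index_enum I | Q j])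
  (1 - (1 - s) * (ind j w)%:R))); last first.
  by apply/funext => w; rewrite powE big_filter.
apply: measurable_prod => j _.
by apply: measurable_funB => //; apply: measurable_funM => //; exact: mind.
Qed.

Let ibd (f : Omega -> R) : measurable_fun setT f -> (forall w, 0 <= f w <= 1) ->
  P.-integrable setT (EFin \o f).
Proof.
move=> mf f01; apply: (integrable_bounded P _ 1) => // w.
by have /andP[f0 f1] := f01 w; rewrite ger0_norm.
Qed.

Let pow01 (s : R) k : 0 <= s <= 1 -> 0 <= s ^+ k <= 1.
Proof. by move=> /andP[s0 s1]; rewrite exprn_ge0//= exprn_ile1. Qed.

Let iind i : P.-integrable setT (EFin \o (fun w => (ind i w)%:R : R)).
Proof. by apply: ibd => // w; rewrite /ind; case: (w \in A i); rewrite ?lexx ler01. Qed.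

Let Eind i : \int[P]_w ((ind i w)%:R : R) = p i.
Proof.
under eq_Rintegral do rewrite indE.
by rewrite /Rintegral integral_indic ?setIT.
Qed.

Hypothesis indep : forall i (s : R), 0 <= s <= 1 ->
  \int[P]_w ((ind i w)%:R * s ^+ V i w) = p i * \int[P]_w (s ^+ V i w).

Let G s := \int[P]_w (s ^+ W w).
Let G' s := \int[P]_w ((W w)%:R * s ^+ (W w).-1).

Let powdiff (s : R) (a b : nat) : 0 <= s <= 1 -> `|s ^+ (a + b) - s ^+ a| <= b%:R.
Proof.
move=> s01; have /andP[a0 a1] := pow01 _ a s01; have /andP[b0 b1] := pow01 _ b s01.
rewrite exprD -{2}[s ^+ a]mulr1 -mulrBr normrM (ger0_norm a0) ler0_norm ?subr_le0//.
case: b b0 b1 => [|b] b0 b1; first by rewrite expr0 subrr oppr0 mulr0.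
rewrite opprB (@le_trans _ _ 1)// ?ler1n// mulr_ile1// ?subr_ge0//.
by rewrite gerBl.
Qed.

Let mWk k : measurable (W @^-1` [set k]).
Proof.
have mW : measurable_fun setT (fun w => \sum_(i <- index_enum I) (ind i w)%:R : R).
  by apply: measurable_sum => i; exact: mind.
have := mW measurableT [set k%:R] (measurable_set1 _).
rewrite setTI; congr measurable; apply/seteqP; split => w /=; rewrite /W -natr_sum.
  by move=> /eqP; rewrite eqr_nat => /eqP.
by move=> ->.
Qed.

Let mW1 (s : R) : measurable_fun setT (fun w => s ^+ (W w).-1).
Proof. exact: (measurable_comp_nat W (fun k => s ^+ k.-1) mWk). Qed.

Let iprod i (f : Omega -> R) : measurable_fun setT f -> (forall w, 0 <= f w <= 1) ->
  P.-integrable setT (EFin \o (fun w => (ind i w)%:R * f w)).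
Proof.
move=> mf f01; apply: ibd; first by apply: measurable_funM => //; exact: mind.
by move=> w; rewrite /ind; case: (w \in A i); rewrite ?mul1r ?mul0r ?lexx ?ler01.
Qed.

Let indM i j w : (ind i w)%:R * (ind j w)%:R = \1_(A i `&` A j) w :> R.
Proof. by rewrite !indE indicI. Qed.

(* G s = E s^W solves G' = lam * G for a Poisson variable. Here it does so up to b1 + b2
   on [0, 1], and G 1 = 1 then determines G 0 = P(W = 0) up to the same error. *)
Let stein_bound (s : R) : 0 <= s <= 1 -> `|G' s - lam * G s| <= chen_stein_b1 + chen_stein_b2.
Proof.
move=> s01.
have -> : G' s = \sum_i \int[P]_w ((ind i w)%:R * s ^+ (W w).-1).
  rewrite -(Rintegral_sum P _ (index_enum I) xpredT _ _).2.
    by apply: eq_Rintegral => w _; rewrite /W natr_sum mulr_suml.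
  by move=> i; apply: iprod => // w; exact: pow01.
rewrite mulr_suml -sumrB.
apply: le_trans (ler_norm_sum _ _ _) _.
rewrite -big_split/=; apply: ler_sum => i _.
set Si := \int[P]_w (s ^+ V i w).
have iV : P.-integrable setT (EFin \o (fun w => s ^+ V i w)).
  by apply: ibd; [exact: mpow|move=> w; exact: pow01].
have iW : P.-integrable setT (EFin \o (fun w => s ^+ W w)).
  by apply: ibd; [exact: (mpow s xpredT)|move=> w; exact: pow01].
(* Independence makes the mean of [ind i * s ^+ V i] a product. Replacing W - 1 by V on the event
   [A i] costs b2; replacing the generating function of V by that of W costs b1. *)
have -> : \int[P]_w ((ind i w)%:R * s ^+ (W w).-1) - p i * G s =
  (\int[P]_w ((ind i w)%:R * s ^+ (W w).-1) - \int[P]_w ((ind i w)%:R * s ^+ V i w))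
   - p i * (G s - Si).
  by rewrite (indep i s s01) -/Si; ring.
apply: le_trans (ler_normB _ _) _; rewrite [leLHS]addrC.
have Wsplit w : W w = (V i w + \sum_(j | B i j) ind j w)%N.
  by rewrite /W (bigID (B i))/= addnC.
have p0 : 0 <= p i by exact: fine_ge0.
apply: lerD.
  rewrite normrM ger0_norm// -mulr_sumr ler_wpM2l//.
  rewrite -RintegralB//; apply: le_trans (le_normr_Rintegral _ _) _ => //.
    rewrite (_ : EFin \o _ = (EFin \o (fun w => (s ^+ W w)%R)) \- (EFin \o (fun w => (s ^+ V i w)%R)))%E//.
    exact: integrableB.
  have [is1 es1] := Rintegral_sum P _ (index_enum I) (B i) (fun j w => (ind j w)%:R) iind.
  rewrite (eq_bigr _ (fun j _ => esym (Eind j))) -es1.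
  apply: le_Rintegral => //.
    apply: (integrable_bounded P _ 2).
      apply: measurableT_comp => //; apply: measurable_funB; [exact: (mpow s xpredT)|exact: mpow].
    move=> w; rewrite normr_id (_ : 2 = 1 + 1)// (le_trans (ler_normB _ _))//.
    by apply: lerD; rewrite ger0_norm ?(andP (pow01 _ _ s01)).1 ?(andP (pow01 _ _ s01)).2.
  by move=> w _; rewrite Wsplit -natr_sum; exact: powdiff.
have i1 : P.-integrable setT (EFin \o (fun w => (ind i w)%:R * s ^+ (W w).-1)).
  by apply: iprod => // w; exact: pow01.
have i2 : P.-integrable setT (EFin \o (fun w => (ind i w)%:R * s ^+ V i w)).
  by apply: iprod; [exact: mpow|move=> w; exact: pow01].
rewrite -RintegralB//; apply: le_trans (le_normr_Rintegral _ _) _ => //.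
  rewrite (_ : EFin \o _ = (EFin \o (fun w => ((ind i w)%:R * s ^+ (W w).-1)%R)) \-
    (EFin \o (fun w => ((ind i w)%:R * s ^+ V i w)%R)))%E//.
  exact: integrableB.
have iAB j : P.-integrable setT (EFin \o (\1_(A i `&` A j) : Omega -> R)).
  apply: ibd; first by apply: measurable_indic; exact: measurableI.
  by move=> w; rewrite indicE; case: (_ \in _); rewrite ?lexx ler01.
have [is2 es2] := Rintegral_sum P _ (index_enum I) (fun j => B i j && (j != i)) _ iAB.
have -> : \sum_(j | B i j && (j != i)) fine (P (A i `&` A j)) =
    \sum_(j | B i j && (j != i)) \int[P]_w \1_(A i `&` A j) w.
  by apply: eq_bigr => j _; rewrite /Rintegral integral_indic ?setIT//; exact: measurableI.
rewrite -es2; apply: le_Rintegral => //.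
  apply: (integrable_bounded P _ 2).
    apply: measurableT_comp => //; apply: measurable_funB.
      by apply: measurable_funM; [exact: mind|exact: mW1].
    by apply: measurable_funM; [exact: mind|exact: mpow].
  move=> w; rewrite normr_id (_ : 2 = 1 + 1)// (le_trans (ler_normB _ _))//.
  by rewrite /ind; case: (w \in A i); rewrite ?mul1r ?mul0r ?normr0 ?addr0 ?ler0n//;
    apply: lerD; rewrite ger0_norm ?(andP (pow01 _ _ s01)).1 ?(andP (pow01 _ _ s01)).2.
move=> w _; rewrite -mulrBr normrM.
rewrite (eq_bigr _ (fun j _ => esym (indM i j w))) -mulr_sumr (ger0_norm (ler0n _ _)).
case iw : (ind i w) => [|k]; first by rewrite !mul0r.
have k0 : k = 0%N by move: iw; rewrite /ind; case: (w \in A i) => // -[].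
rewrite k0 !mul1r -natr_sum.
(* On [A i] the predecessor removes [i] itself, so W - 1 exceeds V by the number of other neighbours
   that occur. *)
have -> : (W w).-1 = (V i w + \sum_(j | B i j && (j != i)) ind j w)%N.
  by rewrite Wsplit (bigD1 i) ?Bii//= iw k0 addnCA add1n.
exact: powdiff.
Qed.

Let pk k : R := fine (P (W @^-1` [set k])).

(** [W] takes finitely many values, so its generating function is a polynomial and can be
    differentiated term by term. *)
Let expW (f : nat -> R) : \int[P]_w f (W w) = \sum_(k < #|I|.+1) f k * pk k.
Proof.
have Wle w : (W w < #|I|.+1)%N.
  rewrite ltnS /W -sum1_card; apply: leq_sum => i _.
  by rewrite /ind; case: (w \in A i).
have ik k : P.-integrable setT (EFin \o (fun w => f k * (\1_(W @^-1` [set k]) w : R))).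
  rewrite (_ : EFin \o _ = (fun w => (f k)%:E * (\1_(W @^-1` [set k]) w)%:E)%E)//.
  apply: integrableZl => //; apply: ibd; first exact: measurable_indic.
  by move=> w; rewrite indicE; case: (_ \in _); rewrite ?lexx ler01.
transitivity (\int[P]_w \sum_(k < #|I|.+1) f k * \1_(W @^-1` [set nat_of_ord k]) w).
  apply: eq_Rintegral => w _.
  rewrite (bigD1 (Ordinal (Wle w)))//= indicE mem_set// mulr1 big1 ?addr0// => k kW.
  rewrite indicE memNset ?mulr0//= => Wk.
  by move: kW; apply/negP; rewrite negbK; apply/eqP/val_inj.
rewrite (Rintegral_sum P _ _ xpredT _ (fun k : 'I_#|I|.+1 => ik k)).2.
apply: eq_bigr => k _; rewrite RintegralZl//.
  by rewrite /pk /Rintegral integral_indic ?setIT.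
apply: ibd; first exact: measurable_indic.
by move=> w; rewrite indicE; case: (_ \in _); rewrite ?lexx ler01.
Qed.

Let derG (s : R) : has_deriv G s (G' s).
Proof.
rewrite /G' (expW (fun k => k%:R * s ^+ k.-1)).
apply: (has_deriv_ext (fun s => \sum_(k < #|I|.+1) s ^+ k * pk k)) => [t|].
  by rewrite /G (expW (fun k => t ^+ k)).
have : is_derive s 1 (\sum_(k < #|I|.+1) (fun t : R => t ^+ k * pk k))
    (\sum_(k < #|I|.+1) k%:R * s ^+ k.-1 * pk k).
  apply: is_derive_sum => k; apply: has_deriv_eq.
    apply: has_derivM; last exact: has_deriv_cst.
    exact: has_derivX.
  by rewrite mulr0 addr0.
by rewrite /has_deriv; congr is_derive; apply/funext => t; rewrite fct_sumE.
Qed.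

(** The mean value theorem for G(s) exp(- lam s) between 0 and 1: the derivative is the Stein defect
    times a factor at most 1, and the end values are P(W = 0) and exp(- lam). *)
Lemma chen_stein :
  `|fine (P [set w | forall i, ~ A i w]) - expR (- \sum_i fine (P (A i)))| <=
  chen_stein_b1 + chen_stein_b2.
Proof.
rewrite -/lam.
have -> : fine (P [set w | forall i, ~ A i w]) = G 0 * expR (- (lam * 0)).
  (* Since 0 ^+ 0 = 1 and all other powers of 0 vanish, G at 0 is the probability that W = 0. *)
  rewrite mulr0 oppr0 expR0 mulr1 /G (expW (fun k => 0 ^+ k)) big_ord_recl/= expr0 mul1r.
  rewrite big1 ?addr0 => [|k _]; last by rewrite expr0n/= mul0r.
  congr (fine (P _)); apply/seteqP; split => w /=.
    move=> nA; rewrite /W big1// => i _; rewrite /ind memNset//; exact: nA.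
  move=> /eqP; rewrite /W sum_nat_eq0 => /forallP W0 i Ai.
  by have := W0 i; rewrite /ind mem_set.
have -> : expR (- lam) = G 1 * expR (- (lam * 1)).
  rewrite mulr1 /G; under eq_Rintegral do rewrite expr1n.
  by rewrite Rintegral_cst1 mul1r.
rewrite distrC.
have lam0 : 0 <= lam by apply: sumr_ge0 => i _; exact: fine_ge0.
pose H' s := (G' s - lam * G s) * expR (- (lam * s)).
have dH (s : R) : has_deriv (fun s => G s * expR (- (lam * s))) s (H' s).
  apply: has_deriv_eq.
    apply: has_derivM; first exact: derG.
    apply: has_deriv_comp; last exact: has_deriv_expR.
    by apply: has_derivN; apply: has_derivM; [exact: has_deriv_cst|exact: has_deriv_id].
  by rewrite /H'; ring.
have [c] := MVT_le _ _ _ _ (@ler01 R) (fun s _ => dH s).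
rewrite in_itv/= => c01 ->; rewrite subr0 mulr1 normrM.
apply: le_trans (_ : _ * 1 <= _); last by rewrite mulr1; exact: (stein_bound c c01).
rewrite ler_wpM2l// (ger0_norm (expR_ge0 _)) -expR0 ler_expR oppr_le0 mulr_ge0//.
by case/andP: c01.
Qed.

End ChenStein.

(** * Residual correlations *)

Section SquaredNorm.
Context {R : realType} {n : nat}.
Implicit Types (e v : 'cV[R]_n) (A : 'M[R]_n).

Definition nrm2 e : R := \sum_t e t ord0 ^+ 2.

Lemma nrm2E e : nrm2 e = (e^T *m e) ord0 ord0.
Proof. by rewrite mxE; apply: eq_bigr => t _; rewrite mxE expr2. Qed.

Lemma nrm2_ge0 e : 0 <= nrm2 e.
Proof. by apply: sumr_ge0 => t _; exact: sqr_ge0. Qed.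

Lemma row_nrm2 A t : \sum_u A t u ^+ 2 = (A *m A^T) t t.
Proof. by rewrite mxE; apply: eq_bigr => u _; rewrite mxE expr2. Qed.

Definition dotc e v : R := \sum_t e t ord0 * v t ord0.

Lemma dotcE e v : dotc e v = (e^T *m v) ord0 ord0.
Proof. by rewrite mxE; apply: eq_bigr => t _; rewrite mxE. Qed.

Lemma nrm2_proj_split (Q : 'M[R]_n) e : Q^T = Q -> Q *m Q = Q ->
  nrm2 e = nrm2 ((1%:M - Q) *m e) + nrm2 (Q *m e).
Proof.
move=> Qt QQ.
have Pt : (1%:M - Q)^T = 1%:M - Q by rewrite linearB/= trmx1 Qt.
rewrite !nrm2E !trmx_mul Pt Qt.
have -> : e^T *m (1%:M - Q) *m ((1%:M - Q) *m e) = e^T *m ((1%:M - Q) *m (1%:M - Q)) *m e.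
  by rewrite !mulmxA.
have -> : e^T *m Q *m (Q *m e) = e^T *m (Q *m Q) *m e by rewrite !mulmxA.
rewrite mulmxBl !mulmxBr !mulmx1 !mul1mx QQ subrr subr0.
rewrite [in RHS]mulmxBl -[RHS](_ : ((e^T *m e - e^T *m Q *m e) + (e^T *m Q *m e)) ord0 ord0 = _).
  by rewrite subrK.
by rewrite mxE.
Qed.

(** Q2 (1 - Q1) Q2 = Q2 - (Q2 Q1) (Q2 Q1)', and the subtracted matrix has nonnegative diagonal. Up
    to the factor m2 this bounds the variances of the coordinates of Q2 P1 e1. *)
Lemma proj_row_bound (Q1 Q2 : 'M[R]_n) t : Q1^T = Q1 -> Q1 *m Q1 = Q1 ->
  Q2^T = Q2 -> Q2 *m Q2 = Q2 ->
  \sum_u (Q2 *m (1%:M - Q1)) t u ^+ 2 <= Q2 t t.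
Proof.
move=> Q1t Q11 Q2t Q22; rewrite row_nrm2.
have -> : Q2 *m (1%:M - Q1) *m (Q2 *m (1%:M - Q1))^T = Q2 - (Q2 *m Q1) *m (Q2 *m Q1)^T.
  have Pt : (1%:M - Q1)^T = 1%:M - Q1 by rewrite linearB/= trmx1 Q1t.
  rewrite !trmx_mul Pt Q1t Q2t.
  have -> : Q2 *m (1%:M - Q1) *m ((1%:M - Q1) *m Q2) = Q2 *m ((1%:M - Q1) *m (1%:M - Q1)) *m Q2.
    by rewrite !mulmxA.
  have -> : Q2 *m Q1 *m (Q1 *m Q2) = Q2 *m (Q1 *m Q1) *m Q2 by rewrite !mulmxA.
  by rewrite mulmxBl !mulmxBr !mulmx1 !mul1mx Q11 subrr subr0 mulmxBl Q22.
by rewrite mxE [X in _ + X]mxE -row_nrm2 gerBl; apply: sumr_ge0 => u _; exact: sqr_ge0.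
Qed.

End SquaredNorm.

Section Residuals.
Context {R : realType} {n p : nat} (x : 'M[R]_(n, p)).
Hypothesis ux : x^T *m x \in unitmx.
Local Notation Pm := (residual_maker x).

Definition hat_matrix : 'M[R]_n := x *m invmx (x^T *m x) *m x^T.
Local Notation Q := hat_matrix.

Lemma residual_makerE : Pm = 1%:M - Q. Proof. by []. Qed.

Lemma hat_sym : Q^T = Q.
Proof. by rewrite /Q !trmx_mul trmx_inv !trmx_mul !trmxK mulmxA. Qed.

Lemma hat_idem : Q *m Q = Q.
Proof.
rewrite /hat_matrix !mulmxA -[x *m _ *m x^T *m x]mulmxA -[x *m _ *m (x^T *m x)]mulmxA.
by rewrite mulVmx// mulmx1.
Qed.

Lemma hat_trace : \tr Q = p%:R.
Proof. by rewrite /hat_matrix -mulmxA mxtrace_mulC -mulmxA mulVmx// mxtrace1. Qed.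

Lemma resid_sym : Pm^T = Pm.
Proof. by rewrite residual_makerE linearB/= trmx1 hat_sym. Qed.

Lemma hat_diag t : Q t t = \sum_u Q t u ^+ 2.
Proof. by rewrite row_nrm2 hat_sym hat_idem. Qed.

Lemma hat_diag_ge0 t : 0 <= Q t t.
Proof. by rewrite hat_diag; apply: sumr_ge0 => u _; exact: sqr_ge0. Qed.

Lemma hat_diag_le1 t : Q t t <= 1.
Proof.
have : Q t t ^+ 2 <= Q t t.
  rewrite [leRHS]hat_diag (bigD1 t)//= lerDl.
  by apply: sumr_ge0 => u _; exact: sqr_ge0.
by have := hat_diag_ge0 t; nra.
Qed.

Lemma hat_diag_sum : \sum_t Q t t = p%:R.
Proof. exact: hat_trace. Qed.

Lemma nrm2_split (e : 'cV[R]_n) : nrm2 e = nrm2 (Pm *m e) + nrm2 (Q *m e).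
Proof. exact: nrm2_proj_split hat_sym hat_idem. Qed.

End Residuals.

Section TwoResiduals.
Context {R : realType} {n p : nat} (x1 x2 : 'M[R]_(n, p)).
Hypotheses (ux1 : x1^T *m x1 \in unitmx) (ux2 : x2^T *m x2 \in unitmx).
Local Notation P1 := (residual_maker x1).
Local Notation P2 := (residual_maker x2).
Local Notation Q1 := (hat_matrix x1).
Local Notation Q2 := (hat_matrix x2).

Lemma hat_resid_row t : \sum_u (Q2 *m P1) t u ^+ 2 <= Q2 t t.
Proof.
by apply: proj_row_bound; rewrite ?hat_sym ?hat_idem.
Qed.

(** By symmetry of the residual makers the numerator is linear in [e2] with coefficient vector P2 P1
    e1, which depends on [e1] alone. *)
Lemma residual_corrE (e1 e2 : 'cV[R]_n) :
  residual_corr x1 x2 e1 e2 = dotc (P2 *m (P1 *m e1)) e2 /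
    (Num.sqrt (nrm2 (P1 *m e1)) * Num.sqrt (nrm2 (P2 *m e2))).
Proof.
rewrite /residual_corr dotcE (trmx_mul P2) (trmx_mul P1) !resid_sym.
by rewrite /euclidean_norm -!/(nrm2 _).
Qed.

Lemma residual_corr_sym (e1 e2 : 'cV[R]_n) :
  residual_corr x1 x2 e1 e2 = residual_corr x2 x1 e2 e1.
Proof.
rewrite /residual_corr [X in _ / X]mulrC; congr (_ / _).
transitivity ((e1^T *m P1 *m P2 *m e2)^T ord0 ord0); first by rewrite [RHS]mxE.
by rewrite !trmx_mul trmxK !resid_sym !mulmxA.
Qed.

Section Good.
Variables (s m2 C3 : R).

(* s stands for T^(1/10): n = s ^+ 10 in all applications. *)
Record good (e : 'cV[R]_n) : Prop := Good {
  good_max : forall t, `|e t ord0| <= s ^+ 2;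
  good_hat1 : forall t, `|(Q1 *m e) t ord0| <= s ^+ 2 * Num.sqrt (Q1 t t);
  good_hat2 : forall t, `|(Q2 *m (P1 *m e)) t ord0| <= s ^+ 2 * Num.sqrt (Q2 t t);
  good_sqr : `|nrm2 e - m2 * s ^+ 10| <= s ^+ 7;
  good_cube : \sum_t `|e t ord0| ^+ 3 <= C3 * s ^+ 10
}.


Hypotheses (m2_gt0 : 0 < m2) (C30 : 0 <= C3).
(** Chosen so that D >= 1 and D m2 >= 4; the latter gives 4 s^7 <= delta m2 s^10, so the fluctuation
    s^7 of a squared norm is a fraction delta / 4 of its size. *)
Definition corr_slack : R := 1 + 4 / m2.
Local Notation D := corr_slack.
Local Notation delta := (D / s ^+ 3).
Hypotheses (s1 : 1 <= s) (sbig : 4 * D * (p%:R + 1) <= s ^+ 3).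

Let s0 : 0 < s. Proof. exact: lt_le_trans s1. Qed.
Let D1 : 1 <= D. Proof. by rewrite lerDl divr_ge0// ltW. Qed.
Let D0 : 0 < D. Proof. exact: lt_le_trans D1. Qed.
Let Dm : 4 <= D * m2.
Proof. by rewrite /D mulrDl divfK ?gt_eqF// mul1r lerDr ltW. Qed.
Let p0 : 0 <= p%:R :> R. Proof. exact: ler0n. Qed.
Let sD : 4 * D <= s ^+ 3.
Proof. by apply: le_trans sbig; rewrite ler_peMr ?mulr_ge0 ?(ltW D0)// lerDr. Qed.
Let sp : p%:R <= s ^+ 3.
Proof.
apply: le_trans sbig; rewrite (@le_trans _ _ (p%:R + 1))// ?lerDl//.
by rewrite ler_peMl ?addr_ge0//; have := D1; lra.
Qed.

Let delta_gt0 : 0 < delta. Proof. by rewrite divr_gt0// exprn_gt0. Qed.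
Let delta_le : delta <= 4^-1.
Proof. by rewrite ler_pdivrMr ?exprn_gt0// mulrC ler_pdivlMr// mulrC. Qed.

Let ps4 : p%:R * s ^+ 4 <= s ^+ 7.
Proof. by rewrite (exprD s 3 4) ler_wpM2r// exprn_ge0// ltW. Qed.

Let s7 : s ^+ 7 <= m2 * s ^+ 10 / 4.
Proof.
rewrite ler_pdivlMr// (exprD s 3 7) mulrA mulrC ler_wpM2r ?exprn_ge0 ?(ltW s0)//.
apply: le_trans Dm _; rewrite mulrC ler_wpM2l ?(ltW m2_gt0)//.
by apply: le_trans sD; have := D0; lra.
Qed.

Let delta10 : 4 * s ^+ 7 <= delta * (m2 * s ^+ 10).
Proof.
have -> : delta * (m2 * s ^+ 10) = D * m2 * s ^+ 7 by field; rewrite gt_eqF.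
by rewrite ler_wpM2r ?exprn_ge0 ?(ltW s0).
Qed.

(** The diagonal of the hat matrix sums to p, so the squared norm is at most p s^4, and p <= s^3 by
    [sbig]. Here the rank of the design enters. *)
Lemma hat_small (x : 'M[R]_(n, p)) (v : 'cV[R]_n) : x^T *m x \in unitmx ->
  (forall t, `|v t ord0| <= s ^+ 2 * Num.sqrt (hat_matrix x t t)) ->
  nrm2 v <= s ^+ 7.
Proof.
move=> ux vt; apply: le_trans ps4.
rewrite -(hat_diag_sum x ux) mulr_suml; apply: ler_sum => t _.
have h0 := hat_diag_ge0 x ux t.
rewrite -(real_normK (num_real _)).
apply: le_trans (_ : (s ^+ 2 * Num.sqrt (hat_matrix x t t)) ^+ 2 <= _).
  by rewrite lerXn2r ?nnegrE// mulr_ge0 ?sqrtr_ge0// exprn_ge0// ltW.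
by rewrite exprMn sqr_sqrtr// -exprM mulrC.
Qed.

Section Center.
Variable e1 : 'cV[R]_n.
Hypothesis ge1 : good e1.
Local Notation w := (P2 *m (P1 *m e1)).
Local Notation N1 := (nrm2 (P1 *m e1)).

Lemma good_N1 : m2 * s ^+ 10 - 2 * s ^+ 7 <= N1 <= m2 * s ^+ 10 + s ^+ 7.
Proof.
have gs := good_sqr _ ge1; rewrite ler_norml in gs; case/andP: gs => a b.
have e := nrm2_split x1 ux1 e1; have c := hat_small _ _ ux1 (good_hat1 _ ge1).
have f := nrm2_ge0 (Q1 *m e1); apply/andP; split; move: a b c e f; lra.
Qed.

Lemma good_w : nrm2 w <= N1 <= nrm2 w + s ^+ 7.
Proof.
have := nrm2_split x2 ux2 (P1 *m e1); have := hat_small _ _ ux2 (good_hat2 _ ge1).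
have := nrm2_ge0 (Q2 *m (P1 *m e1)) => a b ->.
by apply/andP; split; move: a b; lra.
Qed.

Lemma good_w_lower : m2 * s ^+ 10 / 4 <= nrm2 w.
Proof. by have /andP[a b] := good_N1; have /andP[c e] := good_w; move: s7 a b c e; lra. Qed.

Let w0 : 0 < nrm2 w.
Proof. by apply: lt_le_trans good_w_lower; rewrite divr_gt0// mulr_gt0// exprn_gt0. Qed.

Lemma good_N1_ratio : N1 <= (1 + delta) * nrm2 w.
Proof.
have /andP[_ h] := good_w; apply: le_trans h _; rewrite mulrDl mul1r lerD2l.
have := ler_wpM2l (ltW delta_gt0) good_w_lower.
rewrite (_ : delta * (m2 * s ^+ 10 / 4) = delta * (m2 * s ^+ 10) / 4); last by rewrite mulrA.
by move: delta10; set A := delta * (m2 * s ^+ 10); set B := delta * nrm2 w; lra.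
Qed.

(* Given e1 the numerator of the correlation is the linear form w . e2; dividing by
   sqrt (m2 |w|^2) normalises its variance. *)
Definition weight t : R := w t ord0 / Num.sqrt (m2 * nrm2 w).

Let mw0 : 0 < m2 * nrm2 w. Proof. exact: mulr_gt0. Qed.

Lemma weight_unit : m2 * \sum_t weight t ^+ 2 = 1.
Proof.
under eq_bigr do rewrite /weight expr_div_n sqr_sqrtr ?(ltW mw0)//.
rewrite -mulr_suml -/(nrm2 w); field; by rewrite !gt_eqF.
Qed.

Lemma weight_dot (e2 : 'cV[R]_n) : (\sum_t weight t * e2 t ord0) ^+ 2 = dotc w e2 ^+ 2 / (m2 * nrm2 w).
Proof.
rewrite -[X in _ / X](sqr_sqrtr (ltW mw0)) -expr_div_n; congr (_ ^+ 2).
by rewrite /dotc mulr_suml; apply: eq_bigr => t _; rewrite /weight mulrAC.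
Qed.

Let sqrt_lower : m2 * s ^+ 5 / 2 <= Num.sqrt (m2 * nrm2 w).
Proof.
have a0 : 0 <= m2 * s ^+ 5 / 2 by rewrite divr_ge0// mulr_ge0 ?exprn_ge0 ?ltW.
rewrite -(ger0_norm a0) -sqrtr_sqr ler_wsqrtr//.
apply: le_trans (ler_wpM2l (ltW m2_gt0) good_w_lower).
by rewrite le_eqVlt; apply/orP; left; apply/eqP; field.
Qed.

Let wt t : w t ord0 = e1 t ord0 - (Q1 *m e1) t ord0 - (Q2 *m (P1 *m e1)) t ord0.
Proof.
rewrite {1}residual_makerE mulmxBl mul1mx mxE [X in _ + X]mxE; congr (_ - _).
by rewrite residual_makerE mulmxBl mul1mx mxE [X in _ + X]mxE.
Qed.

Let sqrt_hat_le (x : 'M[R]_(n, p)) (ux : x^T *m x \in unitmx) t : Num.sqrt (hat_matrix x t t) <= 1.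
Proof. by rewrite -[leRHS]sqrtr1 ler_wsqrtr// hat_diag_le1. Qed.

Let wt3 t : `|w t ord0| <= `|e1 t ord0| + `|(Q1 *m e1) t ord0| + `|(Q2 *m (P1 *m e1)) t ord0|.
Proof. by rewrite wt (le_trans (ler_normB _ _))// lerD2r ler_normB. Qed.

Let hatQ1 t : `|(Q1 *m e1) t ord0| <= s ^+ 2.
Proof.
apply: le_trans (good_hat1 _ ge1 t) _.
by rewrite ler_piMr ?exprn_ge0 ?(ltW s0)// sqrt_hat_le.
Qed.

Let hatQ2 t : `|(Q2 *m (P1 *m e1)) t ord0| <= s ^+ 2.
Proof.
apply: le_trans (good_hat2 _ ge1 t) _.
by rewrite ler_piMr ?exprn_ge0 ?(ltW s0)// sqrt_hat_le.
Qed.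

(** The vector w is e1 minus two fitted parts, each of the three with entries at most s^2, and the
    normalising root is at least m2 s^5 / 2. *)
Lemma weight_max t : `|weight t| <= 6 / m2 / s ^+ 3.
Proof.
rewrite /weight normrM normfV (ger0_norm (sqrtr_ge0 _)).
have a0 : 0 < m2 * s ^+ 5 / 2 by rewrite divr_gt0// mulr_gt0 ?exprn_gt0.
rewrite (_ : 6 / m2 / s ^+ 3 = (3 * s ^+ 2) * (m2 * s ^+ 5 / 2)^-1); last first.
  by field; rewrite !gt_eqF.
apply: ler_pM; rewrite ?normr_ge0 ?invr_ge0 ?sqrtr_ge0//.
  by have := wt3 t; have := good_max _ ge1 t; have := hatQ1 t; have := hatQ2 t; lra.
by rewrite lef_pV2 ?posrE// (lt_le_trans a0 sqrt_lower).
Qed.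

Let cube3 (a b c : R) : 0 <= a -> 0 <= b -> 0 <= c ->
  (a + b + c) ^+ 3 <= 9 * (a ^+ 3 + b ^+ 3 + c ^+ 3).
Proof.
move=> a0 b0 c0.
have ab (u v : R) : 0 <= u -> 0 <= v -> u ^+ 2 * v + u * v ^+ 2 <= u ^+ 3 + v ^+ 3.
  by move=> u0 v0; have := mulr_ge0 (sqr_ge0 (u - v)) (addr_ge0 u0 v0); lra.
have abc : 3 * (a * b * c) <= a ^+ 3 + b ^+ 3 + c ^+ 3.
  have h : 0 <= (a - b) ^+ 2 + (b - c) ^+ 2 + (a - c) ^+ 2.
    by rewrite !addr_ge0 ?sqr_ge0.
  by have := mulr_ge0 (addr_ge0 (addr_ge0 a0 b0) c0) h; lra.
have := ab a b a0 b0; have := ab b c b0 c0; have := ab a c a0 c0.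
rewrite (_ : (a + b + c) ^+ 3 = a ^+ 3 + b ^+ 3 + c ^+ 3 + 3 * (a ^+ 2 * b + a * b ^+ 2)
 + 3 * (b ^+ 2 * c + b * c ^+ 2) + 3 * (a ^+ 2 * c + a * c ^+ 2) + 6 * (a * b * c)); last by ring.
by move: abc; lra.
Qed.

Let hat_cube (x : 'M[R]_(n, p)) (ux : x^T *m x \in unitmx) (v : 'cV[R]_n) :
  (forall t, `|v t ord0| <= s ^+ 2 * Num.sqrt (hat_matrix x t t)) ->
  \sum_t `|v t ord0| ^+ 3 <= s ^+ 10.
Proof.
move=> vt; apply: (@le_trans _ _ (s ^+ 2 * nrm2 v)).
  rewrite mulr_sumr; apply: ler_sum => t _.
  rewrite exprS real_normK ?num_real// ler_wpM2r ?sqr_ge0//.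
  by apply: le_trans (vt t) _; rewrite ler_piMr ?exprn_ge0 ?(ltW s0)// sqrt_hat_le.
have := hat_small x v ux vt => h.
apply: le_trans (ler_wpM2l (exprn_ge0 2 (ltW s0)) h) _.
by rewrite -exprD ler_weXn2l.
Qed.

(** The cubes of e1 sum to O(s^10) by [good_cube], those of the two fitted parts to at most s^2 s^7
    each. Dividing by (m2 s^5 / 2)^3 leaves s^-5, with 72 = 9 * 8. *)
Lemma weight_cube : \sum_t `|weight t| ^+ 3 <= 72 * (C3 + 2) / m2 ^+ 3 / s ^+ 5.
Proof.
have a0 : 0 < m2 * s ^+ 5 / 2 by rewrite divr_gt0// mulr_gt0 ?exprn_gt0.
have -> : \sum_t `|weight t| ^+ 3 = (\sum_t `|w t ord0| ^+ 3) / Num.sqrt (m2 * nrm2 w) ^+ 3.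
  rewrite mulr_suml; apply: eq_bigr => t _.
  by rewrite /weight normrM normfV (ger0_norm (sqrtr_ge0 _)) exprMn exprVn.
have w3 : \sum_t `|w t ord0| ^+ 3 <= 9 * ((C3 + 2) * s ^+ 10).
  apply: (@le_trans _ _ (\sum_t 9 * (`|e1 t ord0| ^+ 3 + `|(Q1 *m e1) t ord0| ^+ 3 +
      `|(Q2 *m (P1 *m e1)) t ord0| ^+ 3))).
    apply: ler_sum => t _; apply: le_trans (cube3 _ _ _ _ _ _) => //.
    by rewrite lerXn2r ?nnegrE ?addr_ge0// wt3.
  rewrite -mulr_sumr ler_wpM2l// !big_split/= mulrDl [2 * _]mulr_natl mulr2n addrA.
  apply: lerD; last exact: hat_cube (good_hat2 _ ge1).
  apply: lerD; last exact: hat_cube (good_hat1 _ ge1).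
  exact: good_cube ge1.
rewrite (_ : 72 * (C3 + 2) / m2 ^+ 3 / s ^+ 5 =
  9 * ((C3 + 2) * s ^+ 10) * ((m2 * s ^+ 5 / 2) ^+ 3)^-1); last first.
  by field; rewrite !gt_eqF.
apply: ler_pM; rewrite ?invr_ge0 ?exprn_ge0 ?sqrtr_ge0//.
  by apply: sumr_ge0 => t _; exact: exprn_ge0.
rewrite lef_pV2 ?posrE ?exprn_gt0// ?(lt_le_trans a0 sqrt_lower)//.
by rewrite lerXn2r ?nnegrE ?sqrtr_ge0 ?(ltW a0).
Qed.

Section Event.
Variables (e2 : 'cV[R]_n) (y : R).
Hypotheses (he2 : forall t, `|(Q2 *m e2) t ord0| <= s ^+ 2 * Num.sqrt (Q2 t t))
  (sq2 : `|nrm2 e2 - m2 * s ^+ 10| <= s ^+ 7) (y0 : 0 < y).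
Local Notation N2 := (nrm2 (P2 *m e2)).
Local Notation zeta := (\sum_t weight t * e2 t ord0).

Let N2b : (1 - delta) * (m2 * s ^+ 10) <= N2 <= (1 + delta) * (m2 * s ^+ 10).
Proof.
have := sq2; rewrite ler_norml => /andP[a b].
have c := nrm2_ge0 (Q2 *m e2); have f := hat_small _ _ ux2 he2.
have g := nrm2_split x2 ux2 e2.
have h7 : 0 <= s ^+ 7 by rewrite exprn_ge0// ltW.
by apply/andP; split; move: delta10 a b c f g h7; lra.
Qed.

Let ms0 : 0 < m2 * s ^+ 10. Proof. by rewrite mulr_gt0// exprn_gt0. Qed.

Let N20 : 0 < N2.
Proof.
have /andP[h _] := N2b; apply: lt_le_trans h; rewrite mulr_gt0//.
by move: delta_le; lra.
Qed.

Let N10 : 0 < N1. Proof. by have /andP[h _] := good_w; exact: lt_le_trans h. Qed.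

(** An exact identity: T times the squared correlation is the squared linear form times a ratio of
    norms. The next two lemmas show that this ratio is close to 1. *)
Let corr2 : s ^+ 10 * residual_corr x1 x2 e1 e2 ^+ 2 =
  zeta ^+ 2 * (nrm2 w * (m2 * s ^+ 10)) / (N1 * N2).
Proof.
rewrite residual_corrE weight_dot expr_div_n exprMn !sqr_sqrtr ?nrm2_ge0//.
by field; rewrite !gt_eqF.
Qed.

(** The ratio in [corr2] is at most 1 / (1 - delta): projecting shortens P1 e1 to w, and the second
    residual norm is at least (1 - delta) m2 s^10. *)
Lemma corr_event_sub : y ^+ 2 < s ^+ 10 * residual_corr x1 x2 e1 e2 ^+ 2 ->
  y * (1 - delta) <= `|zeta|.
Proof.
have d1 : 0 <= 1 - delta by move: delta_le; lra.
rewrite corr2 ltr_pdivlMr ?mulr_gt0// => h.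
rewrite -(ler_pXn2r (ltn0Sn 1)) ?nnegrE ?mulr_ge0 ?(ltW y0)//.
rewrite real_normK ?num_real//.
have M0 : 0 < nrm2 w * (m2 * s ^+ 10) by rewrite mulr_gt0.
rewrite -(ler_pM2r M0) (le_trans _ (ltW h))//.
have /andP[wN _] := good_w; have /andP[lN _] := N2b.
rewrite (_ : (y * (1 - delta)) ^+ 2 * _ =
  y ^+ 2 * (nrm2 w * ((1 - delta) ^+ 2 * (m2 * s ^+ 10)))); last by ring.
rewrite ler_wpM2l ?sqr_ge0//.
apply: ler_pM => //; [exact: ltW|by apply: mulr_ge0; [exact: sqr_ge0|exact: ltW]|].
apply: le_trans lN; rewrite ler_wpM2r ?(ltW ms0)// expr2 ler_piMr//.
by move: delta_gt0; lra.
Qed.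

(** The ratio in [corr2] is at least (1 + delta)^-2. Taking 2 delta in the threshold leaves room for
    the strict inequality. *)
Lemma corr_event_sup : y * (1 + 2 * delta) <= `|zeta| ->
  y ^+ 2 < s ^+ 10 * residual_corr x1 x2 e1 e2 ^+ 2.
Proof.
move=> h; rewrite corr2 ltr_pdivlMr ?mulr_gt0//.
have d1 : 0 <= 1 + 2 * delta by move: delta_gt0; lra.
have d2 : 0 <= 1 + delta by move: delta_gt0; lra.
have M0 : 0 < nrm2 w * (m2 * s ^+ 10) by rewrite mulr_gt0.
have h2 : (y * (1 + 2 * delta)) ^+ 2 <= zeta ^+ 2.
  by rewrite -[leRHS]real_normK ?num_real// lerXn2r ?nnegrE ?mulr_ge0 ?(ltW y0).
apply: lt_le_trans (ler_wpM2r (ltW M0) h2).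
have /andP[_ uN] := N2b; have rN := good_N1_ratio.
apply: (@le_lt_trans _ _ (y ^+ 2 * ((1 + delta) ^+ 2 * (nrm2 w * (m2 * s ^+ 10))))).
  rewrite ler_wpM2l ?sqr_ge0//.
  rewrite (_ : (1 + delta) ^+ 2 * _ = ((1 + delta) * nrm2 w) * ((1 + delta) * (m2 * s ^+ 10))); last by ring.
  by apply: ler_pM; rewrite ?(ltW N10) ?(ltW N20).
rewrite (_ : (y * (1 + 2 * delta)) ^+ 2 * _ =
  y ^+ 2 * ((1 + 2 * delta) ^+ 2 * (nrm2 w * (m2 * s ^+ 10)))); last by ring.
rewrite ltr_pM2l ?exprn_gt0// ltr_pM2r//.
by rewrite ltrXn2r ?nnegrE//; move: delta_gt0; lra.
Qed.

End Event.
End Center.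
End Good.
End TwoResiduals.

(** * Concentration of the errors *)

Section UnionBound.
Context {d} {Omega : measurableType d} {R : realType} (P : probability Omega R).

Lemma pr_union2 (A B : set Omega) (a b : R) : measurable A -> measurable B ->
  (P A <= a%:E)%E -> (P B <= b%:E)%E -> (P (A `|` B) <= (a + b)%:E)%E.
Proof.
move=> mA mB Aa Bb; apply: le_trans (measureU2 _ mA mB) _.
by rewrite EFinD; apply: leeD.
Qed.

Lemma pr_union_fin (J : finType) (A : J -> set Omega) (a : R) :
  (forall j, measurable (A j)) -> (forall j, P (A j) <= a%:E)%E ->
  measurable [set w | exists j, A j w] /\
  (P [set w | exists j, A j w] <= (#|J|%:R * a)%:E)%E.
Proof.
move=> mA Aa.
have h (s : seq J) : measurable (\big[setU/set0]_(j <- s) A j) /\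
    (P (\big[setU/set0]_(j <- s) A j) <= ((size s)%:R * a)%:E)%E.
  elim: s => [|j s [IH1 IH2]]; first by rewrite big_nil measure0 mul0r.
  rewrite big_cons; split; first exact: measurableU.
  rewrite /= -addn1 natrD mulrDl mul1r addrC; exact: pr_union2.
have -> : [set w | exists j, A j w] = \big[setU/set0]_(j <- enum J) A j.
  rewrite -bigcup_seq; apply/seteqP; split => w /=.
    by move=> [j Aj]; exists j => //=; rewrite mem_enum.
  by move=> [j _ Aj]; exists j.
by have := h (enum J); rewrite -cardE.
Qed.

End UnionBound.

Section Concentration.
Context {d} {Omega : measurableType d} {R : realType} (P : probability Omega R)
  {I : finType} (X : I -> Omega -> R) (mu : probability R R).
Hypotheses (mX : forall i, measurable_fun setT (X i))
  (indX : mutually_independent P X)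
  (lawX : forall i A, measurable A -> P (X i @^-1` A) = mu A).

(** From exp(t) <= 1 / (1 - t). No lower bound on t is involved, so summands unbounded below are
    allowed. *)
Lemma expR_le_quad (t : R) : t <= 2^-1 -> expR t <= 1 + t + 2 * t ^+ 2.
Proof.
move=> t2; have h : 0 < 1 - t by lra.
rewrite -[leLHS]invrK -expRN.
apply: (@le_trans _ _ (1 - t)^-1).
  by rewrite lef_pV2 ?posrE ?expR_gt0//; exact: expR_ge1Dx.
rewrite -[leLHS]mul1r ler_pdivrMr//.
have : 0 <= t ^+ 2 * (1 - 2 * t) by rewrite mulr_ge0 ?sqr_ge0//; lra.
by lra.
Qed.

Lemma measurable_sum_comp (f : R -> R) : measurable_fun setT f ->
  measurable_fun setT (fun w => \sum_i f (X i w)).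
Proof. by move=> mf; apply: measurable_sum => i; exact: measurableT_comp. Qed.

(** A one-sided Bernstein bound: [expR_le_quad] bounds the exponential moment of one summand by its
    first two moments, then Markov. The sum of squares is controlled from below in this way without
    truncation. *)
Lemma concentration (f : R -> R) (theta a b delta : R) :
  measurable_fun setT f -> 0 <= theta -> (forall x, theta * f x <= 2^-1) ->
  mu.-integrable setT (EFin \o f) -> mu.-integrable setT (EFin \o (fun x => f x ^+ 2)) ->
  \int[mu]_x f x <= a -> \int[mu]_x (f x ^+ 2) <= b ->
  (P [set w | (#|I|%:R * (a + delta) <= \sum_i f (X i w))%R] <=
    (expR (#|I|%:R * (2 * theta ^+ 2 * b - theta * delta)))%:E)%E.
Proof.
move=> mf th0 thf if1 if2 fa fb.
have mef : measurable_fun setT (fun x => expR (theta * f x)).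
  by apply: measurableT_comp => //; exact: measurable_funM.
have ief : mu.-integrable setT (EFin \o (fun x => expR (theta * f x))).
  apply: (integrable_bounded mu _ (expR 2^-1)) => // x.
  by rewrite ger0_norm ?expR_ge0// ler_expR.
pose r := \int[mu]_x expR (theta * f x).
have r0 : 0 <= r by apply: Rintegral_ge0 => x _; exact: expR_ge0.
have rb : r <= expR (theta * a + 2 * theta ^+ 2 * b).
  have i0 : mu.-integrable setT (EFin \o (fun _ : R => 1 : R)).
    exact: finite_measure_integrable_cst.
  have i1 := integrableM_cst mu f theta if1.
  have i2 := integrableM_cst mu (fun x => f x ^+ 2) (2 * theta ^+ 2) if2.
  apply: (@le_trans _ _ (\int[mu]_x (1 + theta * f x + 2 * theta ^+ 2 * f x ^+ 2))).
    apply: le_Rintegral => //.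
      by apply: integrableD_fun => //; exact: integrableD_fun.
    by move=> x _; apply: le_trans (expR_le_quad _ (thf x)) _; rewrite exprMn mulrA.
  rewrite RintegralD//; last exact: integrableD_fun.
  rewrite RintegralD// Rintegral_cst1 !RintegralZl//.
  apply: le_trans (expR_ge1Dx _); rewrite -addrA lerD2l lerD//.
    exact: ler_wpM2l.
  by rewrite ler_wpM2l// mulr_ge0// exprn_ge0.
have mS := measurable_sum_comp f mf.
have mS' : measurable_fun setT (fun w => theta * \sum_i f (X i w)).
  exact: measurable_funM.
apply: (@le_trans _ _ (P [set w | (theta * (#|I|%:R * (a + delta)) <= theta * \sum_i f (X i w))%R])).
  apply: le_measure; rewrite ?inE.
  - exact: measurable_set_ge mS.
  - exact: measurable_set_ge mS'.
  - by move=> w /=; exact: ler_wpM2l.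
apply: le_trans (markov_exp P (fun w => theta * \sum_i f (X i w)) _ (r ^+ #|I|) mS' _) _.
  rewrite (eq_integral (fun w => (\prod_i expR (theta * f (X i w)))%:E)); last first.
    by move=> w _; rewrite -expR_sum big_distrr.
  rewrite (prod_integral P X mu mX indX lawX (fun _ x => expR (theta * f x)) (fun _ => r)
    (index_enum I) (index_enum_uniq I))//.
  - by rewrite prodr_const.
  - by move=> j; rewrite EFin_Rintegral.
rewrite lee_fin.
apply: (@le_trans _ _ (expR (- (theta * (#|I|%:R * (a + delta)))) *
    expR (theta * a + 2 * theta ^+ 2 * b) ^+ #|I|)).
  by rewrite ler_wpM2l ?expR_ge0// lerXn2r ?nnegrE ?expR_ge0.
rewrite -expRM_natl -expRD ler_expR.
by rewrite le_eqVlt; apply/orP; left; apply/eqP; ring.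
Qed.

Variable u0 : R.
Hypotheses (u0gt0 : 0 < u0)
  (int2 : mu.-integrable setT (fun x : R => (expR (2 * u0 * `|x|))%:E))
  (mean0 : \int[mu]_x x = 0).
Local Notation m2 := (moment2 mu).
Local Notation m3 := (moment3 mu u0).

Definition linear_const : R := expR (m2 * u0 ^+ 2 / 2 + m3 * u0 ^+ 3).

(** Markov at the fixed tilt [u0], admissible because every coefficient is at most 1 in absolute
    value. The sign [sg] serves both tails. *)
Lemma linear_unit_tail (z : I -> R) (sg h : R) : \sum_i z i ^+ 2 <= 1 -> `|sg| = 1 ->
  (P [set w | (h <= sg * \sum_i z i * X i w)%R] <= (expR (- (u0 * h)) * linear_const)%:E)%E.
Proof.
move=> z1 sg1.
have zi i : `|z i| <= 1.
  rewrite -(ler_pXn2r (ltn0Sn 1)) ?nnegrE// expr1n real_normK ?num_real//.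
  apply: le_trans z1; rewrite (bigD1 i)//= lerDl; apply: sumr_ge0 => j _; exact: sqr_ge0.
have mS := measurable_linear X mX z (index_enum I).
have mS' : measurable_fun setT (fun w => u0 * sg * \sum_i z i * X i w).
  exact: measurable_funM.
have mS2 : measurable_fun setT (fun w => sg * \sum_i z i * X i w).
  exact: measurable_funM.
apply: (@le_trans _ _ (P [set w | (u0 * h <= u0 * sg * \sum_i z i * X i w)%R])).
  apply: le_measure; rewrite ?inE.
  - exact: measurable_set_ge mS2.
  - exact: measurable_set_ge mS'.
  - by move=> w /= hw; rewrite -mulrA ler_wpM2l// ltW.
apply: markov_exp => //.
have usg : `|u0 * sg| = u0 by rewrite normrM sg1 mulr1 gtr0_norm.
apply: le_trans (linear_mgf P X mu mX indX lawX u0 u0gt0 int2 mean0 (u0 * sg) z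
  (index_enum I) (index_enum_uniq I) _) _.
  by move=> i; rewrite usg ler_piMr// ltW.
rewrite lee_fin ler_expR usg.
have -> : (u0 * sg) ^+ 2 = u0 ^+ 2 by rewrite -real_normK ?num_real// usg.
have c1 : \sum_i `|z i| ^+ 3 <= 1.
  apply: le_trans z1; apply: ler_sum => i _.
  by rewrite exprS real_normK ?num_real// ler_piMl ?sqr_ge0.
apply: lerD.
  rewrite ler_wpM2r// ler_piMr// mulr_ge0 ?moment2_ge0// exprn_ge0// ltW//.
rewrite ler_piMr// mulr_ge0 ?moment3_ge0// exprn_ge0// ltW//.
Qed.

Lemma linear_tail (a : I -> R) (r h : R) : 0 <= h -> \sum_i a i ^+ 2 <= r ->
  measurable [set w | (h * Num.sqrt r < `|\sum_i a i * X i w|)%R] /\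
  (P [set w | (h * Num.sqrt r < `|\sum_i a i * X i w|)%R] <=
    (2 * linear_const * expR (- (u0 * h)))%:E)%E.
Proof.
move=> h0 ar.
have mS := measurable_linear X mX a (index_enum I).
have mA : measurable [set w | (h * Num.sqrt r < `|\sum_i a i * X i w|)%R].
  have mN : measurable_fun setT (fun w => `|\sum_i a i * X i w|) by exact: measurableT_comp.
  have := mN measurableT `]h * Num.sqrt r, +oo[%classic (measurable_itv _).
  by rewrite setTI; congr measurable; apply/seteqP; split => w /=; rewrite in_itv/= andbT.
split => //.
have l0 : 0 <= 2 * linear_const * expR (- (u0 * h)) by rewrite !mulr_ge0 ?expR_ge0.
have r0 : 0 <= r by apply: le_trans ar; apply: sumr_ge0 => i _; exact: sqr_ge0.
(* For r = 0 all coefficients vanish and the strict inequality makes the event empty; otherwise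
   divide by the root of r. *)
have [r00|rn0] := eqVneq r 0.
  rewrite (_ : [set w | _] = set0) ?measure0 ?lee_fin//.
  apply/seteqP; split => w //=; rewrite r00 sqrtr0 mulr0.
  rewrite big1 ?normr0 ?ltxx// => i _.
  have : a i ^+ 2 <= 0.
    rewrite -r00; apply: le_trans ar; rewrite (bigD1 i)//= lerDl.
    by apply: sumr_ge0 => j _; exact: sqr_ge0.
  by rewrite le_eqVlt ltNge sqr_ge0 orbF sqrf_eq0 => /eqP ->; rewrite mul0r.
have rp : 0 < r by rewrite lt_neqAle eq_sym rn0.
have q0 : 0 < Num.sqrt r by rewrite sqrtr_gt0.
pose z i := a i / Num.sqrt r.
have z1 : \sum_i z i ^+ 2 <= 1.
  under eq_bigr do rewrite /z expr_div_n sqr_sqrtr//.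
  by rewrite -mulr_suml ler_pdivrMr// mul1r.
have zE w : \sum_i z i * X i w = (\sum_i a i * X i w) / Num.sqrt r.
  by rewrite mulr_suml; apply: eq_bigr => i _; rewrite /z mulrAC.
have n1 : `|1 : R| = 1 by rewrite normr1.
have n2 : `|-1 : R| = 1 by rewrite normrN normr1.
have mz := measurable_linear X mX z (index_enum I).
have mz1 sg : measurable [set w | (h <= sg * \sum_i z i * X i w)%R].
  by apply: measurable_set_ge; exact: measurable_funM.
apply: le_trans (_ : P ([set w | (h <= 1 * \sum_i z i * X i w)%R] `|`
    [set w | (h <= -1 * \sum_i z i * X i w)%R]) <= _)%E.
  apply: le_measure; rewrite ?inE//; first exact: measurableU.
  move=> w /=; rewrite !zE mul1r mulN1r -mulNr !ler_pdivlMr//.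
  by rewrite ltr_normr => /orP[/ltW|/ltW]; [left|right].
apply: le_trans (pr_union2 P _ _ _ _ (mz1 1) (mz1 (-1)) (linear_unit_tail z 1 h z1 n1)
  (linear_unit_tail z (-1) h z1 n2)) _.
rewrite lee_fin le_eqVlt; apply/orP; left; apply/eqP; ring.
Qed.

Definition abs_moment (k : nat) : R := \int[mu]_x (`|x| ^+ k).

Lemma abs_moment_ge0 k : 0 <= abs_moment k.
Proof. by apply: Rintegral_ge0 => x _; exact: exprn_ge0. Qed.

(* The summands are truncated at M so that theta * f stays below 1/2. *)
Lemma truncated_power_tail (k : nat) (M delta theta : R) : 0 <= M ->
  theta * M ^+ k <= 2^-1 -> 0 <= theta ->
  (P [set w | (#|I|%:R * (abs_moment k + delta) <=
      \sum_i (`|X i w| ^+ k * \1_(`[- M, M]%classic) (X i w)))%R] <=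
    (expR (#|I|%:R * (2 * theta ^+ 2 * abs_moment (2 * k) - theta * delta)))%:E)%E.
Proof.
move=> M0 thM th0.
pose f (x : R) := `|x| ^+ k * \1_(`[- M, M]%classic) x.
have i01 (x : R) : 0 <= (\1_(`[- M, M]%classic) x : R) <= 1.
  by rewrite indicE; case: (_ \in _); rewrite ?lexx ler01.
have f0 x : 0 <= f x by rewrite mulr_ge0 ?exprn_ge0//; case/andP: (i01 x).
have fx x : f x <= `|x| ^+ k by rewrite ler_piMr ?exprn_ge0//; case/andP: (i01 x).
have mf : measurable_fun setT f.
  apply: measurable_funM; last exact: measurable_indic.
  by apply: measurable_funX; exact: normr_measurable.
apply: (concentration f) => //.
- move=> x; rewrite /f indicE; case: (boolP (x \in _)) => [|_]; last first.
    by rewrite mulr0 mulr0.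
  rewrite inE/= in_itv/= -ler_norml mulr1 => xM; apply: le_trans thM.
  by rewrite ler_wpM2l// lerXn2r ?nnegrE.
- apply: (integrable_le mu _ (fun x => `|x| ^+ k)) => //; last exact: integrable_pow mu u0 u0gt0 int2 (k).
  by move=> x; rewrite ger0_norm.
- apply: (integrable_le mu _ (fun x => `|x| ^+ (2 * k))); last exact: integrable_pow mu u0 u0gt0 int2 (2 * k).
    exact: measurable_funX.
  by move=> x; rewrite ger0_norm ?sqr_ge0// mulnC exprM lerXn2r ?nnegrE ?exprn_ge0.
- apply: le_Rintegral => //; last exact: integrable_pow mu u0 u0gt0 int2 (k).
  apply: (integrable_le mu _ (fun x => `|x| ^+ k)) => //; last exact: integrable_pow mu u0 u0gt0 int2 (k).
  by move=> x; rewrite ger0_norm.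
- apply: le_Rintegral => //; last 2 first.
  + exact: integrable_pow mu u0 u0gt0 int2 (2 * k).
  + by move=> x _; rewrite mulnC exprM lerXn2r ?nnegrE ?exprn_ge0.
  apply: (integrable_le mu _ (fun x => `|x| ^+ (2 * k))); last exact: integrable_pow mu u0 u0gt0 int2 (2 * k).
    exact: measurable_funX.
  by move=> x; rewrite ger0_norm ?sqr_ge0// mulnC exprM lerXn2r ?nnegrE ?exprn_ge0.
Qed.

Lemma square_lower_tail (delta theta : R) : 0 <= theta ->
  (P [set w | (#|I|%:R * (- m2 + delta) <= \sum_i (- X i w ^+ 2))%R] <=
    (expR (#|I|%:R * (2 * theta ^+ 2 * abs_moment 4 - theta * delta)))%:E)%E.
Proof.
move=> th0.
have mf : measurable_fun setT (fun x : R => - x ^+ 2).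
  by apply: measurableT_comp => //; exact: measurable_funX.
have e x : (- x ^+ 2) ^+ 2 = `|x| ^+ 4 :> R.
  by rewrite sqrrN -exprM -normrX ger0_norm// (exprM x 2 2) sqr_ge0.
apply: (concentration (fun x => - x ^+ 2)) => //.
- by move=> x; rewrite mulrN; have := mulr_ge0 th0 (sqr_ge0 x); lra.
- apply: (integrable_le mu _ (fun x => `|x| ^+ 2)) => //; last exact: integrable_pow mu u0 u0gt0 int2 2.
  by move=> x; rewrite normrN normrX.
- by rewrite (funext e); exact: integrable_pow mu u0 u0gt0 int2 4.
- rewrite /moment2; under eq_Rintegral do rewrite -mulN1r.
  by rewrite RintegralZl// ?mulN1r//; exact: integrable_sqr mu u0 u0gt0 int2.
- by under eq_Rintegral do rewrite e.
Qed.

End Concentration.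

Section GoodEvent.
Context {d} {Omega : measurableType d} {R : realType} (P : probability Omega R)
  {n p : nat} (X : 'I_n -> Omega -> R) (mu : probability R R).
Hypotheses (mX : forall i, measurable_fun setT (X i))
  (indX : mutually_independent P X)
  (lawX : forall i A, measurable A -> P (X i @^-1` A) = mu A).
Variable u0 : R.
Hypotheses (u0gt0 : 0 < u0)
  (int2 : mu.-integrable setT (fun x : R => (expR (2 * u0 * `|x|))%:E))
  (mean0 : \int[mu]_x x = 0).
Local Notation m2 := (moment2 mu).
Local Notation C3 := (abs_moment mu 3 + 1).
Variables (x1 x2 : 'M[R]_(n, p)).
Hypotheses (ux1 : x1^T *m x1 \in unitmx) (ux2 : x2^T *m x2 \in unitmx).
Variable s : R.
Hypotheses (s1 : 1 <= s) (ns : n%:R = s ^+ 10).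

(** In order: three families of n = s^10 linear forms exceeding the height s^2, the two tails of the
    sum of squares at deviation s^7, and the upper tail of the sum of cubes. *)
Definition bad_bound (s : R) : R :=
  s ^+ 10 * (2 * linear_const mu u0 * expR (- (u0 * s ^+ 2))) * 3 +
  expR ((abs_moment mu 4 * s ^+ 2 - s ^+ 3) / 2) * 2 +
  expR ((abs_moment mu 6 / s ^+ 2 - s ^+ 4) / 2).

Let s0 : 0 < s. Proof. exact: lt_le_trans s1. Qed.
Let s20 : 0 <= s ^+ 2. Proof. exact: sqr_ge0. Qed.
Let colX w : 'cV[R]_n := \col_t X t w.

Let rows_bad (A : 'M[R]_n) (r : 'I_n -> R) : (forall t, \sum_u A t u ^+ 2 <= r t) ->
  exists B : set Omega, [/\ measurable B,
    (P B <= (s ^+ 10 * (2 * linear_const mu u0 * expR (- (u0 * s ^+ 2))))%:E)%E &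
    forall w, ~ B w -> forall t, `|(A *m colX w) t ord0| <= s ^+ 2 * Num.sqrt (r t)].
Proof.
move=> Ar.
have lt t := linear_tail P X mu mX indX lawX u0 u0gt0 int2 mean0 (A t) (r t) (s ^+ 2) s20 (Ar t).
have [mB PB] := pr_union_fin P _ _ _ (fun t => (lt t).1) (fun t => (lt t).2).
rewrite card_ord ns in PB.
exists [set w | exists t, s ^+ 2 * Num.sqrt (r t) < `|\sum_u A t u * X u w|]; split => //.
move=> w /= nB t; rewrite leNgt; apply/negP => h; apply: nB; exists t.
have e : (A *m colX w) t ord0 = \sum_u A t u * X u w.
  by rewrite mxE; apply: eq_bigr => u _; rewrite /colX mxE.
by move: h; rewrite e.
Qed.

Lemma good_event : exists Bad : set Omega, [/\ measurable Bad,
  (P Bad <= (bad_bound s)%:E)%E &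
  forall w, ~ Bad w -> good x1 x2 s m2 C3 (\col_t X t w)].
Proof.
have r1 t : \sum_u (1%:M : 'M[R]_n) t u ^+ 2 <= 1.
  rewrite (bigD1 t)//= big1 ?addr0 ?mxE ?eqxx ?expr1n// => u ut.
  by rewrite mxE eq_sym (negbTE ut) expr0n.
have r2 t : \sum_u hat_matrix x1 t u ^+ 2 <= hat_matrix x1 t t by rewrite -hat_diag.
(* The identity matrix yields the bound on the entries themselves. *)
have [B1 [mB1 PB1 hB1]] := rows_bad 1%:M (fun _ => 1) r1.
have [B2 [mB2 PB2 hB2]] := rows_bad (hat_matrix x1) (fun t => hat_matrix x1 t t) r2.
have [B3 [mB3 PB3 hB3]] := rows_bad (hat_matrix x2 *m residual_maker x1)
  (fun t => hat_matrix x2 t t) (hat_resid_row x1 x2 ux1 ux2).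
(* The tilts 1/(2 s^4) and 1/(2 s^6) are the largest compatible with squares and cubes truncated at
   height s^2. *)
have th4 : 0 <= (2 * s ^+ 4)^-1 by rewrite invr_ge0 mulr_ge0 ?exprn_ge0 ?(ltW s0).
have th6 : 0 <= (2 * s ^+ 6)^-1 by rewrite invr_ge0 mulr_ge0 ?exprn_ge0 ?(ltW s0).
have sn0 : s != 0 by rewrite gt_eqF.
have th4m : (2 * s ^+ 4)^-1 * (s ^+ 2) ^+ 2 <= 2^-1.
  by rewrite -exprM invfM -mulrA mulVf ?mulr1 ?expf_neq0.
have th6m : (2 * s ^+ 6)^-1 * (s ^+ 2) ^+ 3 <= 2^-1.
  by rewrite -exprM invfM -mulrA mulVf ?mulr1 ?expf_neq0.
have P4 := truncated_power_tail P X mu mX indX lawX u0 u0gt0 int2 2 (s ^+ 2) (s ^- 3)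
  (2 * s ^+ 4)^-1 s20 th4m th4.
have P5 := square_lower_tail P X mu mX indX lawX u0 u0gt0 int2 (s ^- 3) (2 * s ^+ 4)^-1 th4.
have P6 := truncated_power_tail P X mu mX indX lawX u0 u0gt0 int2 3 (s ^+ 2) 1
  (2 * s ^+ 6)^-1 s20 th6m th6.
have mtr k : measurable_fun setT (fun w => \sum_i (`|X i w| ^+ k *
    \1_(`[- (s ^+ 2), s ^+ 2]%classic) (X i w) : R)).
  apply: (measurable_sum_comp X mX (fun x => `|x| ^+ k * \1_(`[- (s ^+ 2), s ^+ 2]%classic) x)).
  apply: measurable_funM; last exact: measurable_indic.
  by apply: measurable_funX; exact: normr_measurable.
have msq : measurable_fun setT (fun w => \sum_i (- X i w ^+ 2)).
  apply: (measurable_sum_comp X mX (fun x => - x ^+ 2)).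
  by apply: measurableT_comp => //; exact: measurable_funX.
have mB4 := measurable_set_ge _ (#|'I_n|%:R * (abs_moment mu 2 + s ^- 3)) (mtr 2).
have mB5 := measurable_set_ge _ (#|'I_n|%:R * (- m2 + s ^- 3)) msq.
have mB6 := measurable_set_ge _ (#|'I_n|%:R * (abs_moment mu 3 + 1)) (mtr 3).
have e45 : #|'I_n|%:R * (2 * (2 * s ^+ 4)^-1 ^+ 2 * abs_moment mu 4 - (2 * s ^+ 4)^-1 * s ^- 3) =
    (abs_moment mu 4 * s ^+ 2 - s ^+ 3) / 2.
  by rewrite card_ord ns; field.
have e6 : #|'I_n|%:R * (2 * (2 * s ^+ 6)^-1 ^+ 2 * abs_moment mu 6 - (2 * s ^+ 6)^-1 * 1) =
    (abs_moment mu 6 / s ^+ 2 - s ^+ 4) / 2.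
  by rewrite card_ord ns; field.
rewrite e45 in P4 P5; rewrite e6 in P6.
have U12 := pr_union2 P _ _ _ _ mB1 mB2 PB1 PB2.
have U123 := pr_union2 P _ _ _ _ (measurableU _ _ mB1 mB2) mB3 U12 PB3.
have U45 := pr_union2 P _ _ _ _ mB4 mB5 P4 P5.
have U456 := pr_union2 P _ _ _ _ (measurableU _ _ mB4 mB5) mB6 U45 P6.
have mU123 := measurableU _ _ (measurableU _ _ mB1 mB2) mB3.
have mU456 := measurableU _ _ (measurableU _ _ mB4 mB5) mB6.
have U := pr_union2 P _ _ _ _ mU123 mU456 U123 U456.
eexists; split; [exact: measurableU mU123 mU456| |].
  apply: le_trans U _; rewrite lee_fin /bad_bound le_eqVlt; apply/orP; left; apply/eqP; ring.
move=> w /= nB.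
have n1 : ~ B1 w by move=> h; apply: nB; left; left; left.
have n2 : ~ B2 w by move=> h; apply: nB; left; left; right.
have n3 : ~ B3 w by move=> h; apply: nB; left; right.
have gmax t : `|X t w| <= s ^+ 2.
  by have := hB1 w n1 t; rewrite mul1mx mxE sqrtr1 mulr1.
(* Off [B1] every entry lies in the truncation interval, so the truncated sums are the full ones. *)
have indmax t : \1_(`[- (s ^+ 2), s ^+ 2]%classic) (X t w) = 1 :> R.
  by rewrite indicE mem_set//= in_itv/= -ler_norml.
have sum_tr k : \sum_i (`|X i w| ^+ k * \1_(`[- (s ^+ 2), s ^+ 2]%classic) (X i w)) =
    \sum_i `|X i w| ^+ k.
  by apply: eq_bigr => i _; rewrite indmax mulr1.
have s37 : s ^+ 10 * s ^- 3 = s ^+ 7 by field.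
have m22 : abs_moment mu 2 = m2.
  by apply: eq_Rintegral => x _; rewrite real_normK ?num_real.
split => [t|t|t||].
- by rewrite mxE.
- exact: hB2.
- by rewrite mulmxA; exact: hB3.
- rewrite /nrm2; under eq_bigr do rewrite mxE.
  rewrite ler_norml; apply/andP; split.
    rewrite leNgt; apply/negP => h; apply: nB; right; left; right => /=.
    by rewrite card_ord ns mulrDr s37 sumrN; move: h; rewrite mulrN; lra.
  rewrite leNgt; apply/negP => h; apply: nB; right; left; left => /=.
  rewrite sum_tr card_ord ns mulrDr s37 m22.
  under eq_bigr do rewrite real_normK ?num_real//.
  by move: h; rewrite mulrC; lra.
- under eq_bigr do rewrite mxE.
  rewrite leNgt; apply/negP => h; apply: nB; right; right => /=.
  by rewrite sum_tr card_ord ns mulrC ltW.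
Qed.

End GoodEvent.

(** The first term is the critical one: the power s^10 is absorbed by half of the exponent u0 s^2,
    whence 2 k <= u0. The other two terms decay like exp(- s^3 / 2) and exp(- s^4 / 2). *)
Lemma bad_bound_decay {R : realType} (mu : probability R R) (u0 : R) : 0 < u0 ->
  exists K kappa : R, [/\ 0 <= K, 0 < kappa &
    forall s, 1 <= s -> bad_bound mu u0 s <= K * expR (- (kappa * s ^+ 2))].
Proof.
move=> u00; pose k := Num.min (u0 / 2) 2^-1.
have k0 : 0 < k by rewrite lt_min divr_gt0//= invr_gt0.
have ku : 2 * k <= u0 by rewrite -ler_pdivlMl// mulrC ge_min lexx.
have k2 : k <= 2^-1 by rewrite ge_min lexx orbT.
set c := linear_const mu u0; set a4 := abs_moment mu 4; set a6 := abs_moment mu 6.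
have c0 : 0 <= c by exact: expR_ge0.
have a40 : 0 <= a4 by exact: abs_moment_ge0.
have a60 : 0 <= a6 by exact: abs_moment_ge0.
(* After factoring out exp(- k s^2) the exponent is (B s^2 - s^3) / 2, at most B^3 / 2 whether s <=
   B or not. *)
pose B := a4 + 2 * k.
have B0 : 0 <= B by rewrite addr_ge0// mulr_ge0// ltW.
exists (6 * c * (5 / k) ^+ 5 + 2 * expR (B ^+ 3 / 2) + expR (a6 / 2)), k; split => //.
  have e5 : 0 <= (5 / k) ^+ 5 by rewrite exprn_ge0// divr_ge0// ltW.
  have h6 : 0 <= 6 * c * (5 / k) ^+ 5 by apply: mulr_ge0 => //; exact: mulr_ge0.
  have h7 : 0 <= 2 * expR (B ^+ 3 / 2) by apply: mulr_ge0 => //; exact: expR_ge0.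
  have h8 : 0 <= expR (a6 / 2) by exact: expR_ge0.
  by move: h6 h7 h8; lra.
move=> s s1; have s0 : 0 < s by exact: lt_le_trans s1.
have s2 : 1 <= s ^+ 2 by exact: exprn_ege1.
rewrite /bad_bound -/c -/a4 -/a6 [leRHS]mulrDl [X in _ <= X + _]mulrDl.
apply: lerD; first apply: lerD.
- have h : s ^+ 10 * expR (- (u0 * s ^+ 2)) <= (5 / k) ^+ 5 * expR (- (k * s ^+ 2)).
    have := @pow_le_exp R 5 (k * s ^+ 2); rewrite mulr_ge0 ?sqr_ge0 ?(ltW k0)// => /(_ isT) h5.
    have s10 : s ^+ 10 <= (5 / k) ^+ 5 * expR (k * s ^+ 2).
      rewrite expr_div_n mulrAC ler_pdivlMr ?exprn_gt0// mulrC (exprM s 2 5) -exprMn.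
      exact: h5.
    apply: le_trans (ler_wpM2r (expR_ge0 _) s10) _.
    rewrite -mulrA ler_wpM2l ?exprn_ge0 ?divr_ge0 ?(ltW k0)// -expRD ler_expR.
    by have := ler_wpM2r (sqr_ge0 s) ku; lra.
  rewrite (_ : _ * 3 = 6 * c * (s ^+ 10 * expR (- (u0 * s ^+ 2)))); last by ring.
  rewrite -(mulrA (6 * c)); apply: ler_wpM2l => //; exact: mulr_ge0.
- rewrite mulrC -(mulrA 2); apply: ler_wpM2l => //; rewrite -expRD ler_expR.
  have : B * s ^+ 2 - s ^+ 3 <= B ^+ 3.
    have [sB|/ltW Bs] := leP s B.
      have : B * s ^+ 2 <= B * B ^+ 2 by rewrite ler_wpM2l// lerXn2r ?nnegrE ?(ltW s0).
      by rewrite -exprS; have := exprn_ge0 3 (ltW s0); lra.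
    have : B * s ^+ 2 <= s * s ^+ 2 by rewrite ler_wpM2r ?sqr_ge0.
    by rewrite -exprS; have := exprn_ge0 3 B0; lra.
  by rewrite /B; lra.
- rewrite -expRD ler_expR.
  have h1 : a6 / s ^+ 2 <= a6 by rewrite ler_piMr// invf_le1// exprn_gt0.
  have h2 : s ^+ 2 <= s ^+ 4 by rewrite ler_weXn2l.
  by have := ler_wpM2r (sqr_ge0 s) k2; lra.
Qed.

(** * Tails of the residual correlations *)

Section TailShift.
Context {R : realType}.

Lemma tail_gt0 (y : R) : 0 < y -> 0 < tail y.
Proof. by move=> y0; rewrite divr_gt0// phi_gt0. Qed.

Lemma expR_le_lin (t : R) : 0 <= t -> t <= 2^-1 -> expR t <= 1 + 2 * t.
Proof.
move=> t0 t2; apply: le_trans (expR_le_quad _ t2) _.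
have : t * t <= 2^-1 * t by rewrite ler_wpM2r.
by rewrite expr2; lra.
Qed.

Lemma tail_scale (y a : R) : 0 < y -> 0 < a ->
  tail (y * a) = tail y * expR (y ^+ 2 / 2 * (1 - a ^+ 2)) / a.
Proof.
move=> y0 a0; rewrite /tail /phi.
have -> : - ((y * a) ^+ 2 / 2) = - (y ^+ 2 / 2) + y ^+ 2 / 2 * (1 - a ^+ 2) by ring.
rewrite expRD; field.
by rewrite !gt_eqF// sqrt2pi_gt0.
Qed.

(** A relative change delta of the level changes log [tail] by about y^2 delta + delta; both are
    kept below [c]. *)
Lemma tail_shift (y delta c : R) : 0 < y -> 0 <= delta -> delta <= c ->
  y ^+ 2 * delta <= c -> c <= 4^-1 ->
  tail (y * (1 - delta)) <= (1 + 6 * c) * tail y /\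
  (1 - 6 * c) * tail y <= tail (y * (1 + 2 * delta)).
Proof.
move=> y0 d0 dc yc c4; have t0 := tail_gt0 y y0.
have c0 : 0 <= c by exact: le_trans dc.
have y20 : 0 <= y ^+ 2 by exact: sqr_ge0.
split.
  rewrite tail_scale//; last by lra.
  rewrite -mulrA mulrC ler_pM2r//.
  have h1 : expR (y ^+ 2 / 2 * (1 - (1 - delta) ^+ 2)) <= 1 + 2 * c.
    apply: le_trans (expR_le_lin c c0 _); last by lra.
    rewrite ler_expR; have := mulr_ge0 y20 (sqr_ge0 delta).
    by rewrite expr2 (expr2 delta) => h; move: h yc; lra.
  rewrite ler_pdivrMr; last by lra.
  apply: le_trans h1 _.
  have : delta * (1 + 6 * c) <= c * (1 + 6 * c) by rewrite ler_wpM2r//; lra.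
  have : c * c <= 4^-1 * c by rewrite ler_wpM2r.
  by lra.
rewrite tail_scale//; last by lra.
rewrite -mulrA [leRHS]mulrC ler_pM2r// ler_pdivlMr; last by lra.
apply: (@le_trans _ _ (1 - 5 / 2 * c)).
  have : 0 <= (1 - 6 * c) * (c - delta) \/ 1 - 6 * c < 0.
    by have [h|h] := leP 0 (1 - 6 * c); [left; apply: mulr_ge0 => //; lra|right].
  case=> [h|h].
    by have := mulr_ge0 c0 c0; lra.
  have : (1 - 6 * c) * (1 + 2 * delta) <= 0 by apply: mulr_le0_ge0; lra.
  by lra.
apply: le_trans (expR_ge1Dx _).
have : y ^+ 2 * delta * delta <= c * 4^-1.
  by apply: ler_pM => //; [exact: mulr_ge0|lra].
by rewrite expr2 => h; move: h yc; lra.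
Qed.

End TailShift.

Section TwoSided.
Context {R : realType} (mu : probability R R) (u0 : R).
Hypotheses (u0gt0 : 0 < u0)
  (int2 : mu.-integrable setT (fun x : R => (expR (2 * u0 * `|x|))%:E))
  (mean0 : \int[mu]_x x = 0).
Local Notation m2 := (moment2 mu).

Lemma md_const_ge0 : 0 <= md_const mu u0.
Proof.
have h1 := md_err_const_ge0 mu u0.
rewrite /md_const; apply: addr_ge0; last first.
  by apply: mulr_ge0.
apply: addr_ge0; first by [].
apply: mulr_ge0; last exact: expR_ge0.
by apply: mulr_ge0; [exact: exprn_ge0|exact: sqrtr_ge0].
Qed.

(** [moderate_deviation] for z and for - z. The constants come before the probability space and the
    weights, so one choice serves all N, all pairs and all values of the conditioning vector. *)
Lemma two_sided_deviation (e : R) : 0 < e -> exists M eta0 : R, [/\ 1 <= M, 0 < eta0 &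
  forall (d : measure_display) (Omega : measurableType d) (P : probability Omega R)
    (I : finType) (X : I -> Omega -> R),
  (forall i, measurable_fun setT (X i)) -> mutually_independent P X ->
  (forall i A, measurable A -> P (X i @^-1` A) = mu A) ->
  forall (z : I -> R) (y : R), m2 * \sum_i z i ^+ 2 = 1 -> M <= y ->
  (forall i, y ^+ 2 * `|z i| <= eta0) -> y ^+ 5 * \sum_i `|z i| ^+ 3 <= eta0 ->
  `|fine (P [set w | y <= `|\sum_i z i * X i w|]) - 2 * tail y| <= e * tail y].
Proof.
move=> e0; have C0 := md_const_ge0; set C := md_const mu u0 in C0.
pose l := Num.max 8 (4 * C / e).
pose eta := Num.min 1 (Num.min u0 (e / (4 * C + 1))).
have l8 : 8 <= l by rewrite le_max lexx.
have lC : 4 * C / e <= l by rewrite le_max lexx orbT.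
have l0 : 0 < l by exact: lt_le_trans l8.
have C1 : 0 < 4 * C + 1 by lra.
have eta0 : 0 < eta by rewrite !lt_min ltr01 u0gt0 divr_gt0.
have eta1 : eta <= 1 by rewrite ge_min lexx.
have etau : eta <= u0 by rewrite !ge_min lexx orbT.
have etae : eta <= e / (4 * C + 1) by rewrite !ge_min lexx !orbT.
have small : C * (l^-1 + eta) <= e / 2.
  have h1 : C / l <= e / 4.
    rewrite ler_pdivrMr//; move: lC; rewrite ler_pdivrMr//; lra.
  have h2 : C * eta <= e / 4.
    apply: (@le_trans _ _ (C * (e / (4 * C + 1)))); first exact: ler_wpM2l.
    rewrite mulrA ler_pdivrMr//; lra.
  by rewrite mulrDr; lra.
have l6 : 1 <= l ^+ 6 by apply: exprn_ege1; lra.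
exists (l ^+ 6), eta; split => //.
move=> d Omega P I X mX indX lawX z y z1 My z2 z3.
have y0 : 0 < y by apply: lt_le_trans My; exact: exprn_gt0.
(* Inverts the parametrisation y = L^6 of [moderate_deviation]. *)
pose L := y `^ 6^-1.
have Ly : L ^+ 6 = y.
  by rewrite -powR_mulrn ?powR_ge0// -powRrM mulVf// powRr1// ltW.
have lL : l <= L.
  rewrite -(ler_pXn2r (ltn0Sn 5)) ?nnegrE ?powR_ge0 ?(ltW l0)//.
  by rewrite Ly.
have L8 : 8 <= L by exact: le_trans lL.
have err : C * (L^-1 + eta) <= e / 2.
  apply: le_trans small; apply: ler_wpM2l => //; rewrite lerD2r.
  by rewrite lef_pV2// posrE// (lt_le_trans l0).
have t0 := tail_gt0 y y0.
have md (z' : I -> R) : m2 * \sum_i z' i ^+ 2 = 1 -> (forall i, `|z' i| = `|z i|) ->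
    `|fine (P [set w | y <= \sum_i z' i * X i w]) - tail y| <= e / 2 * tail y.
  move=> z'1 zz.
  have a1 i : L ^+ 6 ^+ 2 * `|z' i| <= eta by rewrite Ly zz.
  have a2 : L ^+ 6 ^+ 5 * \sum_i `|z' i| ^+ 3 <= eta.
    by rewrite Ly; under eq_bigr do rewrite zz.
  have := moderate_deviation P X mu mX indX lawX u0 u0gt0 int2 mean0 z' z'1 L eta L8
    (ltW eta0) eta1 etau a1 a2.
  by rewrite Ly => h; apply: le_trans h _; rewrite ler_pM2r.
have zN1 : m2 * \sum_i (- z i) ^+ 2 = 1 by under eq_bigr do rewrite sqrrN.
have p1 := md z z1 (fun=> erefl).
have p2 := md (fun i => - z i) zN1 (fun i => normrN _).
have mS (z' : I -> R) : measurable [set w | y <= \sum_i z' i * X i w].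
  by apply: measurable_set_ge; exact: measurable_linear.
have U : P [set w | y <= `|\sum_i z i * X i w|] =
    (P [set w | (y <= \sum_i z i * X i w)%R] + P [set w | (y <= \sum_i - z i * X i w)%R])%E.
  rewrite -measureU//.
    congr (P _); apply/seteqP; split => w /=.
      under [X in _ \/ (y <= X)]eq_bigr do rewrite mulNr.
      by rewrite sumrN ler_normr => /orP[|]; [left|right].
    under [X in _ \/ (y <= X)]eq_bigr do rewrite mulNr.
    by rewrite sumrN ler_normr => -[->|->]//; rewrite orbT.
  apply/seteqP; split => w //= -[].
  under [X in _ -> (y <= X) -> _]eq_bigr do rewrite mulNr.
  by rewrite sumrN => h1 h2; move: y0 h1 h2; lra.
rewrite U fineD ?fin_num_measure//.
rewrite (_ : _ - _ = (fine (P [set w | y <= \sum_i z i * X i w]) - tail y) +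
  (fine (P [set w | y <= \sum_i - z i * X i w]) - tail y)); last by ring.
apply: le_trans (ler_normD _ _) _; move: p1 p2; lra.
Qed.

End TwoSided.

Section CorrEvent.
Context {R : realType}.

Lemma fine_pr_cover {d} {Omega : measurableType d} (P : probability Omega R)
    (E Z B : set Omega) (b : R) :
  measurable E -> measurable Z -> measurable B -> E `<=` Z `|` B ->
  (P B <= b%:E)%E -> fine (P E) <= fine (P Z) + b.
Proof.
move=> mE mZ mB EZB PB.
have PE : (P E <= P Z + b%:E)%E.
  apply: (@le_trans _ _ (P (Z `|` B))).
    by apply: le_measure; rewrite ?inE//; exact: measurableU.
  by apply: le_trans (measureU2 _ mZ mB) _; exact: leeD2l.
have fZ : P Z = (fine (P Z))%:E by rewrite fineK// fin_num_measure.
by move: PE; rewrite fZ -EFinD -lee_fin fineK// fin_num_measure.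
Qed.

Lemma measurable_dotc {d} {U : measurableType d} {n} (F G : U -> 'cV[R]_n) :
  (forall t, measurable_fun setT (fun u => F u t ord0)) ->
  (forall t, measurable_fun setT (fun u => G u t ord0)) ->
  measurable_fun setT (fun u => dotc (F u) (G u)).
Proof. by move=> mF mG; apply: measurable_sum => t; exact: measurable_funM. Qed.

Lemma measurable_mulmx {d} {U : measurableType d} {n} (A : 'M[R]_n) (F : U -> 'cV[R]_n) :
  (forall t, measurable_fun setT (fun u => F u t ord0)) ->
  forall t, measurable_fun setT (fun u => (A *m F u) t ord0).
Proof.
move=> mF t; rewrite (_ : (fun u => _) = (fun u => \sum_j A t j * F u j ord0)).
  by apply: measurable_sum => j; exact: measurable_funM.
by apply/funext => u; rewrite mxE.
Qed.

(** A vanishing residual vector makes the quotient 0 by the convention for inverses, and then the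
    event fails because c >= 0. The event thus becomes two polynomial inequalities, which makes it
    measurable. *)
Lemma residual_corr_ltE {n p} (x1 x2 : 'M[R]_(n, p)) (e1 e2 : 'cV[R]_n) (c k : R) :
  x1^T *m x1 \in unitmx -> x2^T *m x2 \in unitmx -> 0 <= c ->
  let a := dotc (residual_maker x2 *m (residual_maker x1 *m e1)) e2 in
  let N := nrm2 (residual_maker x1 *m e1) * nrm2 (residual_maker x2 *m e2) in
  (c < k * residual_corr x1 x2 e1 e2 ^+ 2) = (0 < N) && (c * N < k * a ^+ 2).
Proof.
move=> ux1 ux2 c0 a N.
have N0 : 0 <= N by rewrite mulr_ge0 ?nrm2_ge0.
have -> : residual_corr x1 x2 e1 e2 ^+ 2 = a ^+ 2 / N.
  by rewrite residual_corrE// expr_div_n exprMn !sqr_sqrtr ?nrm2_ge0.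
have [Np|] := ltrP 0 N; first by rewrite mulrA ltr_pdivlMr.
by move=> Nn; rewrite (le_anti (introT andP (conj Nn N0))) invr0 !mulr0 ltNge c0.
Qed.

Lemma measurable_corr_event {d} {U : measurableType d} {n p} (x1 x2 : 'M[R]_(n, p))
    (F G : U -> 'cV[R]_n) (c k : R) :
  x1^T *m x1 \in unitmx -> x2^T *m x2 \in unitmx -> 0 <= c ->
  (forall t, measurable_fun setT (fun u => F u t ord0)) ->
  (forall t, measurable_fun setT (fun u => G u t ord0)) ->
  measurable [set u | c < k * residual_corr x1 x2 (F u) (G u) ^+ 2].
Proof.
move=> ux1 ux2 c0 mF mG.
have mn (A : 'M[R]_n) (H : U -> 'cV[R]_n) : (forall t, measurable_fun setT (fun u => H u t ord0)) ->
    measurable_fun setT (fun u => nrm2 (A *m H u)).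
  move=> mH; apply: measurable_sum => t; apply: measurable_funX; exact: measurable_mulmx.
pose N u := nrm2 (residual_maker x1 *m F u) * nrm2 (residual_maker x2 *m G u).
pose a u := dotc (residual_maker x2 *m (residual_maker x1 *m F u)) (G u).
have mN : measurable_fun setT N by apply: measurable_funM; exact: mn.
have ma : measurable_fun setT a.
  by apply: measurable_dotc => //; do 2 apply: measurable_mulmx.
rewrite (_ : [set u | _] = [set u | 0 < N u] `&` [set u | 0 < k * a u ^+ 2 - c * N u]).
  have pos (f : U -> R) : measurable_fun setT f -> measurable [set u | 0 < f u].
    move=> mf; have := mf measurableT `]0, +oo[%classic (measurable_itv _).
    by rewrite setTI; congr measurable; apply/seteqP; split => w /=; rewrite in_itv/= andbT.
  apply: measurableI; apply: pos => //.
  apply: measurable_funB; last exact: measurable_funM.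
  by apply: measurable_funM => //; exact: measurable_funX.
apply/seteqP; split => u /=; rewrite residual_corr_ltE//= -/(N u) -/(a u) subr_gt0.
  by move=> /andP.
by move=> [-> ->].
Qed.

End CorrEvent.

Section CorrTail.
Context {R : realType} (mu : probability R R) (u0 : R) (p : nat).
Hypotheses (u0gt0 : 0 < u0)
  (int2 : mu.-integrable setT (fun x : R => (expR (2 * u0 * `|x|))%:E))
  (mean0 : \int[mu]_x x = 0).
Local Notation m2 := (moment2 mu).
Hypothesis m2_gt0 : 0 < m2.
Local Notation C3 := (abs_moment mu 3 + 1).

(** Compounds two relative errors, e' from the deviation estimate and 6 c = e'/2 from the shift of
    the level: (2 + e') (1 + e'/2) <= 2 + e once e' <= 1 and e' <= e/4. *)
Let sandwich (e e' c t tl th El Eh E b : R) : 0 < t -> 0 < e' -> e' <= 1 -> e' <= e / 4 ->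
  c = e' / 12 -> tl <= (1 + 6 * c) * t -> (1 - 6 * c) * t <= th ->
  `|El - 2 * tl| <= e' * tl -> `|Eh - 2 * th| <= e' * th ->
  E <= El + b -> Eh <= E + b -> `|E - 2 * t| <= e * t + b.
Proof.
move=> t0 e'0 e'1 e'e cE sh1 sh2; rewrite !ler_norml => /andP[_ dev1] /andP[dev2 _] up lo.
have ec : e' * c <= c by rewrite ler_piMl// cE divr_ge0// ltW.
have ec0 : 0 <= e' * c by rewrite mulr_ge0// ?cE ?divr_ge0// ltW.
have h1 : (2 + e') * tl <= (2 + e) * t.
  apply: (@le_trans _ _ ((2 + e') * ((1 + 6 * c) * t))).
    by rewrite ler_wpM2l//; lra.
  rewrite mulrA ler_pM2r//; lra.
have h2 : (2 - e) * t <= (2 - e') * th.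
  apply: (@le_trans _ _ ((2 - e') * ((1 - 6 * c) * t))); last first.
    by rewrite ler_wpM2l//; lra.
  by rewrite mulrA ler_pM2r//; lra.
by apply/andP; split; lra.
Qed.

Let shift_range (delta : R) : 0 <= delta -> delta <= 4^-1 ->
  [/\ 1 / 2 <= 1 - delta, 1 - delta <= 2, 1 / 2 <= 1 + 2 * delta & 1 + 2 * delta <= 2].
Proof. by move=> d0 d4; split; lra. Qed.

(** The conditional estimate: [e1] is frozen and only the second vector is random. The condition
    [A * y <= s] is the quantitative form of y = o(s), and [A] depends only on the law, on p and on
    [e]. *)
Lemma corr_tail_given (e : R) : 0 < e -> exists A : R, 1 <= A /\
  forall (d : measure_display) (Omega : measurableType d) (P : probability Omega R)
    (n : nat) (X : 'I_n -> Omega -> R),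
  (forall i, measurable_fun setT (X i)) -> mutually_independent P X ->
  (forall i A, measurable A -> P (X i @^-1` A) = mu A) ->
  forall (x1 x2 : 'M[R]_(n, p)) (s y : R) (e1 : 'cV[R]_n),
  x1^T *m x1 \in unitmx -> x2^T *m x2 \in unitmx ->
  n%:R = s ^+ 10 -> A <= y -> A * y <= s -> good x1 x2 s m2 C3 e1 ->
  `|fine (P [set w | y ^+ 2 < s ^+ 10 * residual_corr x1 x2 e1 (\col_t X t w) ^+ 2])
     - 2 * tail y| <= e * tail y + bad_bound mu u0 s.
Proof.
move=> e0.
have C30 : 0 <= C3 by rewrite addr_ge0// abs_moment_ge0.
have [M [eta [M1 eta0 dev]]] := two_sided_deviation mu u0 u0gt0 int2 mean0 (Num.min 1 (e / 4))
  (ltac:(by rewrite lt_min ltr01 divr_gt0)).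
set e' := Num.min 1 (e / 4) in dev.
have e'1 : e' <= 1 by rewrite ge_min lexx.
have e'e : e' <= e / 4 by rewrite ge_min lexx orbT.
have e'0 : 0 < e' by rewrite lt_min ltr01 divr_gt0.
pose c := e' / 12.
have c0 : 0 < c by rewrite divr_gt0.
have c4 : c <= 4^-1 by rewrite /c; lra.
set D := corr_slack m2.
have D0 : 0 < D by rewrite /D /corr_slack addr_gt0// divr_gt0.
(* The constants of [weight_max] and [weight_cube], multiplied by 2^2 and 2^5 because the shifted
   levels reach up to 2 y. *)
pose K2 := 24 / m2; pose K5 := 2 ^+ 5 * (72 * (C3 + 2) / m2 ^+ 3).
have K20 : 0 <= K2 by rewrite divr_ge0// ltW.
have K50 : 0 <= K5.
  apply: mulr_ge0; first exact: exprn_ge0.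
  apply: divr_ge0; last by rewrite exprn_ge0// ltW.
  by apply: mulr_ge0 => //; rewrite addr_ge0.
(* One summand per requirement: shifted levels, at least y/2, stay above [M]; [sbig] holds; y^2
   delta <= c; and the two smallness conditions on the weights. *)
pose A := 1 + 2 * M + 4 * D * (p%:R + 1) + D / c + K2 / eta + K5 / eta.
have p0 : 0 <= p%:R :> R by exact: ler0n.
have a1 : 0 <= 4 * D * (p%:R + 1).
  by apply: mulr_ge0; [apply: mulr_ge0 => //; exact: ltW|exact: addr_ge0].
have a2 : 0 <= D / c by rewrite divr_ge0// ltW.
have a3 : 0 <= K2 / eta by rewrite divr_ge0// ltW.
have a4 : 0 <= K5 / eta by rewrite divr_ge0// ltW.
have A1 : 1 <= A by rewrite /A; lra.
have AM : 2 * M <= A by rewrite /A; lra.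
have Ap : 4 * D * (p%:R + 1) <= A by rewrite /A; lra.
have AD : D <= c * A by rewrite mulrC -ler_pdivrMr// /A; lra.
have A2 : K2 <= eta * A by rewrite mulrC -ler_pdivrMr// /A; lra.
have A5 : K5 <= eta * A by rewrite mulrC -ler_pdivrMr// /A; lra.
exists A; split => //.
move=> d Omega P n X mX indX lawX x1 x2 s y e1 ux1 ux2 ns Ay Ays ge1.
have A0 : 0 < A by exact: lt_le_trans A1.
have y0 : 0 < y by exact: lt_le_trans Ay.
have y1 : 1 <= y by exact: le_trans Ay.
have ys : y <= s by apply: le_trans Ays; rewrite ler_peMl// ltW.
have s1 : 1 <= s by exact: le_trans ys.
have s0 : 0 < s by exact: lt_le_trans s1.
have As : A <= s by exact: le_trans ys.
have sA3 : A <= s ^+ 3.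
  by apply: le_trans As _; rewrite -[leLHS]expr1 ler_weXn2l.
have sbig : 4 * corr_slack m2 * (p%:R + 1) <= s ^+ 3 by exact: le_trans sA3.
pose delta := D / s ^+ 3.
have s30 : 0 < s ^+ 3 by exact: exprn_gt0.
have d0 : 0 <= delta by rewrite divr_ge0// ltW.
have dc : delta <= c.
  rewrite ler_pdivrMr//; apply: le_trans AD _; rewrite ler_wpM2l// ltW//.
have ydc : y ^+ 2 * delta <= c.
  rewrite mulrA ler_pdivrMr//.
  have h : A * y ^+ 2 <= s ^+ 3.
    rewrite (exprS s) (_ : A * y ^+ 2 = A * y * y); last by rewrite expr2 mulrA.
    rewrite expr2; apply: ler_pM; rewrite ?mulr_ge0 ?(ltW A0) ?(ltW y0)//.
    by apply: le_trans ys _; rewrite ler_peMl// ltW.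
  apply: (@le_trans _ _ (y ^+ 2 * (c * A))); first by rewrite ler_wpM2l ?sqr_ge0.
  by rewrite (_ : y ^+ 2 * (c * A) = c * (A * y ^+ 2)) ?ler_wpM2l ?(ltW c0)//; ring.
have z1 := weight_unit x1 x2 ux1 ux2 s m2 C3 m2_gt0 s1 sbig e1 ge1.
have z2 := weight_max x1 x2 ux1 ux2 s m2 C3 m2_gt0 s1 sbig e1 ge1.
have z3 := weight_cube x1 x2 ux1 ux2 s m2 C3 m2_gt0 s1 sbig e1 ge1.
pose z := weight x1 x2 m2 e1.
have dev_at (a : R) : 1 / 2 <= a -> a <= 2 ->
    `|fine (P [set w | y * a <= `|\sum_t z t * X t w|]) - 2 * tail (y * a)| <= e' * tail (y * a).
  move=> ah a2'; have a0 : 0 <= a by apply: le_trans ah; rewrite divr_ge0.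
  have ya0 : 0 <= y * a by rewrite mulr_ge0// ltW.
  apply: dev => //.
  - apply: (@le_trans _ _ (y * (1 / 2))); last by rewrite ler_wpM2l// ltW.
    by rewrite mul1r ler_pdivlMr// mulrC (le_trans AM).
  - move=> t; apply: (@le_trans _ _ ((y * 2) ^+ 2 * (6 / m2 / s ^+ 3))).
      apply: ler_pM; rewrite ?sqr_ge0//.
      by rewrite lerXn2r ?nnegrE ?mulr_ge0 ?(ltW y0)// ler_wpM2l// ltW.
    rewrite (_ : (y * 2) ^+ 2 * (6 / m2 / s ^+ 3) = K2 * y ^+ 2 / s ^+ 3); last first.
      by rewrite /K2; field; rewrite !gt_eqF.
    rewrite ler_pdivrMr//.
    apply: (@le_trans _ _ (eta * A * y ^+ 2)); first by rewrite ler_wpM2r ?sqr_ge0.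
    rewrite -mulrA ler_wpM2l ?(ltW eta0)// (exprS s).
    rewrite (_ : A * y ^+ 2 = A * y * y); last by rewrite expr2 mulrA.
    rewrite expr2; apply: ler_pM; rewrite ?mulr_ge0 ?(ltW A0) ?(ltW y0)//.
    by apply: le_trans ys _; rewrite ler_peMl// ltW.
  - apply: (@le_trans _ _ ((y * 2) ^+ 5 * (72 * (C3 + 2) / m2 ^+ 3 / s ^+ 5))).
      apply: ler_pM; rewrite ?exprn_ge0//.
        by apply: sumr_ge0 => t _; exact: exprn_ge0.
      by rewrite lerXn2r ?nnegrE ?mulr_ge0 ?(ltW y0)// ler_wpM2l// ltW.
    rewrite (_ : (y * 2) ^+ 5 * (72 * (C3 + 2) / m2 ^+ 3 / s ^+ 5) = K5 * y ^+ 5 / s ^+ 5); last first.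
      by rewrite /K5 exprMn; field; rewrite !gt_eqF.
    rewrite ler_pdivrMr ?exprn_gt0//.
    apply: (@le_trans _ _ (eta * A * y ^+ 5)); first by rewrite ler_wpM2r// exprn_ge0// ltW.
    rewrite -mulrA ler_wpM2l ?(ltW eta0)// (exprS s).
    rewrite (_ : A * y ^+ 5 = A * y * y ^+ 4); last by rewrite exprS mulrA.
    apply: ler_pM; rewrite ?mulr_ge0 ?exprn_ge0 ?(ltW A0) ?(ltW y0)//.
    by rewrite lerXn2r ?nnegrE ?(ltW y0) ?(ltW s0).
(* The designs are exchanged: for the second vector, the first fitted part is the one on [x2]. *)
have [B [mB PB hB]] := good_event P X mu mX indX lawX u0 u0gt0 int2 mean0 x2 x1 ux2 ux1 s s1 ns.
have mE : measurable [set w | y ^+ 2 < s ^+ 10 * residual_corr x1 x2 e1 (\col_t X t w) ^+ 2].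
  apply: (measurable_corr_event x1 x2 (fun _ : Omega => e1)) => //; first exact: sqr_ge0.
  by move=> t; rewrite (_ : (fun u => _) = X t)//; apply/funext => u; rewrite mxE.
have mZ a : measurable [set w | y * a <= `|\sum_t z t * X t w|].
  by apply: measurable_set_ge; apply: measurableT_comp => //; exact: measurable_linear.
have zE w : \sum_t z t * (\col_t X t w : 'cV[R]_n) t ord0 = \sum_t z t * X t w.
  by apply: eq_bigr => t _; rewrite mxE.
have up := fine_pr_cover P _ _ B (bad_bound mu u0 s) mE (mZ (1 - delta)) mB _ PB.
have lo := fine_pr_cover P _ _ B (bad_bound mu u0 s) (mZ (1 + 2 * delta)) mE mB _ PB.
have {}up := up (ltac:(move=> w /= hw; have [Bw|nB] := pselect (B w); [by right|left];
  have gw := hB w nB; rewrite -zE;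
  exact: (corr_event_sub x1 x2 ux1 ux2 s m2 C3 m2_gt0 s1 sbig e1 ge1 _ y (good_hat1 _ _ _ _ _ _ gw)
    (good_sqr _ _ _ _ _ _ gw) y0 hw))).
have {}lo := lo (ltac:(move=> w /= hw; have [Bw|nB] := pselect (B w); [by right|left];
  have gw := hB w nB; rewrite -zE in hw;
  exact: (corr_event_sup x1 x2 ux1 ux2 s m2 C3 m2_gt0 s1 sbig e1 ge1 _ y (good_hat1 _ _ _ _ _ _ gw)
    (good_sqr _ _ _ _ _ _ gw) y0 hw))).
have d4 : delta <= 4^-1 by exact: le_trans c4.
have [d1 d1' d2 d2'] : [/\ 1 / 2 <= 1 - delta, 1 - delta <= 2,
    1 / 2 <= 1 + 2 * delta & 1 + 2 * delta <= 2].
  exact: shift_range.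
have [sh1 sh2] := tail_shift y delta c y0 d0 dc ydc c4.
exact: sandwich (tail_gt0 y y0) e'0 e'1 e'e erefl sh1 sh2 (dev_at _ d1 d1') (dev_at _ d2 d2') up lo.
Qed.

End CorrTail.

(** * Conditioning on one error vector *)

Section Conditioning.
Context {d d1 d2} {Omega : measurableType d} {E1 : measurableType d1}
  {E2 : measurableType d2} {R : realType} (P : probability Omega R).
Variables (Y : Omega -> E1) (Z : Omega -> E2).
Hypotheses (mY : measurable_fun [set: Omega] Y) (mZ : measurable_fun [set: Omega] Z).

Lemma measurable_section (C : set (E1 * E2)) (u : E1) : measurable C ->
  measurable [set w | C (u, Z w)].
Proof.
move=> mC; have -> : [set w' | C (u, Z w')] = (fun w' => (u, Z w')) @^-1` C by [].
by rewrite -[X in measurable X]setTI; apply: measurable_fun_pair.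
Qed.

Lemma measurable_section_prob (C : set (E1 * E2)) : measurable C ->
  measurable_fun setT (fun w => fine (P [set w' | C (Y w, Z w')])).
Proof.
move=> mC; pose PZ : probability E2 R := distribution P (mfun_Sub (mem_set mZ)).
have mf : measurable_fun setT (fun u => PZ (xsection C u)) by exact: measurable_fun_xsection.
apply/measurable_EFinP.
have e : EFin \o (fun w => fine (P [set w' | C (Y w, Z w')])) =
    (fun u => PZ (xsection C u)) \o Y.
  apply/funext => w /=; rewrite fineK; last by apply: fin_num_measure; exact: measurable_section.
  rewrite /PZ/= /pushforward; congr (P _).
  by apply/seteqP; split => w' /=; rewrite /xsection/=; [move=> h; exact: mem_set|move/set_mem].
by rewrite e; apply: measurableT_comp.
Qed.

Hypothesis ind : forall A B, measurable A -> measurable B ->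
  P (Y @^-1` A `&` Z @^-1` B) = (P (Y @^-1` A) * P (Z @^-1` B))%E.

Lemma pair_prob_Rintegral (C : set (E1 * E2)) : measurable C ->
  fine (P [set w | C (Y w, Z w)]) = \int[P]_w fine (P [set w' | C (Y w, Z w')]).
Proof.
move=> mC; rewrite (indep_pair_prob P Y Z mY mZ ind C mC) /Rintegral; congr fine.
apply: eq_integral => w _; rewrite fineK//; apply: fin_num_measure.
exact: measurable_section.
Qed.

End Conditioning.

Section Averaging.
Context {d} {Omega : measurableType d} {R : realType} (P : probability Omega R).
Variables (f : Omega -> R) (B : set Omega) (b : R).
Hypotheses (mf : measurable_fun setT f) (f01 : forall w, 0 <= f w <= 1)
  (mB : measurable B) (PB : (P B <= b%:E)%E).

Let PB' : fine (P B) <= b.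
Proof. by rewrite -lee_fin fineK// fin_num_measure. Qed.

Let intf : P.-integrable setT (EFin \o f).
Proof.
apply: (integrable_bounded P _ 1) => // w.
by have /andP[h0 h1] := f01 w; rewrite ger0_norm.
Qed.

Let intB (a c : R) : P.-integrable setT (EFin \o (fun w => a + c * \1_B w)) /\
  \int[P]_w (a + c * \1_B w) = a + c * fine (P B).
Proof.
have i1 : P.-integrable setT (EFin \o (fun _ : Omega => a)).
  exact: finite_measure_integrable_cst.
have i2 := integrable_indicator P B mB.
have i3 : P.-integrable setT (EFin \o (fun w => c * \1_B w)).
  rewrite (_ : EFin \o _ = (fun w => c%:E * (\1_B w)%:E)%E)//.
  exact: integrableZl.
split.
  rewrite (_ : EFin \o _ = ((EFin \o (fun=> a)) \+ (EFin \o (fun w => (c * \1_B w)%R)))%E)//.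
  exact: integrableD.
by rewrite RintegralD// RintegralZl// Rintegral_indic// Rintegral_cst1.
Qed.

(** Averages a pointwise bound that holds off an event of probability at most [b]; on that event
    only f <= 1 is used. *)
Lemma mean_le_off (a : R) : 0 <= a -> (forall w, ~ B w -> f w <= a) ->
  \int[P]_w f w <= a + b.
Proof.
move=> a0 fa; have [i e] := intB a 1.
apply: (@le_trans _ _ (\int[P]_w (a + 1 * \1_B w))); last first.
  by rewrite e mul1r lerD2l.
apply: le_Rintegral => // w _; rewrite indicE mul1r.
have [wB|] := boolP (w \in B).
  by have /andP[_ h] := f01 w; rewrite (le_trans h)// lerDr.
by rewrite notin_setE addr0 => /fa.
Qed.

Lemma mean_ge_off (a c : R) : 0 <= c -> a <= c -> (forall w, ~ B w -> a <= f w) ->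
  a - c * b <= \int[P]_w f w.
Proof.
move=> c0 ac fa; have [i e] := intB a (- c).
apply: (@le_trans _ _ (\int[P]_w (a + - c * \1_B w))).
  by rewrite e mulNr lerD2l lerN2 ler_wpM2l.
apply: le_Rintegral => // w _; rewrite indicE mulNr.
have [wB|] := boolP (w \in B).
  by have /andP[h _] := f01 w; rewrite mulr1 (le_trans _ h)// subr_le0.
by rewrite notin_setE mulr0 subr0 => /fa.
Qed.

End Averaging.

(** * Exceedances for pairs and triples of error vectors *)

Section Sample.
Context {d} {Omega : measurableType d} {R : realType} (P : probability Omega R)
  {N n p : nat} (eps : 'I_N -> Omega -> n.-tuple R) (x : 'I_N -> 'M[R]_(n, p))
  (mu : probability R R) (u0 : R).
Hypotheses (mE : forall i, measurable_fun [set: Omega] (eps i))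
  (indE : mutually_independent P eps)
  (indT : forall i, mutually_independent P (fun (t : 'I_n) w => tnth (eps i w) t))
  (lawT : forall i t A, measurable A -> P ((fun w => tnth (eps i w) t) @^-1` A) = mu A)
  (ux : forall i, (x i)^T *m x i \in unitmx)
  (u0gt0 : 0 < u0)
  (int2 : mu.-integrable setT (fun x : R => (expR (2 * u0 * `|x|))%:E))
  (mean0 : \int[mu]_x x = 0).
Variables (s y e : R).
Hypotheses (s1 : 1 <= s) (ns : n%:R = s ^+ 10) (y1 : 1 <= y) (e0 : 0 <= e) (e1 : e <= 1).
Local Notation m2 := (moment2 mu).
Local Notation C3 := (abs_moment mu 3 + 1).
Local Notation bad := (bad_bound mu u0 s).

Definition corr_exceed (i j : 'I_N) (u v : n.-tuple R) : Prop :=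
  y ^+ 2 < s ^+ 10 * residual_corr (x i) (x j) (col_of_tuple u) (col_of_tuple v) ^+ 2.

Hypothesis tail_given : forall i j v, good (x i) (x j) s m2 C3 v ->
  `|fine (P [set w | y ^+ 2 < s ^+ 10 *
       residual_corr (x i) (x j) v (col_of_tuple (eps j w)) ^+ 2]) - 2 * tail y|
    <= e * tail y + bad.

Lemma measurable_corr_exceed {d'} {U : measurableType d'} i j (f g : U -> n.-tuple R) :
  measurable_fun setT f -> measurable_fun setT g ->
  measurable [set z | corr_exceed i j (f z) (g z)].
Proof.
move=> mf mg.
apply: (measurable_corr_event (x i) (x j) (fun z => col_of_tuple (f z))
  (fun z => col_of_tuple (g z))) => //; first exact: sqr_ge0.
- move=> t; rewrite (_ : (fun u => _) = (@tnth n R)^~ t \o f).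
    by apply: measurableT_comp => //; exact: measurable_tnth.
  by apply/funext => u; rewrite mxE.
- move=> t; rewrite (_ : (fun u => _) = (@tnth n R)^~ t \o g).
    by apply: measurableT_comp => //; exact: measurable_tnth.
  by apply/funext => u; rewrite mxE.
Qed.

Let mX i t : measurable_fun setT (fun w => tnth (eps i w) t).
Proof. exact: (measurableT_comp (measurable_tnth t) (mE i)). Qed.

Let bad_event i j : exists B : set Omega, [/\ measurable B, (P B <= bad%:E)%E &
  forall w, ~ B w -> good (x i) (x j) s m2 C3 (col_of_tuple (eps i w))].
Proof.
exact: (good_event P _ mu (mX i) (indT i) (lawT i) u0 u0gt0 int2 mean0 (x i) (x j)
  (ux i) (ux j) s s1 ns).
Qed.

Let bad0 : 0 <= bad.
Proof.
have s0 : 0 <= s by exact: le_trans s1.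
have l0 : 0 <= linear_const mu u0 by exact: expR_ge0.
by rewrite /bad_bound !addr_ge0 ?mulr_ge0 ?expR_ge0 ?exprn_ge0.
Qed.

Let y0 : 0 < y. Proof. exact: lt_le_trans y1. Qed.

Let tail_le1 : tail y <= 1.
Proof. by rewrite /tail ler_pdivrMr// mul1r; apply: le_trans y1; exact: phi_le1. Qed.

Let fine_pr01 (A : set Omega) : measurable A -> 0 <= fine (P A) <= 1.
Proof.
move=> mA; rewrite fine_ge0//= -lee_fin fineK ?fin_num_measure//; exact: probability_le1.
Qed.

(** Averages [tail_given] over [eps i]. One term [bad] is already in the conditional estimate; the
    excluded values of [eps i] cost at most two more. *)
Lemma corr_pair_tail i j : i != j ->
  `|fine (P [set w | corr_exceed i j (eps i w) (eps j w)]) - 2 * tail y|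
    <= e * tail y + 4 * bad.
Proof.
move=> ij; have [B [mB PB gB]] := bad_event i j.
pose C := [set z : n.-tuple R * n.-tuple R | corr_exceed i j z.1 z.2].
have mC : measurable C by exact: measurable_corr_exceed.
have ind := indep_blocks_fun P eps mE indE (pred1 i) (pred1 j) (eps i) (eps j)
  (fun k ki => ltac:(by rewrite /= (eqP ki)))
  (measurable_block_X eps (pred1 i) i (eqxx i)) (measurable_block_X eps (pred1 j) j (eqxx j)).
rewrite (pair_prob_Rintegral P (eps i) (eps j) (mE i) (mE j) ind C mC).
have mf := measurable_section_prob P (eps i) (eps j) (mE i) (mE j) C mC.
set f := (fun w => _) in mf.
have f01 w : 0 <= f w <= 1 by apply: fine_pr01; exact: measurable_section.
have fg w : ~ B w -> `|f w - 2 * tail y| <= e * tail y + bad.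
  by move=> nB; exact: tail_given (gB w nB).
have t0 := tail_gt0 y y0; have t1 := tail_le1.
have et0 : 0 <= e * tail y by rewrite mulr_ge0// ltW.
have up := mean_le_off P f B bad mf f01 mB PB (2 * tail y + (e * tail y + bad)).
(* The 2 bounds the conditional lower bound from above, since [tail y] <= 1; it is what the bad
   event can cost per unit of probability. *)
have lo := mean_ge_off P f B bad mf f01 mB PB (2 * tail y - (e * tail y + bad)) 2.
rewrite -/(Rintegral _ _ f) ler_norml; apply/andP; split.
  have := lo _ _ _; rewrite ler0n => /(_ isT); have h : 2 * tail y - (e * tail y + bad) <= 2.
    by move: t0 t1 et0 bad0; lra.
  move=> /(_ h) h2; have : forall w, ~ B w -> 2 * tail y - (e * tail y + bad) <= f w.
    by move=> w /fg; rewrite ler_norml => /andP[h3 _]; move: h3; lra.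
  by move=> /h2; move: bad0; lra.
have h : 0 <= 2 * tail y + (e * tail y + bad) by move: t0 et0 bad0; lra.
have h2 w : ~ B w -> f w <= 2 * tail y + (e * tail y + bad).
  by move=> /fg; rewrite ler_norml => /andP[_ h3]; move: h3; lra.
by have := up h h2; move: bad0; lra.
Qed.

(** For fixed [eps i] the two events depend on [eps j] and on [eps k] separately, so their
    probabilities multiply. The value of [eps i] must be good with respect to both partners, whence
    [2 * bad]. *)
Lemma corr_triple_tail i j k : i != j -> i != k -> j != k ->
  fine (P ([set w | corr_exceed i j (eps i w) (eps j w)] `&`
           [set w | corr_exceed i k (eps i w) (eps k w)]))
    <= (3 * tail y + bad) ^+ 2 + 2 * bad.
Proof.
move=> ij ik jk.
have [B1 [mB1 PB1 gB1]] := bad_event i j; have [B2 [mB2 PB2 gB2]] := bad_event i k.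
have PB := pr_union2 P _ _ _ _ mB1 mB2 PB1 PB2.
have mB := measurableU _ _ mB1 mB2.
pose Z w := (eps j w, eps k w).
have mZ : measurable_fun setT Z by exact: measurable_fun_pair.
pose C := [set z : n.-tuple R * (n.-tuple R * n.-tuple R) |
  corr_exceed i j z.1 z.2.1 /\ corr_exceed i k z.1 z.2.2].
have mC : measurable C.
  apply: (measurableI [set z | corr_exceed i j z.1 z.2.1] [set z | corr_exceed i k z.1 z.2.2]).
    by apply: measurable_corr_exceed => //; exact: measurableT_comp measurable_fst measurable_snd.
  by apply: measurable_corr_exceed => //; exact: measurableT_comp measurable_snd measurable_snd.
have sj : pred2 j k j by rewrite /= eqxx.
have sk : pred2 j k k by rewrite /= eqxx orbT.
have mZb : measurable_fun [set: block eps (pred2 j k)] (Z : block eps (pred2 j k) -> _).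
  exact: measurable_fun_pair (measurable_block_X eps _ j sj) (measurable_block_X eps _ k sk).
have ind := indep_blocks_fun P eps mE indE (pred1 i) (pred2 j k) (eps i) Z
  (fun l li => ltac:(by rewrite /= (eqP li) negb_or ij ik))
  (measurable_block_X eps (pred1 i) i (eqxx i)) mZb.
have ind2 := indep_blocks_fun P eps mE indE (pred1 j) (pred1 k) (eps j) (eps k)
  (fun l lj => ltac:(by rewrite /= (eqP lj)))
  (measurable_block_X eps (pred1 j) j (eqxx j)) (measurable_block_X eps (pred1 k) k (eqxx k)).
rewrite -[X in fine (P X)]/[set w | C (eps i w, Z w)].
rewrite (pair_prob_Rintegral P (eps i) Z (mE i) mZ ind C mC).
have mf := measurable_section_prob P (eps i) Z (mE i) mZ C mC.
set f := (fun w => _) in mf.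
have f01 w : 0 <= f w <= 1 by apply: fine_pr01; exact: measurable_section.
have t0 := tail_gt0 y y0.
have q0 : 0 <= 3 * tail y + bad by rewrite addr_ge0// mulr_ge0// ltW.
have et : e * tail y <= tail y by rewrite ler_piMl// ltW.
have fg w : ~ (B1 `|` B2) w -> f w <= (3 * tail y + bad) ^+ 2.
  move=> nB; have n1 : ~ B1 w by move=> h; apply: nB; left.
  have n2 : ~ B2 w by move=> h; apply: nB; right.
  have mj : measurable [set v | corr_exceed i j (eps i w) v] by exact: measurable_corr_exceed.
  have mk : measurable [set v | corr_exceed i k (eps i w) v] by exact: measurable_corr_exceed.
  have := tail_given i j _ (gB1 w n1); have := tail_given i k _ (gB2 w n2).
  rewrite !ler_norml => /andP[_ hk] /andP[_ hj].
  rewrite /f; have := ind2 _ _ mj mk => /(congr1 fine) E.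
  rewrite -[X in fine (P X)]/((eps j @^-1` [set v | corr_exceed i j (eps i w) v]) `&`
    (eps k @^-1` [set v | corr_exceed i k (eps i w) v])) E.
  rewrite fineM ?fin_num_measure//; last 2 first.
  - by rewrite -[X in measurable X]setTI; exact: mE.
  - by rewrite -[X in measurable X]setTI; exact: mE.
  rewrite expr2; apply: ler_pM.
  - by apply: fine_ge0.
  - by apply: fine_ge0.
  - by move: hj et; rewrite /corr_exceed/=; lra.
  - by move: hk et; rewrite /corr_exceed/=; lra.
have := mean_le_off P f _ _ mf f01 mB PB _ (sqr_ge0 _) fg.
by rewrite [2 * bad]mulr_natl mulr2n.
Qed.

End Sample.

(** * Poisson approximation *)

Section IndepExpectation.
Context {d} {Omega : measurableType d} {R : realType} (P : probability Omega R).

Lemma indep_Rintegral_mul (Y Z : Omega -> R) :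
  measurable_fun setT Y -> measurable_fun setT Z ->
  (forall A B, measurable A -> measurable B ->
    P (Y @^-1` A `&` Z @^-1` B) = (P (Y @^-1` A) * P (Z @^-1` B))%E) ->
  (forall w, 0 <= Y w <= 1) -> (forall w, 0 <= Z w <= 1) ->
  \int[P]_w (Y w * Z w) = (\int[P]_w Y w) * (\int[P]_w Z w).
Proof.
move=> mY mZ ind Y01 Z01.
(* Absolute values extend the product to a nonnegative function on the plane; Y and Z are themselves
   nonnegative. *)
have h0 (x : R * R) : (0 <= (`|x.1| * `|x.2|)%:E)%E by rewrite lee_fin mulr_ge0.
have mh : measurable_fun [set: R * R] (fun x : R * R => (`|x.1| * `|x.2|)%:E).
  by apply/measurable_EFinP; apply: measurable_funM; apply: measurableT_comp.
have nY w : `|Y w| = Y w by have /andP[a _] := Y01 w; rewrite ger0_norm.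
have nZ w : `|Z w| = Z w by have /andP[a _] := Z01 w; rewrite ger0_norm.
have bd (f : Omega -> R) : measurable_fun setT f -> (forall w, 0 <= f w <= 1) ->
    P.-integrable setT (EFin \o f).
  move=> mf f01; apply: (integrable_bounded P _ 1) => // w.
  by have /andP[a b] := f01 w; rewrite ger0_norm.
have iZ := bd Z mZ Z01.
have := indep_pair_integral P Y Z mY mZ ind (fun x => (`|x.1| * `|x.2|)%:E) mh h0.
rewrite /Rintegral/= => E.
transitivity (fine (\int[P]_w (`|Y w| * `|Z w|)%:E)%E).
  by congr fine; apply: eq_integral => w _; rewrite nY nZ.
rewrite E -[LHS]/(fine (\int[P]_w _)%E).
rewrite (eq_integral (fun w => ((\int[P]_w' Z w') * Y w)%:E)); last first.
  move=> w _; transitivity (\int[P]_w' ((Y w)%:E * (Z w')%:E))%E.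
    by apply: eq_integral => w' _; rewrite nY nZ.
  rewrite integralZl// EFinM EFin_Rintegral// muleC//.
rewrite -[LHS]/(\int[P]_w ((\int[P]_w' Z w') * Y w)).
by rewrite RintegralZl ?bd// mulrC.
Qed.

End IndepExpectation.

Section ChenSteinBlocks.
Context {d d'} {Omega : measurableType d} {E : measurableType d'} {R : realType}
  (P : probability Omega R) {J I : finType} (X : J -> Omega -> E).
Hypotheses (mX : forall j, measurable_fun [set: Omega] (X j))
  (indX : mutually_independent P X).
Variables (A : I -> set Omega) (S : I -> pred J) (B : I -> pred I).
(** Measurability is asked for every larger index set, so that a count of many events is measurable
    for one common block. *)
Hypothesis mA : forall i (S' : pred J), (forall v, S i v -> S' v) ->
  @measurable _ (block X S') (A i).
Hypotheses (Bii : forall i, B i i)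
  (BS : forall i j, ~~ B i j -> forall v, S j v -> ~~ S i v).

Lemma measurable_pow_count {d0} {U : measurableType d0} (D : I -> set U) (s : R) (Q : pred I) :
  (forall i, Q i -> measurable (D i)) ->
  measurable_fun setT (fun w => s ^+ (\sum_(j | Q j) (w \in D j))%N).
Proof.
move=> mD.
rewrite (_ : (fun w => _) = (fun w => \prod_(j <- [seq j <- index_enum I | Q j])
  (1 - (1 - s) * \1_(D j) w))).
  rewrite (_ : (fun w => _) = (fun w => \prod_(j <- [seq j <- index_enum I | Q j])
     (1 - (1 - s) * \1_(if Q j then D j else set0) w))).
    apply: measurable_prod => j _.
    apply: measurable_funB => //; apply: measurable_funM => //; apply: measurable_indic.
    by case: ifP => // /mD.
  by apply/funext => w; rewrite !big_filter; apply: eq_bigr => j ->.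
apply/funext => w; rewrite -prodrXr big_filter; apply: eq_bigr => j _.
by rewrite indicE; case: (w \in D j); rewrite ?mulr1 ?mulr0 ?subr0 ?expr0// opprB addrC subrK expr1.
Qed.

(** The count outside [B i] depends only on variables outside [S i], hence is independent of
    [A i]. *)
Lemma chen_stein_blocks :
  `|fine (P [set w | forall i, ~ A i w]) - expR (- \sum_i fine (P (A i)))| <=
  chen_stein_b1 P A B + chen_stein_b2 P A B.
Proof.
have mA0 i : measurable (A i).
  by apply: (block_measurable X mX (S i)); exact: mA.
apply: chen_stein => // i s s01.
have /andP[s0 s1] := s01.
have mY : measurable_fun [set: block X (S i)] (fun w => \1_(A i) w : R).
  by apply: measurable_indic; exact: mA.
have mZ : measurable_fun [set: block X (fun v => ~~ S i v)]
    (fun w => s ^+ (\sum_(j | ~~ B i j) (w \in A j))%N).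
  apply: (@measurable_pow_count _ (block X (fun v => ~~ S i v)) A) => j Bij.
  by apply: mA; exact: BS.
have ind := indep_blocks_fun P X mX indX (S i) (fun v => ~~ S i v) _ _ _ mY mZ.
rewrite -[X in X * _](_ : \int[P]_w \1_(A i) w = _); last by rewrite Rintegral_indic.
rewrite -indep_Rintegral_mul//.
- exact: (measurable_fun_block X mX _ _ mZ).
- by apply: ind => v; rewrite negbK.
- by move=> w; rewrite indicE; case: (_ \in _); rewrite ?lexx ?ler01.
- by move=> w; rewrite exprn_ge0//= exprn_ile1.
Qed.

End ChenSteinBlocks.

Section PairCounting.
Context {R : realType} {N : nat}.
Implicit Types a b : 'I_N * 'I_N.

Definition share_vertex a : pred ('I_N * 'I_N) := fun b =>
  [|| b.1 == a.1, b.1 == a.2, b.2 == a.1 | b.2 == a.2].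

Lemma share_vertex_refl a : share_vertex a a.
Proof. by rewrite /share_vertex eqxx. Qed.

Lemma sum_share_vertex a (c : R) : 0 <= c ->
  \sum_(b | share_vertex a b) c <= 4 * N%:R * c.
Proof.
move=> c0.
have s1 (v : 'I_N) : \sum_(b : 'I_N * 'I_N) ((b.1 == v)%:R * c) = N%:R * c.
  rewrite -(pair_bigA _ (fun i j => (i == v)%:R * c))/= (bigD1 v)//= eqxx mul1r.
  rewrite sumr_const card_ord big1 ?addr0 ?mulr_natl// => i /negbTE ->.
  by rewrite mul0r sumr_const mul0rn.
have s2 (v : 'I_N) : \sum_(b : 'I_N * 'I_N) ((b.2 == v)%:R * c) = N%:R * c.
  rewrite -(pair_bigA _ (fun i j => (j == v)%:R * c))/= exchange_big/= (bigD1 v)//= eqxx mul1r.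
  rewrite sumr_const card_ord big1 ?addr0 ?mulr_natl// => i /negbTE ->.
  by rewrite mul0r sumr_const mul0rn.
have -> : 4 * N%:R * c = \sum_(b : 'I_N * 'I_N) ((b.1 == a.1)%:R * c + (b.1 == a.2)%:R * c +
    (b.2 == a.1)%:R * c + (b.2 == a.2)%:R * c).
  by rewrite !big_split/= !s1 !s2; ring.
rewrite big_mkcond/=; apply: ler_sum => b _; rewrite /share_vertex.
by do 4 case: eqP => _; rewrite /= ?mul1r ?mul0r ?add0r ?addr0 ?lerDl ?lerDr ?addr_ge0.
Qed.

(** Doubling counts both orders; adding the N diagonal pairs gives N^2. *)
Lemma sum_ordered_pairs : 2 * \sum_(a : 'I_N * 'I_N | (a.1 < a.2)%N) (1 : R) = N%:R * (N%:R - 1).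
Proof.
have -> : \sum_(a : 'I_N * 'I_N | (a.1 < a.2)%N) (1 : R) = \sum_(i < N) \sum_(j < N) (i < j)%N%:R.
  rewrite pair_bigA/= big_mkcond/=; apply: eq_bigr => a _; by case: (a.1 < a.2)%N.
set c := LHS; have cE : c = \sum_(i < N) \sum_(j < N) (i < j)%N%:R + \sum_(i < N) \sum_(j < N) (j < i)%N%:R.
  by rewrite [X in _ + X]exchange_big/= /c mulr_natl mulr2n.
have d : \sum_(i < N) \sum_(j < N) (i == j)%:R = N%:R :> R.
  rewrite (eq_bigr (fun _ => 1)); first by rewrite sumr_const card_ord.
  move=> i _; rewrite (bigD1 i)//= eqxx big1 ?addr0// => j ji.
  by rewrite eq_sym (negbTE ji).
have t : c + \sum_(i < N) \sum_(j < N) (i == j)%:R = N%:R * N%:R.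
  rewrite cE -!big_split/= (eq_bigr (fun _ => N%:R)); first last.
    move=> i _; rewrite -!big_split/= (eq_bigr (fun _ => 1)); first by rewrite sumr_const card_ord.
    by move=> j _; rewrite -val_eqE/=; case: ltngtP; rewrite ?addr0 ?add0r.
  by rewrite sumr_const card_ord mulr_natl.
by move: t; rewrite d mulrBr mulr1 => <-; rewrite addrK.
Qed.

End PairCounting.

Section PoissonApproximation.
Context {d} {Omega : measurableType d} {R : realType} (P : probability Omega R)
  {N n p : nat} (eps : 'I_N -> Omega -> n.-tuple R) (x : 'I_N -> 'M[R]_(n, p))
  (mu : probability R R) (u0 : R).
Hypotheses (mE : forall i, measurable_fun [set: Omega] (eps i))
  (indE : mutually_independent P eps)
  (indT : forall i, mutually_independent P (fun (t : 'I_n) w => tnth (eps i w) t))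
  (lawT : forall i t A, measurable A -> P ((fun w => tnth (eps i w) t) @^-1` A) = mu A)
  (ux : forall i, (x i)^T *m x i \in unitmx)
  (u0gt0 : 0 < u0)
  (int2 : mu.-integrable setT (fun x : R => (expR (2 * u0 * `|x|))%:E))
  (mean0 : \int[mu]_x x = 0).
Variables (s y e : R).
Hypotheses (s1 : 1 <= s) (ns : n%:R = s ^+ 10) (y1 : 1 <= y) (e0 : 0 <= e) (e1 : e <= 1).
Local Notation m2 := (moment2 mu).
Local Notation C3 := (abs_moment mu 3 + 1).
Local Notation bad := (bad_bound mu u0 s).

Hypothesis tail_given : forall i j v, good (x i) (x j) s m2 C3 v ->
  `|fine (P [set w | y ^+ 2 < s ^+ 10 *
       residual_corr (x i) (x j) v (col_of_tuple (eps j w)) ^+ 2]) - 2 * tail y|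
    <= e * tail y + bad.

Let Ex i j : set Omega := [set w | corr_exceed x s y i j (eps i w) (eps j w)].
(** All ordered pairs index the family; those not increasing carry the empty event and contribute
    nothing. *)
Let A (a : 'I_N * 'I_N) : set Omega := if (a.1 < a.2)%N then Ex a.1 a.2 else set0.
Let pm : R := 3 * tail y + 4 * bad.

Let y0 : 0 < y. Proof. exact: lt_le_trans y1. Qed.
Let t0 : 0 < tail y. Proof. exact: tail_gt0. Qed.
Let bad0 : 0 <= bad.
Proof.
have s0 : 0 <= s by exact: le_trans s1.
have l0 : 0 <= linear_const mu u0 by exact: expR_ge0.
by rewrite /bad_bound !addr_ge0 ?mulr_ge0 ?expR_ge0 ?exprn_ge0.
Qed.
Let pm0 : 0 <= pm. Proof. by apply: addr_ge0; apply: mulr_ge0 => //; exact: ltW. Qed.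

Let ExC i j : Ex i j = Ex j i.
Proof. by apply/seteqP; split => w; rewrite /Ex/= /corr_exceed residual_corr_sym. Qed.

Let pair_tail i j : i != j -> `|fine (P (Ex i j)) - 2 * tail y| <= e * tail y + 4 * bad.
Proof.
exact: (corr_pair_tail P eps x mu u0 mE indE indT lawT ux u0gt0 int2 mean0 s y e s1 ns y1 e0
  tail_given).
Qed.

Let triple_tail i j k : i != j -> i != k -> j != k ->
  fine (P (Ex i j `&` Ex i k)) <= pm ^+ 2 + 2 * bad.
Proof.
move=> ij ik jk.
apply: le_trans (corr_triple_tail P eps x mu u0 mE indE indT lawT ux u0gt0 int2 mean0 s y e
  s1 ns y1 e1 tail_given i j k ij ik jk) _.
have h1 : 0 <= 3 * tail y + bad by move: t0 bad0; lra.
have h2 : 3 * tail y + bad <= pm by move: bad0; rewrite /pm; lra.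
by rewrite lerD2r lerXn2r ?nnegrE.
Qed.

(** The map [f] covers the blocks, which are Omega with a smaller sigma-algebra. *)
Let mEx {d'} {U : measurableType d'} (f : U -> Omega) i j :
  measurable_fun setT (eps i \o f) -> measurable_fun setT (eps j \o f) ->
  measurable [set u | Ex i j (f u)].
Proof. by move=> mi mj; exact: (measurable_corr_exceed x ux s y i j _ _ mi mj). Qed.

Let pA a : fine (P (A a)) <= pm.
Proof.
rewrite /A; case: ifP => [a12|_]; last by rewrite measure0.
have := pair_tail a.1 a.2; rewrite -val_eqE/= neq_ltn a12 => /(_ isT).
rewrite ler_norml => /andP[_]; rewrite /pm.
have : e * tail y <= tail y by rewrite ler_piMl// ltW.
by lra.
Qed.

(** Two distinct increasing pairs can share a vertex in four ways; symmetry of the correlation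
    brings the shared vertex to the first place each time. *)
Let pAB a b : share_vertex a b -> b != a -> fine (P (A a `&` A b)) <= pm ^+ 2 + 2 * bad.
Proof.
have q0 : 0 <= pm ^+ 2 + 2 * bad by rewrite addr_ge0 ?sqr_ge0 ?mulr_ge0.
rewrite /A; case: ifP => [a12|_]; last by rewrite set0I measure0.
case: ifP => [b12|_]; last by rewrite setI0 measure0.
case: a b a12 b12 => i j [k l] /=; rewrite /share_vertex/=.
have neq (u v : 'I_N) : (u < v)%N -> u != v by move=> uv; rewrite -val_eqE/= neq_ltn uv.
have neq' (u v : 'I_N) : (u < v)%N -> v != u by move=> uv; rewrite eq_sym; exact: neq.
move=> ij kl; rewrite xpair_eqE => /or4P[] /eqP E kil.
- subst k; apply: triple_tail; [exact: neq|exact: neq|].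
  by move: kil; rewrite eqxx/= eq_sym.
- subst k; rewrite (ExC i j); apply: triple_tail; [exact: neq'|exact: neq|].
  by apply: neq; exact: ltn_trans kl.
- subst l; rewrite (ExC k i); apply: triple_tail; [exact: neq|exact: neq'|].
  by apply: neq'; exact: ltn_trans ij.
- subst l; rewrite (ExC i j) (ExC k j); apply: triple_tail; [exact: neq'|exact: neq'|].
  by move: kil; rewrite eqxx andbT eq_sym.
Qed.

Definition corr_rate : R := \sum_(a : 'I_N * 'I_N) fine (P (A a)).

Lemma corr_rate_bound :
  `|corr_rate - N%:R * (N%:R - 1) * tail y| <= N%:R ^+ 2 * (e * tail y + 4 * bad).
Proof.
have c0 : 0 <= e * tail y + 4 * bad.
  by apply: addr_ge0; apply: mulr_ge0 => //; exact: ltW.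
have -> : N%:R * (N%:R - 1) * tail y = \sum_(a : 'I_N * 'I_N | (a.1 < a.2)%N) (2 * tail y).
  rewrite -sum_ordered_pairs mulrAC mulr_sumr.
  by apply: eq_bigr => a _; rewrite mulr1.
have -> : corr_rate = \sum_(a : 'I_N * 'I_N | (a.1 < a.2)%N) fine (P (Ex a.1 a.2)).
  rewrite [RHS]big_mkcond/=; apply: eq_bigr => a _; rewrite /A.
  by case: ifP => //; rewrite measure0.
rewrite -sumrB; apply: le_trans (ler_norm_sum _ _ _) _.
apply: (@le_trans _ _ (\sum_(a : 'I_N * 'I_N) (e * tail y + 4 * bad))).
  rewrite big_mkcond/=; apply: ler_sum => a _; case: ifP => // a12.
  by apply: pair_tail; rewrite -val_eqE/= neq_ltn a12.
by rewrite sumr_const card_prod !card_ord -(mulr_natl (e * tail y + 4 * bad)) natrM expr2.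
Qed.

Lemma corr_rate_ge0 : 0 <= corr_rate.
Proof. by apply: sumr_ge0 => a _; exact: fine_ge0. Qed.

(** At most 4 N^3 pairs of index pairs share a vertex; each contributes [pm ^+ 2] to b1 and at most
    [pm ^+ 2 + 2 * bad] to b2. *)
Lemma corr_poisson :
  `|fine (P [set w | forall i j : 'I_N, (i < j)%N ->
       ~ corr_exceed x s y i j (eps i w) (eps j w)]) - expR (- corr_rate)|
    <= 4 * N%:R ^+ 3 * (2 * pm ^+ 2 + 2 * bad).
Proof.
pose S (a : 'I_N * 'I_N) : pred 'I_N := pred2 a.1 a.2.
have mA a (S' : pred 'I_N) : (forall v, S a v -> S' v) -> @measurable _ (block eps S') (A a).
  move=> SS'; rewrite /A; case: ifP => _; last exact: measurable0.
  have h1 : S' a.1 by apply: SS'; rewrite /S/= eqxx.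
  have h2 : S' a.2 by apply: SS'; rewrite /S/= eqxx orbT.
  apply: (mEx (idfun : block eps S' -> Omega)); exact: measurable_block_X.
have BS a b : ~~ share_vertex a b -> forall v, S b v -> ~~ S a v.
  rewrite /share_vertex !negb_or => /and4P[h1 h2 h3 h4] v /orP[] /eqP ->;
    by rewrite /S/= negb_or ?h1 ?h2 ?h3 ?h4.
have := chen_stein_blocks P eps mE indE A S share_vertex mA share_vertex_refl BS.
rewrite (_ : [set w | forall a, ~ A a w] = [set w | forall i j : 'I_N, (i < j)%N ->
       ~ corr_exceed x s y i j (eps i w) (eps j w)]); last first.
  apply/seteqP; split => w /= h.
    by move=> i j ij; have := h (i, j); rewrite /A/= ij.
  by move=> [i j]; rewrite /A/=; case: ifP => [ij|_ []]; exact: (h i j ij).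
move=> h; apply: le_trans h _.
have q0 : 0 <= pm ^+ 2 + 2 * bad by rewrite addr_ge0 ?sqr_ge0 ?mulr_ge0.
have cnt (c : R) : 0 <= c -> \sum_(a : 'I_N * 'I_N) \sum_(b | share_vertex a b) c <= 4 * N%:R ^+ 3 * c.
  move=> c0; apply: (@le_trans _ _ (\sum_(a : 'I_N * 'I_N) (4 * N%:R * c))).
    by apply: ler_sum => a _; exact: sum_share_vertex.
  rewrite sumr_const card_prod !card_ord -(mulr_natl (4 * N%:R * c)) natrM.
  by rewrite le_eqVlt; apply/orP; left; apply/eqP; ring.
have b1 : chen_stein_b1 P A share_vertex <= 4 * N%:R ^+ 3 * pm ^+ 2.
  apply: le_trans (cnt _ (sqr_ge0 _)); apply: ler_sum => a _; apply: ler_sum => b _.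
  by rewrite expr2; apply: ler_pM => //; exact: fine_ge0.
have b2 : chen_stein_b2 P A share_vertex <= 4 * N%:R ^+ 3 * (pm ^+ 2 + 2 * bad).
  apply: le_trans (cnt _ q0); apply: ler_sum => a _.
  rewrite [leRHS]big_mkcond/= [leLHS]big_mkcond/=; apply: ler_sum => b _.
  by case: (boolP (share_vertex a b)) => //= ab; case: eqP => //= /eqP ba; exact: pAB.
by rewrite (_ : 2 * pm ^+ 2 + 2 * bad = pm ^+ 2 + (pm ^+ 2 + 2 * bad)) 1?mulrDr ?lerD//; ring.
Qed.

End PoissonApproximation.

(** * Limits *)

Section Asymptotics.
Context {R : realType} (a : R).

(* T * L_N ^+ 2 <= level2 a N is the event whose limit probability is F a. *)
Definition level2 (N : nat) : R := 4 * ln N%:R - ln (ln N%:R) + a.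

Lemma ln_nat_large (M : R) : \forall N \near \oo, M <= ln (N%:R : R).
Proof.
near=> N; have h : expR M <= N%:R.
  by near: N; exact: nbhs_infty_ger.
by rewrite -[leLHS]expRK ler_ln// posrE ?expR_gt0// (lt_le_trans (expR_gt0 M)).
Unshelve. all: by end_near. Qed.

Lemma ln_le_sqrt (l : R) : 0 < l -> ln l <= 2 * Num.sqrt l.
Proof.
move=> l0; have q0 : 0 < Num.sqrt l by rewrite sqrtr_gt0.
rewrite -[leRHS]expRK ler_ln ?posrE ?expR_gt0//.
rewrite -{1}(sqr_sqrtr (ltW l0)) mulr_natl mulr2n expRD expr2.
have h : Num.sqrt l <= expR (Num.sqrt l) by apply: le_trans (expR_ge1Dx _); rewrite lerDr.
by apply: ler_pM => //; exact: ltW.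
Qed.

(** With l = log N, the distance to 4 is |log l - a| / l, and log l <= 2 sqrt(l). *)
Lemma level2_ratio : level2 N / ln N%:R @[N --> \oo] --> (4 : R).
Proof.
apply/cvgrPdist_le => e e0; near=> N.
have l1 : 1 <= ln (N%:R : R) by near: N; exact: ln_nat_large.
have le : ((2 + `|a|) / e) ^+ 2 <= ln (N%:R : R) by near: N; exact: ln_nat_large.
set l : R := ln N%:R in l1 le *.
have l0 : 0 < l by exact: lt_le_trans l1.
have q0 : 0 < Num.sqrt l by rewrite sqrtr_gt0.
have q1 : 1 <= Num.sqrt l by rewrite -[leLHS]sqrtr1 ler_wsqrtr.
have c0 : 0 <= (2 + `|a|) / e by rewrite divr_ge0 ?addr_ge0// ltW.
have qe : (2 + `|a|) / e <= Num.sqrt l by rewrite -[leLHS](ger0_norm c0) -sqrtr_sqr ler_wsqrtr.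
have -> : 4 - level2 N / l = (ln l - a) / l by rewrite /level2 -/l; field; rewrite gt_eqF.
rewrite normrM normfV (gtr0_norm l0) ler_pdivrMr//.
apply: le_trans (ler_normB _ _) _.
have ll : `|ln l| <= 2 * Num.sqrt l.
  by rewrite ger0_norm ?ln_ge0//; exact: ln_le_sqrt.
have h1 : `|a| <= `|a| * Num.sqrt l by rewrite ler_peMr.
have h2 : 2 + `|a| <= e * Num.sqrt l by move: qe; rewrite ler_pdivrMr// mulrC.
have h3 := ler_wpM2r (ltW q0) h2.
have lq : l = Num.sqrt l * Num.sqrt l by rewrite -expr2 sqr_sqrtr ?(ltW l0).
rewrite -mulrA -lq in h3; apply: le_trans h3.
by move: ll h1; rewrite mulrDl; lra.
Unshelve. all: by end_near. Qed.

Lemma level2_bounds : \forall N \near \oo, 3 * ln N%:R <= level2 N <= 5 * ln N%:R.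
Proof.
have := level2_ratio => /cvgrPdist_le/(_ 1 ltr01) h.
near=> N.
have l1 : 1 <= ln (N%:R : R) by near: N; exact: ln_nat_large.
have l0 : 0 < ln (N%:R : R) by exact: lt_le_trans l1.
have : `|4 - level2 N / ln N%:R| <= 1 by near: N.
rewrite ler_norml => /andP[h1 h2].
have e : level2 N = level2 N / ln N%:R * ln N%:R by rewrite divfK// gt_eqF.
rewrite e !ler_pM2r//; apply/andP; split; move: h1 h2; lra.
Unshelve. all: by end_near. Qed.

(** The level v is made so that exp(- v/2) = N^-2 sqrt(log N) exp(- a/2). The root cancels against
    sqrt(v) ~ 2 sqrt(log N) in [tail], and 2 sqrt(2 pi) = sqrt(8 pi). *)
Lemma tail_level : N%:R ^+ 2 * tail (Num.sqrt (level2 N)) @[N --> \oo] -->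
  (expR (- a / 2) / Num.sqrt (8 * pi) : R).
Proof.
pose c : R := expR (- a / 2) / Num.sqrt (2 * pi).
have s2 := @sqrt2pi_gt0 R.
have -> : expR (- a / 2) / Num.sqrt (8 * pi) = c / Num.sqrt 4.
  rewrite /c (_ : 8 * pi = (2 * pi) * 4 :> R); last by ring.
  by rewrite sqrtrM ?mulr_ge0 ?pi_ge0// invfM mulrA.
have : c / Num.sqrt (level2 N / ln N%:R) @[N --> \oo] --> c / Num.sqrt 4.
  apply: cvgM; first exact: cvg_cst.
  apply: cvgV; first by rewrite gt_eqF// sqrtr_gt0.
  by apply: continuous_cvg level2_ratio; exact: sqrt_continuous.
apply: cvg_trans; apply: near_eq_cvg; near=> N.
have l1 : 1 <= ln (N%:R : R) by near: N; exact: ln_nat_large.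
have : 3 * ln N%:R <= level2 N <= 5 * ln N%:R by near: N; exact: level2_bounds.
set l : R := ln N%:R in l1 *; move=> /andP[v3 _].
have l0 : 0 < l by exact: lt_le_trans l1.
have v0 : 0 < level2 N by apply: lt_le_trans v3; exact: mulr_gt0.
have N0 : 0 < (N%:R : R).
  by rewrite ltNge; apply/negP => h; move: l0; rewrite /l ln0// ltxx.
have q0 : 0 < Num.sqrt l by rewrite sqrtr_gt0.
have w0 : 0 < Num.sqrt (level2 N) by rewrite sqrtr_gt0.
rewrite /tail /phi sqr_sqrtr ?(ltW v0)//.
have -> : expR (- (level2 N / 2)) = N%:R ^- 2 * Num.sqrt l * expR (- a / 2).
  rewrite -[N%:R]lnK ?posrE// -/l -[Num.sqrt l]lnK ?posrE//.
  have -> : ln (Num.sqrt l) = ln l / 2.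
    have : ln l = ln (Num.sqrt l) + ln (Num.sqrt l).
      by rewrite -lnM ?posrE// -expr2 sqr_sqrtr// ltW.
    by move=> ->; field.
  by rewrite -expRM_natl -expRN -!expRD; congr expR; rewrite /level2 -/l; field.
rewrite sqrtrM ?(ltW v0)// sqrtrV ?(ltW l0)// /c; field.
by rewrite !gt_eqF.
Unshelve. all: by end_near. Qed.

End Asymptotics.

(** * Transfer of the moment hypotheses to the common law of the entries *)

Section Law.
Context {d} {Omega : measurableType d} {R : realType} (P : probability Omega R)
  (X : Omega -> R) (mu : probability R R).
Hypotheses (mX : measurable_fun setT X)
  (lawX : forall A, measurable A -> P (X @^-1` A) = mu A).

Let law (g : R -> \bar R) : measurable_fun setT g -> (forall x, 0 <= g x)%E ->
  (\int[P]_w g (X w) = \int[mu]_x g x)%E.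
Proof. exact: (law_integral P (fun _ : unit => X) mu (fun=> mX) (fun=> lawX) tt g). Qed.

Lemma law_integrable_exp (omega : R) :
  ('E_P[fun w => expR (omega * `|X w|)%R] < +oo)%E ->
  mu.-integrable setT (fun x : R => (expR (2 * (omega / 2) * `|x|))%:E).
Proof.
have -> : 2 * (omega / 2) = omega by field.
rewrite unlock => h.
have mg : measurable_fun setT (fun x : R => (expR (omega * `|x|))%:E).
  apply/measurable_EFinP; apply: measurableT_comp => //; exact: measurable_funM.
have g0 (x : R) : (0 <= (expR (omega * `|x|))%:E)%E by rewrite lee_fin expR_ge0.
apply/integrableP; split => //.
by under eq_integral do rewrite gee0_abs//; rewrite -law.
Qed.

Lemma law_mean : ('E_P[X] = 0)%E -> \int[mu]_x x = 0.
Proof.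
rewrite unlock /Rintegral => h; suff -> : (\int[mu]_x x%:E = 0)%E by [].
have mE : measurable_fun [set: R] (EFin : R -> \bar R) by exact: measurable_funTS.
(* The transfer to [mu] is available for nonnegative functions, hence the split into positive and
   negative parts. *)
rewrite -h integralE [RHS]integralE; congr (_ - _)%E.
  rewrite -(law _ (measurable_funepos mE) (fun=> funepos_ge0 _ _)).
  by apply: eq_integral => w _; rewrite !funeposE.
rewrite -(law _ (measurable_funeneg mE) (fun=> funeneg_ge0 _ _)).
by apply: eq_integral => w _; rewrite !funenegE.
Qed.

Lemma law_moment2_gt0 (u0 : R) : 0 < u0 ->
  mu.-integrable setT (fun x : R => (expR (2 * u0 * `|x|))%:E) ->
  ('E_P[X] = 0)%E -> (0 < 'V_P[X])%E -> 0 < moment2 mu.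
Proof.
move=> u00 int2 EX.
have -> : ('V_P[X] = \int[mu]_x (x ^+ 2)%:E)%E.
  rewrite /variance unlock EX/= unlock -law//.
  - by apply: eq_integral => w _; rewrite -[LHS]/((X w - 0) * (X w - 0))%:E subr0 expr2.
  - by apply/measurable_EFinP; exact: measurable_funX.
  - by move=> x; rewrite lee_fin sqr_ge0.
by rewrite (EFin_Rintegral mu _ (integrable_sqr mu u0 u00 int2)) lte_fin.
Qed.

End Law.

Section PoissonLimit.
Context {R : realType}.

Lemma expRN_lipschitz (a b : R) : 0 <= a -> 0 <= b ->
  `|expR (- a) - expR (- b)| <= `|a - b|.
Proof.
wlog ab : a b / a <= b => [h a0 b0|a0 _].
  have [ab|/ltW ba] := leP a b; first exact: h.
  by rewrite distrC (distrC a); exact: h.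
rewrite ger0_norm ?subr_ge0 ?ler_expR ?lerN2// ler0_norm ?subr_le0// opprB.
have -> : expR (- b) = expR (- a) * expR (- (b - a)) by rewrite -expRD; congr expR; ring.
have h1 : 1 - (b - a) <= expR (- (b - a)) by exact: expR_ge1Dx.
have h2 : expR (- a) <= 1 by rewrite -[leRHS]expR0 ler_expR oppr_le0.
have h3 := expR_ge0 (- a).
have h4 : 0 <= b - a by rewrite subr_ge0.
apply: (@le_trans _ _ (expR (- a) * (b - a))).
  by have := ler_wpM2l h3 h1; rewrite mulrBr mulr1; lra.
by rewrite ler_piMl.
Qed.

Lemma le_three_quarters (a b c z : R) : 0 < z -> a <= z / 4 -> b <= z / 4 -> c <= z / 4 ->
  a + b + c <= z.
Proof. by move=> *; lra. Qed.

(** The arithmetic of the limit, with n for N, [Lam] the sum of the exceedance probabilities and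
    [lam] its limit. Since t is of order n^-2 and [bad] of order n^-4, the Chen-Stein error n^3 t^2
    + n^3 bad is O(1/n); so is the n t lost between n^2 and n (n - 1). *)
Lemma poisson_limit_bound (n t bad Pr Lam lam K e e' : R) : 1 <= n -> 0 <= t -> 0 <= bad ->
  0 <= Lam -> 0 <= lam -> 0 <= e -> 0 <= K ->
  n ^+ 4 * bad <= K -> `|n ^+ 2 * t - lam| <= e' -> e' <= 1 ->
  `|Pr - expR (- Lam)| <= 4 * n ^+ 3 * (2 * (3 * t + 4 * bad) ^+ 2 + 2 * bad) ->
  `|Lam - n * (n - 1) * t| <= n ^+ 2 * (e * t + 4 * bad) ->
  `|Pr - expR (- lam)| <= (8 * (3 * (lam + 1) + 4 * K) ^+ 2 + 12 * K + lam + 1) / n +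
     e * (lam + 1) + e'.
Proof.
move=> n1 t0 b0 L0 l0 e0 K0 hK ht e'1 hP hL.
have n0 : 0 < n by exact: lt_le_trans n1.
have n2 : 0 <= n ^+ 2 by exact: sqr_ge0.
have t1 : n ^+ 2 * t <= lam + 1.
  by move: ht; rewrite ler_norml => /andP[_ h]; move: h e'1; lra.
have q0 : 0 <= 3 * t + 4 * bad by lra.
have b2 : n ^+ 2 * bad <= n ^+ 3 * bad by rewrite ler_wpM2r// ler_weXn2l.
have b3 : n ^+ 3 * bad <= n ^+ 4 * bad by rewrite ler_wpM2r// ler_weXn2l.
have b3n : n ^+ 3 * bad <= K / n.
  by rewrite ler_pdivlMr// (_ : n ^+ 3 * bad * n = n ^+ 4 * bad)//; ring.
have q1 : n ^+ 2 * (3 * t + 4 * bad) <= 3 * (lam + 1) + 4 * K.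
  by move: t1 b2 b3 hK; rewrite mulrDr !(mulrCA (n ^+ 2)); lra.
have q2 : n ^+ 3 * (3 * t + 4 * bad) ^+ 2 <= (3 * (lam + 1) + 4 * K) ^+ 2 / n.
  rewrite ler_pdivlMr// (_ : n ^+ 3 * _ ^+ 2 * n = (n ^+ 2 * (3 * t + 4 * bad)) ^+ 2); last by ring.
  have q3 : 0 <= n ^+ 2 * (3 * t + 4 * bad) by exact: mulr_ge0.
  by rewrite lerXn2r ?nnegrE ?(le_trans q3 q1).
have tn : n * t <= (lam + 1) / n.
  by rewrite ler_pdivlMr// mulrC mulrA -expr2.
have et : e * (n ^+ 2 * t) <= e * (lam + 1) by exact: ler_wpM2l.
have LL : `|Lam - lam| <= e * (lam + 1) + 4 * (K / n) + e' + (lam + 1) / n.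
  have nt0 : 0 <= n * t by rewrite mulr_ge0// ltW.
  rewrite (_ : Lam - lam = (Lam - n * (n - 1) * t) + ((n ^+ 2 * t - lam) - n * t)); last by ring.
  apply: le_trans (ler_normD _ _) _; apply: le_trans (lerD hL (ler_normB _ _)) _.
  rewrite (ger0_norm nt0) (_ : n ^+ 2 * (e * t + 4 * bad) = e * (n ^+ 2 * t) + 4 * (n ^+ 2 * bad)); last by ring.
  by move: et ht tn b2 b3n; lra.
have E := expRN_lipschitz Lam lam L0 l0.
rewrite (_ : Pr - expR (- lam) = (Pr - expR (- Lam)) + (expR (- Lam) - expR (- lam))); last by ring.
apply: le_trans (ler_normD _ _) _.
rewrite (_ : 4 * n ^+ 3 * _ = 8 * (n ^+ 3 * (3 * t + 4 * bad) ^+ 2) + 8 * (n ^+ 3 * bad)) in hP; last by ring.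
rewrite (_ : (8 * _ + _ + _ + _) / n = 8 * ((3 * (lam + 1) + 4 * K) ^+ 2 / n) + 12 * (K / n) + (lam + 1) / n); last by ring.
by move: hP LL E q2 b3n; lra.
Qed.

End PoissonLimit.

Section MaxCorr.
Context {R : realType} {N n p : nat} (x : 'I_N -> 'M[R]_(n, p)).

(** Both directions pass through r <= sqrt(c / k), a form in which a maximum can be compared term by
    term; the default value 0 is harmless because that root is nonnegative. *)
Lemma max_corr_leP (e : 'I_N -> 'cV[R]_n) (k c : R) : 0 < k -> 0 <= c ->
  k * max_residual_corr x e ^+ 2 <= c <->
  forall i j : 'I_N, (i < j)%N -> ~ c < k * residual_corr (x i) (x j) (e i) (e j) ^+ 2.
Proof.
move=> k0 c0.
have kc (r : R) : 0 <= r -> (k * r ^+ 2 <= c) = (r <= Num.sqrt (c / k)).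
  move=> r0; rewrite mulrC -ler_pdivlMr//.
  by rewrite -[in RHS](ger0_norm r0) -sqrtr_sqr ler_sqrt// divr_ge0// ltW.
have M0 : 0 <= max_residual_corr x e by exact: bigmax_ge_id.
rewrite kc//; split => [/bigmax_leP[_ h] i j ij|h].
  apply/negP; rewrite -leNgt -(real_normK (num_real _)) kc//.
  exact: (h (i, j) ij).
apply/bigmax_leP; split; first exact: sqrtr_ge0.
move=> [i j] /= ij; rewrite -kc// real_normK ?num_real// leNgt; apply/negP; exact: h.
Qed.

End MaxCorr.

Lemma measurable_no_exceed {d} {Omega : measurableType d} {R : realType} {N n p : nat}
    (P : probability Omega R) (eps : 'I_N -> Omega -> n.-tuple R) (x : 'I_N -> 'M[R]_(n, p))
    (s y : R) :
  (forall i, measurable_fun [set: Omega] (eps i)) ->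
  (forall i, (x i)^T *m x i \in unitmx) ->
  measurable [set w | forall i j : 'I_N, (i < j)%N ->
    ~ corr_exceed x s y i j (eps i w) (eps j w)].
Proof.
move=> mE ux.
pose A (a : 'I_N * 'I_N) : set Omega :=
  if (a.1 < a.2)%N then [set w | corr_exceed x s y a.1 a.2 (eps a.1 w) (eps a.2 w)] else set0.
have mA a : measurable (A a).
  by rewrite /A; case: ifP => // _; exact: measurable_corr_exceed.
have PA a : (P (A a) <= 1%:E)%E by exact: probability_le1.
have [mU _] := pr_union_fin P _ A 1 mA PA.
rewrite (_ : [set w | _] = ~` [set w | exists a, A a w]); first exact: measurableC.
apply/seteqP; split => w /= h.
  by move=> [[i j]]; rewrite /A/=; case: ifP => // ij; exact: h.
by move=> i j ij ex; apply: h; exists (i, j); rewrite /A/= ij.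
Qed.

Theorem theorem4 (R : realType) (p : nat) (T : nat -> nat)
  (x : forall N, 'I_N -> 'M[R]_(T N, p))
  (d : nat -> measure_display) (Omega : forall N, measurableType (d N))
  (P : forall N, probability (Omega N) R)
  (eps : forall N, 'I_N -> {RV (P N) >-> (T N).-tuple R})
  (mu : probability R R) (omega : R)
  (hT : forall N, (p < T N)%N)
  (hx : forall N (i : 'I_N), (x N i)^T *m x N i \in unitmx)
  (hlog : (fun N : nat => ln N%:R : R) =o_\oo
            (fun N : nat => (T N)%:R `^ (5%:R^-1) : R))
  (hvec : forall N, iid (P N) (fun i : 'I_N => eps N i))
  (hent : forall N (i : 'I_N),
    iid (P N) (fun (t : 'I_(T N)) w => tnth (eps N i w) t))
  (hlaw : forall N (i : 'I_N) (t : 'I_(T N)) (A : set R),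
    measurable A -> P N [set w | A (tnth (eps N i w) t)] = mu A)
  (hcont : forall N (i : 'I_N) (t : 'I_(T N)),
    continuous_rv (P N) (fun w => tnth (eps N i w) t))
  (hmean : forall N (i : 'I_N) (t : 'I_(T N)),
    ('E_(P N)[fun w => tnth (eps N i w) t] = 0)%E)
  (hvar : forall N (i : 'I_N) (t : 'I_(T N)),
    (0 < 'V_(P N)[fun w => tnth (eps N i w) t])%E)
  (homega : 0 < omega)
  (hexp : forall N (i : 'I_N) (t : 'I_(T N)),
    ('E_(P N)[fun w => expR (omega * `|tnth (eps N i w) t|)%R] < +oo)%E) :
  converges_weakly_to_df P
    (fun N w =>
       (T N)%:R * max_residual_corr (x N) (fun i => col_of_tuple (eps N i w)) ^+ 2
       - 4%:R * ln N%:R + ln (ln N%:R))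
    (fun y => expR (- (expR (- y / 2%:R) / Num.sqrt (8%:R * pi)))).

Proof.
move=> y0 _.
have T0 N : (0 < T N)%N by exact: leq_ltn_trans (leq0n p) (hT N).
have TR N : 0 < (T N)%:R :> R by rewrite ltr0n.
have mE N i : measurable_fun setT (eps N i) by exact: measurable_funPT.
have mX N i t : measurable_fun setT (fun w => tnth (eps N i w) t).
  exact: measurableT_comp (measurable_tnth t) (mE N i).
have indE N : mutually_independent (P N) (fun i => eps N i : Omega N -> _) by have [] := hvec N.
have indT N i : mutually_independent (P N) (fun (t : 'I_(T N)) w => tnth (eps N i w) t).
  by have [] := hent N i.
pose u0 := omega / 2; have u00 : 0 < u0 by rewrite divr_gt0.
(* The moments of [mu] are read off a single entry, in the sample with N = 1. *)
pose i1 : 'I_1 := ord0; pose t1 : 'I_(T 1) := Ordinal (T0 1%N).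
have int2 : mu.-integrable setT (fun x : R => (expR (2 * u0 * `|x|))%:E).
  exact: (law_integrable_exp (P 1%N) _ mu (mX 1%N i1 t1) (hlaw 1%N i1 t1) omega (hexp 1%N i1 t1)).
have mean0 : \int[mu]_x x = 0.
  exact: (law_mean (P 1%N) _ mu (mX 1%N i1 t1) (hlaw 1%N i1 t1) (hmean 1%N i1 t1)).
have m20 : 0 < moment2 mu.
  exact: (law_moment2_gt0 (P 1%N) _ mu (mX 1%N i1 t1) (hlaw 1%N i1 t1) u0 u00 int2
    (hmean 1%N i1 t1) (hvar 1%N i1 t1)).
set lam : R := expR (- y0 / 2) / Num.sqrt (8 * pi).
have lam0 : 0 <= lam by rewrite divr_ge0 ?expR_ge0.
pose s N : R := (T N)%:R `^ 10^-1.
have s10 N : (T N)%:R = s N ^+ 10.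
  by rewrite -powR_mulrn ?powR_ge0// -powRrM mulVf// powRr1// ltW.
have s2 N : s N ^+ 2 = (T N)%:R `^ 5^-1.
  by rewrite -powR_mulrn ?powR_ge0// -powRrM; congr (_ `^ _); field.
pose y N : R := Num.sqrt (level2 y0 N).
pose E N : set (Omega N) := [set w | forall i j : 'I_N, (i < j)%N ->
  ~ corr_exceed (x N) (s N) (y N) i j (eps N i w) (eps N j w)].
have mEN N : measurable (E N) by exact: measurable_no_exceed.
(* The growth hypothesis in terms of s: log N = o(s^2). *)
have lnT c : 0 < c -> \forall N \near \oo, ln (N%:R : R) <= c * s N ^+ 2.
  move=> c0; have := hlog => /eqoP /(_ c c0) h; near=> N.
  rewrite s2.
  apply: le_trans (ler_norm _) _; apply: le_trans (_ : c * `|(T N)%:R `^ 5^-1| <= _).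
    by near: N.
  by rewrite ger0_norm// powR_ge0.
have level_ge0 : \forall N \near \oo, 0 <= level2 y0 N.
  near=> N; have : 3 * ln N%:R <= level2 y0 N <= 5 * ln N%:R by near: N; exact: level2_bounds.
  move=> /andP[h _]; apply: le_trans h; rewrite mulr_ge0//.
  by near: N; exact: ln_nat_large.
have eventE : \forall N \near \oo,
    [set w | (T N)%:R * max_residual_corr (x N) (fun i => col_of_tuple (eps N i w)) ^+ 2
      - 4%:R * ln N%:R + ln (ln N%:R) <= y0] = E N.
  near=> N; have l0 : 0 <= level2 y0 N by near: N.
  apply/seteqP; split => w /=.
    move=> h; have : (T N)%:R * max_residual_corr (x N) (fun i => col_of_tuple (eps N i w)) ^+ 2
        <= level2 y0 N by rewrite /level2; move: h; lra.
    move=> /(max_corr_leP (x N) _ _ _ (TR N) l0) h2 i j ij.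
    by have := h2 i j ij; rewrite /corr_exceed sqr_sqrtr// s10.
  move=> h; suff : (T N)%:R * max_residual_corr (x N) (fun i => col_of_tuple (eps N i w)) ^+ 2
        <= level2 y0 N by rewrite /level2; lra.
  apply/(max_corr_leP (x N) _ _ _ (TR N) l0) => i j ij.
  by have := h i j ij; rewrite /corr_exceed sqr_sqrtr// s10.
apply/fine_cvgP; split.
  by apply: filterS eventE => M EM; rewrite EM fin_num_measure.
apply/cvgrPdist_le => z z0.
have [K [kappa [K0 kappa0 bd]]] := bad_bound_decay mu u0 u00.
have lam1 : 0 < lam + 1 by rewrite ltr_wpDl.
(* The final error is Q / N + e (lam + 1) + e'; each of the three is kept below z / 4. *)
pose e := Num.min 1 (z / (4 * (lam + 1))).
have e0 : 0 < e by rewrite lt_min ltr01 divr_gt0// mulr_gt0.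
have e1 : e <= 1 by rewrite ge_min lexx.
have ez : e * (lam + 1) <= z / 4.
  have : e <= z / (4 * (lam + 1)) by rewrite ge_min lexx orbT.
  by rewrite invfM mulrA ler_pdivlMr.
pose e' := Num.min 1 (z / 4).
have e'0 : 0 < e' by rewrite lt_min ltr01 divr_gt0.
have e'1 : e' <= 1 by rewrite ge_min lexx.
have e'z : e' <= z / 4 by rewrite ge_min lexx orbT.
have [A [A1 given]] := corr_tail_given mu u0 p u00 int2 mean0 m20 e e0.
have A0 : 0 < A by exact: lt_le_trans A1.
pose Q := 8 * (3 * (lam + 1) + 4 * K) ^+ 2 + 12 * K + lam + 1.
near=> N.
have AE : [set w | (T N)%:R * max_residual_corr (x N) (fun i => col_of_tuple (eps N i w)) ^+ 2
      - 4%:R * ln N%:R + ln (ln N%:R) <= y0] = E N by near: N.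
have ln1 : 1 <= ln (N%:R : R) by near: N; exact: ln_nat_large.
have lnA : A ^+ 2 <= ln (N%:R : R) by near: N; exact: ln_nat_large.
have lev : 3 * ln N%:R <= level2 y0 N <= 5 * ln N%:R by near: N; exact: level2_bounds.
(* Makes N^4 at most exp(kappa s^2), so that N^4 [bad_bound] stays below [K]. *)
have lnk : ln (N%:R : R) <= kappa / 4 * s N ^+ 2 by near: N; apply: lnT; rewrite divr_gt0.
(* Together with y^2 <= 5 log N this gives A y <= s. *)
have lnA2 : ln (N%:R : R) <= (5 * A ^+ 2)^-1 * s N ^+ 2.
  by near: N; apply: lnT; rewrite invr_gt0 mulr_gt0// exprn_gt0.
have tl : `|N%:R ^+ 2 * tail (y N) - lam| <= e'.
  rewrite distrC; near: N; have := tail_level y0 => /cvgrPdist_le; exact.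
have NQ : Q / (z / 4) <= N%:R by near: N; exact: nbhs_infty_ger.
have N0 : 0 < (N%:R : R).
  by rewrite ltNge; apply/negP => h; move: ln1; rewrite ln0// ler10.
have N1 : 1 <= (N%:R : R) by rewrite ler1n -(ltr0n R).
have s0 : 0 <= s N by exact: powR_ge0.
case/andP: lev => lev3 lev5.
have lev0 : 0 <= level2 y0 N by apply: le_trans lev3; rewrite mulr_ge0// (le_trans _ ln1).
have Ay : A <= y N.
  rewrite -[leLHS](ger0_norm (ltW A0)) -sqrtr_sqr ler_wsqrtr//.
  by apply: le_trans lev3; apply: le_trans lnA _; rewrite ler_peMl// ?(le_trans _ ln1)// ler1n.
have Ays : A * y N <= s N.
  rewrite -(ler_pXn2r (ltn0Sn 1)) ?nnegrE ?mulr_ge0 ?sqrtr_ge0 ?(ltW A0)//.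
  rewrite exprMn sqr_sqrtr//.
  apply: (@le_trans _ _ (A ^+ 2 * (5 * ln N%:R))); first by rewrite ler_wpM2l ?sqr_ge0.
  by move: lnA2; rewrite ler_pdivlMl ?mulr_gt0 ?exprn_gt0// => h; rewrite mulrCA mulrA.
have y1 : 1 <= y N by exact: le_trans Ay.
have s1 : 1 <= s N.
  apply: le_trans Ays; apply: le_trans A1 _; rewrite ler_peMr// ltW//.
have bad0 : 0 <= bad_bound mu u0 (s N).
  have l0 : 0 <= linear_const mu u0 by exact: expR_ge0.
  by rewrite /bad_bound !addr_ge0 ?mulr_ge0 ?expR_ge0 ?exprn_ge0.
have NK : N%:R ^+ 4 * bad_bound mu u0 (s N) <= K.
  apply: le_trans (ler_wpM2l (exprn_ge0 4 (ltW N0)) (bd (s N) s1)) _.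
  rewrite mulrCA ler_piMr// -[X in X ^+ 4]lnK ?posrE// -expRM_natl -expRD -[leRHS]expR0 ler_expR.
  by rewrite subr_le0; move: lnk; rewrite mulrAC ler_pdivlMr// mulrC.
have tg i j v : good (x N i) (x N j) (s N) (moment2 mu) (abs_moment mu 3 + 1) v ->
  `|fine (P N [set w | y N ^+ 2 < s N ^+ 10 *
       residual_corr (x N i) (x N j) v (col_of_tuple (eps N j w)) ^+ 2]) - 2 * tail (y N)|
    <= e * tail (y N) + bad_bound mu u0 (s N).
  move=> gv; exact: (given _ (Omega N) (P N) (T N) (fun t w => tnth (eps N j w) t) (mX N j)
    (indT N j) (hlaw N j) (x N i) (x N j) (s N) (y N) v (hx N i) (hx N j) (s10 N) Ay Ays gv).
have pois := corr_poisson (P N) (fun i => eps N i : Omega N -> _) (x N) mu u0 (mE N) (indE N)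
  (indT N) (hlaw N) (hx N) u00 int2 mean0 (s N) (y N) e s1 (s10 N) y1 (ltW e0) e1 tg.
have rate := corr_rate_bound (P N) (fun i => eps N i : Omega N -> _) (x N) mu u0 (mE N) (indE N)
  (indT N) (hlaw N) (hx N) u00 int2 mean0 (s N) (y N) e s1 (s10 N) y1 (ltW e0) tg.
have t0 : 0 <= tail (y N) by apply/ltW/tail_gt0; exact: lt_le_trans y1.
have L0 := corr_rate_ge0 (P N) (fun i => eps N i : Omega N -> _) (x N) (s N) (y N).
rewrite /= AE distrC.
apply: le_trans (poisson_limit_bound _ _ _ _ _ _ K e e' N1 t0 bad0 L0 lam0 (ltW e0) K0 NK tl e'1
  pois rate) _.
have : Q / N%:R <= z / 4.
  by move: NQ; rewrite !ler_pdivrMr ?divr_gt0// mulrC.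
by rewrite -/Q => QN; exact: le_three_quarters.
Unshelve. all: by end_near. Qed.
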